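(* Fix an integer $m\ge 2$ and consider either the Gaussian model or the Erdős–Rényi model for $m$ correlated graphs $X=(X^1,\dots,X^m)$ with latent alignment $\pi^\star$, and let $Y$ be the aggregate matrix (all defined in the context). (a) If exact (respectively almost-exact, partial) recovery of $\pi^\star_2$ from $(X^1,Y)$ is impossible, then exact (respectively almost-exact, partial) recovery of $\pi^\star$ from $X$ is impossible. (b) If partial recovery of $\pi^\star_2$ from $(X^1,Y)$ is intractable, then partial recovery of $\pi^\star$ from $X$ is intractable.
   Context: Let $m\ge2$ be fixed, $n\to\infty$; model parameters may depend on $n$. Let $\mathcal{E}_n=\binom{[n]}{2}$ be the set of unordered pairs from $[n]$, $N=\binom n2$, and $\mathfrak{S}_n$ the set of permutations of $[n]$. A permutation $\tau$ acts on $\mathcal{E}_n$ by $\tau(\{i,j\})=\{\tau(i),\tau(j)\}$. An alignment is an $m$-tuple $\pi=(\pi_1,\dots,\pi_m)$ of permutations with $\pi_1=\mathrm{Id}$; put $\pi_{k\ell}=\pi_\ell\circ\pi_k^{-1}$. The observation $X=(X^1,\dots,X^m)$ consists of $m$ random symmetric $n\times n$ matrices with zero diagonal. Under the law $\mathsf{P}$ there is a uniformly distributed random alignment $\pi^\star$ such that, conditioned on $\pi^\star$, the $m$-vectors $(X^1_e,X^2_{\pi^\star_2(e)},\dots,X^m_{\pi^\star_m(e)})$, $e\in\mathcal{E}_n$, are mutually independent, with the following distribution. Gaussian model ($\rho\in[0,1]$): each vector is jointly Gaussian with mean zero, unit variances and all pairwise covariances $\rho$. Erdős–Rényi model ($p,s\in[0,1]$):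 $X^k_{\pi^\star_k(e)}=X^0_e\,\xi^k_e$ with $X^0_e\sim\mathrm{Bern}(p)$, $\xi^k_e\sim\mathrm{Bern}(s)$ all mutually independent (and independent of $\pi^\star$). Aggregate matrix: in the Gaussian model $Y_e=X^2_e+X^3_{\pi^\star_{23}(e)}+\cdots+X^m_{\pi^\star_{2m}(e)}$; in the Erdős–Rényi model $Y_e=X^2_e\vee X^3_{\pi^\star_{23}(e)}\vee\cdots\vee X^m_{\pi^\star_{2m}(e)}$, for $e\in\mathcal E_n$. Overlaps: for alignments, $\mathrm{ov}(\pi,\pi')=\frac1n|\{i\in[n]:\pi_k(i)=\pi'_k(i)\text{ for all }2\le k\le m\}|$; for permutations $\tau,\tau'$, $\mathrm{ov}(\tau,\tau')=\frac1n|\{i\in[n]:\tau(i)=\tau'(i)\}|$. For a target $\theta$ (either $\theta=\pi^\star$ with estimators $\hat\theta$ based on $X$, or $\theta=\pi^\star_2$ with estimators $\hat\theta$ based on $(X^1,Y)$), an estimator achieves exact recovery if $\mathsf{P}(\mathrm{ov}(\theta,\hat\theta)=1)=1-o(1)$; almost-exact recovery if $\mathsf{P}(\mathrm{ov}(\theta,\hat\theta)\ge1-\epsilon)=1-o(1)$ for all $\epsilon>0$; partial recovery if $\mathsf{P}(\mathrm{ov}(\theta,\hat\theta)\ge c)=1-o(1)$ for some constant $c>0$. Each type of recovery is impossible if no estimator achieves it. Partial recovery is intractable if for every estimator $\hat\theta$ and every $\epsilon>0$, $\mathsf{P}(\mathrm{ov}(\theta,\hat\theta)\le\epsilon)=1-o(1)$.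 *)

(* Defs.v *)
From HB Require Import structures.
From mathcomp Require Import all_boot all_order all_algebra all_fingroup.
From mathcomp Require Import all_classical all_reals all_analysis.

Set Implicit Arguments.
Unset Strict Implicit.
Unset Printing Implicit Defensive.

Import Order.TTheory GRing.Theory Num.Theory.
Import numFieldNormedType.Exports.

Local Open Scope classical_set_scope.
Local Open Scope ring_scope.

(* The sigma-algebra on matrices generated by the entries. *)

Definition matrix_display : measure_display -> measure_display.
Proof. exact. Qed.

Section measurable_matrix.
Context {d} {T : sigmaRingType d}.
Variables p q : nat.

Definition entry_cylinders : set (set 'M[T]_(p, q)) :=
  [set C | exists i j (B : set T),
     measurable B /\ C = [set A : 'M[T]_(p, q) | B (A i j)]].

Let mx_set0 : <<s entry_cylinders >> set0.
Proof. exact: sigma_algebra0. Qed.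

Let mx_setC C : <<s entry_cylinders >> C -> <<s entry_cylinders >> (~` C).
Proof. exact: sigma_algebraC. Qed.

Let mx_bigcup (F : (set 'M[T]_(p, q))^nat) :
  (forall i, <<s entry_cylinders >> (F i)) ->
  <<s entry_cylinders >> (\bigcup_i (F i)).
Proof. exact: sigma_algebra_bigcup. Qed.

HB.instance Definition _ := @isMeasurable.Build (matrix_display d)
  'M[T]_(p, q) <<s entry_cylinders >> mx_set0 mx_setC mx_bigcup.

End measurable_matrix.

Section probability_notions.
Context {d : measure_display} {T : measurableType d} {R : realType}.
Implicit Types P : probability T R.

(* Measurability of a map to a finite set carrying the discrete
   sigma-algebra. *)
Definition fin_measurable (S : finType) (f : T -> S) : Prop :=
  forall s, measurable (f @^-1` [set s]).

(* The conditional probability P( . | C ) = P( . `&` C) / P C. The library's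
   [mnormalize] falls back to its last argument when P C = 0, a case that
   does not occur below. *)
Definition cond_law P (C : set T) (mC : measurable C) : probability T R :=
  mnormalize (mrestr P mC) P.

Definition mutually_independent P (I : finType) (d' : measure_display)
    (E : measurableType d') (Z : I -> T -> E) : Prop :=
  forall (J : {set I}) (B : I -> set E), (forall i, measurable (B i)) ->
  (P [set w | forall i, i \in J -> B i (Z i w)]
   = \prod_(i in J) P (Z i @^-1` B i))%E.

(* Independence of a finite-valued random variable from a family. *)
Definition independent_of_family P (S : finType) (W : T -> S)
    (I : finType) (d' : measure_display) (E : measurableType d')
    (Z : I -> T -> E) : Prop :=
  forall (s : S) (B : I -> set E), (forall i, measurable (B i)) ->
  (P [set w | W w = s /\ forall i, B i (Z i w)]
   = P (W @^-1` [set s]) * P [set w | forall i, B i (Z i w)])%E.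

(* N(mu, sigma^2), including the point mass at mu for sigma = 0, a value for
   which the library's [normal_prob] takes a dummy value. *)
Definition normal_law (mu sigma : R) (A : set R) : \bar R :=
  if sigma == 0 then \d_mu A else normal_prob mu sigma A.

Definition jointly_gaussian P (m : nat) (V : T -> m.-tuple R) : Prop :=
  forall c : 'I_m -> R, exists mu sigma : R, forall A : set R, measurable A ->
  P [set w | A (\sum_(k < m) c k * tnth (V w) k)] = normal_law mu sigma A.

End probability_notions.

Section alignments.
Variables (R : realType) (m n : nat).

(* The k-th graph, 1 <= k <= m, has index k - 1 in 'I_m; so this is a_1 = Id. *)
Definition is_alignment (a : {ffun 'I_m -> 'S_n}) : bool :=
  [forall k : 'I_m, (val k == 0%N) ==> (a k == 1%g)].

Definition alignment := {a : {ffun 'I_m -> 'S_n} | is_alignment a}.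

Definition component (a : alignment) : 'I_m -> 'S_n := val a.

(* Products of permutations are read from left to right: (s * t) i = t (s i),
   so this is a_l \o (a_k)^-1. *)
Definition relative (a : alignment) (k l : 'I_m) : 'S_n :=
  ((component a k)^-1 * component a l)%g.

(* The unordered pair {i, j} is represented by (i, j) with i < j. It only
   serves to index entries of symmetric matrices. *)
Definition edge := {e : 'I_n * 'I_n | (e.1 < e.2)%N}.

Definition overlap_perm (s t : 'S_n) : R :=
  #|[set i : 'I_n | s i == t i]|%:R / n%:R.

Definition overlap (a b : alignment) : R :=
  #|[set i : 'I_n | [forall k : 'I_m,
       (0 < k)%N ==> (component a k i == component b k i)]]|%:R / n%:R.

Definition observation := m.-tuple 'M[R]_n.

(* (X^1_e, X^2_{a_2(e)}, ..., X^m_{a_m(e)}); the first entry is X^1_e because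
   a_1 = Id. *)
Definition edge_vector (a : alignment) (x : observation) (e : edge) :
    m.-tuple R :=
  [tuple tnth x k (component a k (val e).1) (component a k (val e).2) | k < m].

End alignments.

Inductive model (R : realType) : Type :=
| Gaussian of R                (* correlation rho *)
| ErdosRenyi of R & R.         (* p and s *)

Section correlated_graphs.
Context {R : realType} {m n : nat} (hm : (1 < m)%N).

Definition graph1 : 'I_m := Ordinal (ltnW hm).
Definition graph2 : 'I_m := Ordinal hm.

(* [None] indexes the parent variables X^0_e, [Some k] the variables xi^k_e. *)
Definition latent_index : finType := (option 'I_m * edge n)%type.

Definition edge_law {d : measure_display} {T : measurableType d}
    (P : probability T R) (M : model R) (pistar : T -> alignment m n)
    (X : T -> observation R m n) : Prop :=
  match M with
  | Gaussian rho =>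
      [/\ 0 <= rho <= 1 &
        forall (a : alignment m n) (ma : measurable (pistar @^-1` [set a])),
        let Q := cond_law P ma in
        let V := fun (e : edge n) w => edge_vector a (X w) e in
        mutually_independent Q V /\
        forall e : edge n,
          [/\ jointly_gaussian Q (V e),
              forall k, ('E_Q[fun w => tnth (V e w) k] = 0)%E,
              forall k, ('V_Q[fun w => tnth (V e w) k] = 1)%E &
              forall k l, k != l ->
                covariance Q (fun w => tnth (V e w) k)
                             (fun w => tnth (V e w) l) = rho%:E]]
  | ErdosRenyi p s =>
      [/\ 0 <= p <= 1, 0 <= s <= 1 &
        exists Z : latent_index -> T -> bool,
        [/\ forall i, measurable_fun setT (Z i),
            mutually_independent P Z,
            independent_of_family P pistar Z,
            forall e, (forall A, P (Z (None, e) @^-1` A) = bernoulli_prob p A)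
              /\ forall k A, P (Z (Some k, e) @^-1` A) = bernoulli_prob s A &
            forall w e k, tnth (edge_vector (pistar w) (X w) e) k
              = (Z (None, e) w)%:R * (Z (Some k, e) w)%:R]]
  end.

Definition correlated_graphs {d : measure_display} {T : measurableType d}
    (P : probability T R) (M : model R) (pistar : T -> alignment m n)
    (X : T -> observation R m n) : Prop :=
  [/\ fin_measurable pistar,
      measurable_fun setT X,
      forall w k, (tnth (X w) k)^T = tnth (X w) k
                  /\ forall i, tnth (X w) k i i = 0,
      forall a, P (pistar @^-1` [set a]) = (#|{: alignment m n}|%:R^-1)%:E &
      edge_law P M pistar X].

(* On the values 0 and 1 of the Erdos-Renyi model, disjunction is the
   maximum. *)
Definition aggregate (M : model R) (a : alignment m n)
    (x : observation R m n) : 'M[R]_n :=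
  let entry i j (k : 'I_m) :=
    tnth x k (relative a graph2 k i) (relative a graph2 k j) in
  match M with
  | Gaussian _ => \matrix_(i, j) \sum_(k < m | (0 < k)%N) entry i j k
  | ErdosRenyi _ _ =>
      \matrix_(i, j) \big[Num.max/0]_(k < m | (0 < k)%N) entry i j k
  end.

End correlated_graphs.

(* Recovery of a target [theta n], with values in the finite set [S n], from
   data [D n]; estimators are measurable functions of the data, and [ov n]
   measures the quality of an estimate. *)
Section recovery.
Context {R : realType} {d : nat -> measure_display}
  {T : forall n, measurableType (d n)} (P : forall n, probability (T n) R).
Context {S : nat -> finType} (ov : forall n, S n -> S n -> R)
  (theta : forall n, T n -> S n).
Context {d' : nat -> measure_display} {E : forall n, measurableType (d' n)}
  (D : forall n, T n -> E n).
Implicit Types est : forall n, E n -> S n.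

Definition estimator est : Prop := forall n, fin_measurable (est n).

Definition with_high_probability (A : forall n, set (T n)) : Prop :=
  P n (A n) @[n --> \oo] --> 1%E.

Let score est n (w : T n) : R := ov (theta w) (est n (D w)).

Definition achieves_exact est : Prop :=
  with_high_probability (fun n => [set w | score est w = 1]).

Definition achieves_almost_exact est : Prop :=
  forall eps : R, 0 < eps ->
  with_high_probability (fun n => [set w | 1 - eps <= score est w]).

Definition achieves_partial est : Prop :=
  exists c : R, 0 < c /\
  with_high_probability (fun n => [set w | c <= score est w]).

Definition exact_impossible : Prop :=
  ~ exists est, estimator est /\ achieves_exact est.

Definition almost_exact_impossible : Prop :=
  ~ exists est, estimator est /\ achieves_almost_exact est.

Definition partial_impossible : Prop :=
  ~ exists est, estimator est /\ achieves_partial est.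

Definition partial_intractable : Prop :=
  forall est, estimator est -> forall eps : R, 0 < eps ->
  with_high_probability (fun n => [set w | score est w <= eps]).

End recovery.

(* A choice of one of the two models, with parameters depending on n. *)
Inductive model_sequence (R : realType) : Type :=
| GaussianSeq of (nat -> R)
| ErdosRenyiSeq of (nat -> R) & (nat -> R).

Definition model_at (R : realType) (M : model_sequence R) (n : nat) : model R :=
  match M with
  | GaussianSeq rho => Gaussian (rho n)
  | ErdosRenyiSeq p s => ErdosRenyi (p n) (s n)
  end.

(* Main.v *)
Require Import Defs.
From HB Require Import structures.
From mathcomp Require Import all_boot all_order all_algebra all_fingroup.
From mathcomp Require Import all_classical all_reals all_analysis.
From mathcomp Require Import measurable_realfun ring lra.

(** The aggregate keeps all that the graphs [X^2, ..., X^m] tell about the second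
permutation [pi_2]: from [(X^1, Y)] and fresh randomness one can manufacture a list
of graphs that follows the law of [X], with the same [pi_2]. An estimator of the whole
alignment can be run on the manufactured list, so recovering [pi_2] from [(X^1, Y)] is
not harder than recovering [pi] from [X].

The edge vectors [(X^1_e, X^2_{pi_2(e)}, ..., X^m_{pi_m(e)})] are i.i.d. given [pi].
Call the entries other than the first the tail; the aggregate is a function of the
tail. In both models the tail can be redrawn from the aggregate without looking at
[X^1], in a way that preserves the law of the edge vector. In the Gaussian model the
deviations of the tail from its mean are independent of the first entry and of the tail
sum, so that they can be replaced by those of an independent vector
([gauss_fill_law]). In the Erdos-Renyi model the tail vanishes when the aggregate is 0;
when it is 1 the parent edge is present, and the flags [xi^2, ..., xi^m] are
independent of [xi^1] and conditioned not to vanish all together ([er_fill_law]).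

The aggregate is labelled like the second graph. Choose an alignment [b] with
[b_2 = Id] and place the redrawn [k]-th entry of the edge [f] of the second graph at
[b_k(f)]. If [pi = a], the result is aligned with [X^1] through the permutations
[b_k o a_2], the second of which is [a_2]. Since [pi] is uniform, averaging over [b]
gives the manufactured list together with [pi_2] the law of [X] together with [pi_2]
([sim_law], [sum_simulated]). Hence, for every score [h (pi_2, estimate)], some value
of [b] and of the randomness gives an estimator based on [(X^1, Y)] whose mean score is
at least that of the given estimator ([derandomized_estimator]).

The overlap of two alignments is at most that of their second components. For exact and
partial recovery and for intractability the score is the indicator of one event.
Almost-exact recovery asks for a single estimator that serves all thresholds; there the
score is the overlap itself, whose mean tends to 1, and Markov's inequality brings back
the events ([aggregate_mean_score]).

In the Gaussian model the hypotheses only speak of linear forms of the edge vectors.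
Laws on [R^m] are compared through the means of cosines of linear forms
([cramer_wold]), and the law of a sum of independent normal variables comes from the
invariance of the Gaussian weight under rotations of the plane ([gauss_rotation]). *)

Set Implicit Arguments.
Unset Strict Implicit.
Unset Printing Implicit Defensive.

Import Order.TTheory GRing.Theory Num.Theory.
Import numFieldNormedType.Exports.

Local Open Scope classical_set_scope.
Local Open Scope ring_scope.

(** * Real trigonometric polynomials and the Cramer-Wold device *)

Section step.
Context {R : realType}.
Implicit Types u q : R.

(** [step n u] is close to [exp (- n (2 u)^n)], so that for [u] in [0, 1] these polynomials
converge to the indicator of [u < 1/2]. *)
Definition step (n : nat) (u : R) : R := (1 - u ^+ n) ^+ (n * 2 ^ n).

Lemma bernoulli_ge (x : R) n : 0 <= x -> 1 + x *+ n <= (1 + x) ^+ n.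
Proof.
move=> x0; elim: n => [|n IH]; first by rewrite mulr0n addr0 expr0.
rewrite exprS; apply: (@le_trans _ _ ((1 + x) * (1 + x *+ n))).
  have : 0 <= x * (x *+ n) by rewrite mulr_ge0// mulrn_wge0.
  by rewrite mulrDl mul1r mulrDr mulr1 mulrS; lra.
by rewrite ler_wpM2l// addr_ge0.
Qed.

Lemma bernoulli_le1 (x : R) n : 0 <= x <= 1 -> 1 - x *+ n <= (1 - x) ^+ n.
Proof.
move=> /andP[x0 x1]; elim: n => [|n IH]; first by rewrite mulr0n subr0 expr0.
rewrite exprS; apply: (@le_trans _ _ ((1 - x) * (1 - x *+ n))).
  have : 0 <= x * (x *+ n) by rewrite mulr_ge0// mulrn_wge0.
  by rewrite mulrBl mul1r mulrBr mulr1 mulrS; lra.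
by rewrite ler_wpM2l// subr_ge0.
Qed.

(** With [r = sqrt q], Bernoulli's inequality bounds [n r^n], and the remaining factor
[r^n] tends to 0. *)
Lemma cvg_natM_expr q : 0 <= q < 1 -> (q ^+ n *+ n) @[n --> \oo] --> (0 : R).
Proof.
move=> /andP[]; rewrite le_eqVlt => /predU1P[<- _|q0 q1].
  apply: cvg_near_cst; near=> n; rewrite expr0n.
  by rewrite gtn_eqF ?mul0rn//; near: n; exact: nbhs_infty_gt.
pose r := Num.sqrt q.
have r0 : 0 < r by rewrite sqrtr_gt0.
have r1 : r < 1 by rewrite -sqrtr1 ltr_sqrt.
have qr : q = r ^+ 2 by rewrite sqr_sqrtr// ltW.
pose h := r^-1 - 1.
have h0 : 0 < h by rewrite subr_gt0 invf_gt1.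
have rnM n : r ^+ n *+ n <= h^-1.
  have := @bernoulli_ge h n (ltW h0).
  have -> : 1 + h = r^-1 by rewrite /h addrC subrK.
  rewrite exprVn => B.
  have rn0 : 0 < r ^+ n by rewrite exprn_gt0.
  rewrite -[leRHS]mul1r ler_pdivlMr// mulrnAl -mulrnAr.
  rewrite -ler_pdivlMl// mulr1; apply: le_trans B.
  by rewrite lerDr.
have := @cvg_geometric R h^-1 r.
rewrite ger0_norm ?ltW// => /(_ r1) /= geo.
apply: (squeeze_cvgr _ (cvg_cst 0) geo).
apply: nearW => n; rewrite mulrn_wge0 ?exprn_ge0 ?(ltW q0)//=.
rewrite qr -exprM mulnC muln2 -addnn exprD -mulrnAl.
by rewrite -[leRHS]/(h^-1 * r ^+ n) ler_wpM2r// exprn_ge0// ltW.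
Unshelve. all: by end_near. Qed.

Lemma step_ge0 n u : 0 <= u <= 1 -> 0 <= step n u.
Proof. by move=> /andP[u0 u1]; rewrite exprn_ge0// subr_ge0 exprn_ile1. Qed.

Lemma step_le1 n u : 0 <= u <= 1 -> step n u <= 1.
Proof.
move=> /andP[u0 u1]; rewrite exprn_ile1 ?subr_ge0 ?exprn_ile1//.
by rewrite gerBl exprn_ge0.
Qed.

(** By Bernoulli's inequality, [step n u >= 1 - n (2 u)^n]. *)
Lemma cvg_step_lt u : 0 <= u -> u < 2^-1 -> step n u @[n --> \oo] --> (1 : R).
Proof.
move=> u0 u2.
have q1 : 0 <= 2 * u < 1 by apply/andP; split; lra.
have u1 : u <= 1 by lra.
have L : (1 - (2 * u) ^+ n *+ n) @[n --> \oo] --> (1 : R).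
  rewrite -[X in _ --> X]subr0; apply: cvgB; first exact: cvg_cst.
  exact: cvg_natM_expr.
apply: (squeeze_cvgr _ L (@cvg_cst _ _ _ _ _)).
apply: nearW => n; rewrite step_le1 ?u0// andbT.
apply: le_trans (bernoulli_le1 _ _); last by rewrite exprn_ge0//= exprn_ile1.
by rewrite lerD2l lerN2 mulnC mulrnA lerMn2r exprMn -natrX mulr_natl lexx orbT.
Qed.

(** Write [x = u^n] and [k = n 2^n]. Then [(1 - x)^k (1 + x)^k <= 1], while
[(1 + x)^k >= 1 + k x >= 1 + n]. *)
Lemma cvg_step_ge u : 2^-1 <= u -> u <= 1 -> step n u @[n --> \oo] --> (0 : R).
Proof.
move=> u2 u1.
have u0 : 0 <= u by apply: le_trans u2; rewrite invr_ge0.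
apply: (squeeze_cvgr _ (cvg_cst 0) (@cvg_harmonic R)).
apply: nearW => n; rewrite step_ge0 ?u0//=.
rewrite /step; set x := u ^+ n; set k := (n * 2 ^ n)%N.
have x0 : 0 <= x by rewrite exprn_ge0.
have x1 : x <= 1 by rewrite exprn_ile1.
have B := @bernoulli_ge x k x0.
have kx : n%:R <= x *+ k.
  rewrite /k mulnC mulrnA -[leLHS]/(1 *+ n) lerMn2r; apply/orP; right.
  rewrite -[_ *+ _]mulr_natl natrX -exprMn exprn_ege1//; lra.
have n1 : 0 < (n.+1%:R : R) by [].
rewrite -[leRHS]mul1r ler_pdivlMr//.
apply: (@le_trans _ _ ((1 - x) ^+ k * (1 + x) ^+ k)).
  rewrite ler_wpM2l ?exprn_ge0 ?subr_ge0//; apply: le_trans B.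
  by rewrite -natr1 addrC lerD2l.
rewrite -exprMn exprn_ile1//; nra.
Qed.

End step.

Section trigonometric_polynomials.
Context {R : realType} {m : nat}.
Implicit Types (f g : m.-tuple R -> R) (c : 'I_m -> R).

Definition proj_comb c (v : m.-tuple R) : R := \sum_(k < m) c k * tnth v k.

(** Cosines with arbitrary phases: sines are included, and everything stays real. *)
Inductive trig_poly : (m.-tuple R -> R) -> Prop :=
| trig_cos c s : trig_poly (fun v => cos (proj_comb c v + s))
| trig_lin a b f g : trig_poly f -> trig_poly g ->
    trig_poly (fun v => a * f v + b * g v).

Lemma proj_combD c c' v :
  proj_comb (fun k => c k + c' k) v = proj_comb c v + proj_comb c' v.
Proof.
by rewrite /proj_comb -big_split /=; apply: eq_bigr => k _; rewrite mulrDl.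
Qed.

Lemma proj_combN c v : proj_comb (fun k => - c k) v = - proj_comb c v.
Proof.
by rewrite /proj_comb -sumrN; apply: eq_bigr => k _; rewrite mulNr.
Qed.

Lemma trig_poly_cst a : trig_poly (fun=> a).
Proof.
have := trig_lin a 0 (trig_cos (fun=> 0) 0) (trig_cos (fun=> 0) 0).
rewrite (_ : (fun _ => _) = fun=> a)//; apply/funext => v.
rewrite /proj_comb big1; last by move=> k _; rewrite mul0r.
by rewrite addr0 cos0 mulr1 mul0r addr0.
Qed.

(** The product of two cosines is half the sum of the cosines of the sum and of the
difference of their arguments. *)
Lemma trig_polyM f g : trig_poly f -> trig_poly g ->
  trig_poly (fun v => f v * g v).
Proof.
move=> tf; elim: tf g => {f}[c s g|a b f1 f2 _ IH1 _ IH2 g tg].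
- elim=> {g}[c' s'|a b g1 g2 _ IH1 _ IH2].
  + have := trig_lin 2^-1 2^-1 (trig_cos (fun k => c k + c' k) (s + s'))
      (trig_cos (fun k => c k + - c' k) (s - s')).
    rewrite (_ : (fun _ => _) = fun v =>
      cos (proj_comb c v + s) * cos (proj_comb c' v + s'))//.
    apply/funext => v; rewrite !proj_combD proj_combN.
    set x := proj_comb c v; set y := proj_comb c' v.
    have -> : x + y + (s + s') = (x + s) + (y + s') by ring.
    have -> : x - y + (s - s') = (x + s) - (y + s') by ring.
    rewrite cosD cosB; lra.
  + have := trig_lin a b IH1 IH2; congr trig_poly; apply/funext => v; ring.
- have := trig_lin a b (IH1 _ tg) (IH2 _ tg).
  congr trig_poly; apply/funext => v; ring.
Qed.

Lemma trig_polyX f n : trig_poly f -> trig_poly (fun v => f v ^+ n).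
Proof.
move=> tf; elim: n => [|n IH]; first exact: trig_poly_cst.
by have := trig_polyM tf IH; congr trig_poly; apply/funext => v; rewrite exprS.
Qed.

Lemma trig_poly_prod (I : Type) (r : seq I) (F : I -> m.-tuple R -> R) :
  (forall i, trig_poly (F i)) -> trig_poly (fun v => \prod_(i <- r) F i v).
Proof.
move=> tF; elim: r => [|i r IH].
  have := trig_poly_cst 1; congr trig_poly; apply/funext => v.
  by rewrite big_nil.
have := trig_polyM (tF i) IH; congr trig_poly; apply/funext => v.
by rewrite big_cons.
Qed.

Lemma trig_poly_step f n : trig_poly f -> trig_poly (fun v => step n (f v)).
Proof.
move=> tf; apply: trig_polyX.
have := trig_lin 1 (-1) (trig_poly_cst 1) (trig_polyX n tf).
by congr trig_poly; apply/funext => v; rewrite mul1r mulN1r.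
Qed.

Lemma measurable_proj_comb c : measurable_fun setT (proj_comb c).
Proof.
apply: measurable_sum => k; apply: measurable_funM => //.
exact: measurable_tnth.
Qed.

Lemma measurable_trig_poly f : trig_poly f -> measurable_fun setT f.
Proof.
elim=> {f}[c s|a b f g _ mf _ mg].
  apply: measurableT_comp.
    by apply: continuous_measurable_fun; exact: continuous_cos.
  by apply: measurable_funD => //; exact: measurable_proj_comb.
by apply: measurable_funD; apply: measurable_funM.
Qed.

Lemma bounded_trig_poly f : trig_poly f -> exists M, forall v, `|f v| <= M.
Proof.
elim=> {f}[c s|a b f g _ [M hM] _ [N hN]].
  by exists 1 => v; exact: cos_max.
exists (`|a| * M + `|b| * N) => v.
by rewrite (le_trans (ler_normD _ _))// !normrM lerD// ler_wpM2l.
Qed.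

End trigonometric_polynomials.

Section cramer_wold.
Context {R : realType} {m : nat}.
Context {d d' : measure_display} {T : measurableType d} {T' : measurableType d'}.
Variables (P : probability T R) (P' : probability T' R).
Variables (V : T -> m.-tuple R) (V' : T' -> m.-tuple R).
Hypotheses (mV : measurable_fun setT V) (mV' : measurable_fun setT V').
Hypothesis cosVV' : forall (c : 'I_m -> R) (s : R),
  (\int[P]_w (cos (proj_comb c (V w) + s))%:E =
   \int[P']_w (cos (proj_comb c (V' w) + s))%:E)%E.

Definition same_mean (f : m.-tuple R -> R) :=
  [/\ measurable_fun setT f, (exists M, forall v, `|f v| <= M) &
   (\int[P]_w (f (V w))%:E = \int[P']_w (f (V' w))%:E)%E].

Lemma bounded_integrable (f : m.-tuple R -> R) (d0 : measure_display)
    (T0 : measurableType d0) (P0 : probability T0 R) (V0 : T0 -> m.-tuple R) :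
  measurable_fun setT V0 -> measurable_fun setT f ->
  (exists M, forall v, `|f v| <= M) ->
  P0.-integrable setT (fun w => (f (V0 w))%:E).
Proof.
move=> mV0 mf [M hM].
apply: (@le_integrable _ _ _ P0 setT measurableT _ (cst M%:E)).
- by apply/measurable_EFinP; exact: measurableT_comp.
- by move=> w _ /=; rewrite lee_fin (le_trans (hM _))// ler_norm.
- exact: finite_measure_integrable_cst.
Qed.

Lemma trig_same_mean f : trig_poly f -> same_mean f.
Proof.
move=> tf; split; [exact: measurable_trig_poly|exact: bounded_trig_poly|].
elim: tf => {f}[//|a b f g tf IHf tg IHg].
have If := bounded_integrable P mV (measurable_trig_poly tf) (bounded_trig_poly tf).
have Ig := bounded_integrable P mV (measurable_trig_poly tg) (bounded_trig_poly tg).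
have If' :=
  bounded_integrable P' mV' (measurable_trig_poly tf) (bounded_trig_poly tf).
have Ig' :=
  bounded_integrable P' mV' (measurable_trig_poly tg) (bounded_trig_poly tg).
under eq_integral do rewrite EFinD !EFinM.
rewrite integralD//=; try exact: integrableZl.
rewrite !integralZl// IHf IHg.
under [RHS]eq_integral do rewrite EFinD !EFinM.
by rewrite integralD//= ?integralZl//; exact: integrableZl.
Qed.

Lemma cvg_same_mean (f_ : nat -> m.-tuple R -> R) f :
  (forall n, same_mean (f_ n)) -> (forall n v, 0 <= f_ n v <= 1) ->
  (forall v, f_ n v @[n --> \oo] --> f v) -> same_mean f.
Proof.
move=> sf f01 ff.
have mf : measurable_fun setT f.
  apply: (measurable_fun_cvg (h := f_)) => [n|v _]; last exact: ff.
  by have [] := sf n.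
have bf v : `|f v| <= 1.
  have cf := ff v.
  have f0 : 0 <= f v.
    rewrite -(cvg_lim (@Rhausdorff R) cf).
    by apply: limr_ge; [exact: cvgP cf|apply: nearW => n; case/andP: (f01 n v)].
  rewrite ger0_norm//.
  rewrite -(cvg_lim (@Rhausdorff R) cf).
  by apply: limr_le; [exact: cvgP cf|apply: nearW => n; case/andP: (f01 n v)].
split => //; first by exists 1.
have key (d0 : measure_display) (T0 : measurableType d0)
    (P0 : probability T0 R) (V0 : T0 -> m.-tuple R) :
    measurable_fun setT V0 ->
    (\int[P0]_w (f_ n (V0 w))%:E @[n --> \oo] --> \int[P0]_w (f (V0 w))%:E)%E.
  move=> mV0.
  have mfn n : measurable_fun setT (fun w => (f_ n (V0 w))%:E).
    apply/measurable_EFinP; apply: measurableT_comp => //.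
    by have [] := sf n.
  have [//|||||_ _] := @dominated_convergence _ _ _ P0 setT measurableT
    (fun n w => (f_ n (V0 w))%:E) (fun w => (f (V0 w))%:E) (cst 1%E).
  - by apply/measurable_EFinP; exact: measurableT_comp.
  - apply: aeW => w _; apply: cvg_EFin; last exact: ff.
    by apply: nearW.
  - exact: finite_measure_integrable_cst.
  - apply: aeW => w n _ /=; rewrite lee_fin ger0_norm//; by case/andP: (f01 n (V0 w)).
  - by [].
have h := key _ _ P _ mV.
have h' := key _ _ P' _ mV'.
have e n : (\int[P]_w (f_ n (V w))%:E = \int[P']_w (f_ n (V' w))%:E)%E.
  by have [] := sf n.
move: h; under eq_cvg do rewrite e.
by move=> h; exact: (cvg_unique _ h h').
Qed.

End cramer_wold.

Section rays.
Context {R : realType} {m : nat}.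

Lemma cvg_prodr (I : Type) (r : seq I) (f : I -> nat -> R) (l : I -> R) :
  (forall i, f i n @[n --> \oo] --> l i) ->
  \prod_(i <- r) f i n @[n --> \oo] --> \prod_(i <- r) l i.
Proof.
move=> fl; elim: r => [|i r IH].
  rewrite big_nil; under eq_cvg do rewrite big_nil; exact: cvg_cst.
by rewrite big_cons; under eq_cvg do rewrite big_cons; exact: cvgM.
Qed.

(** A sinusoid with values in [0, 1] that crosses the level 1/2 at [x = b]. Its
period grows with [j], and on a half-period around [b] comparing it with 1/2 decides
whether [b < x]. *)
Definition half_sine (b x : R) (j : nat) : R :=
  (1 + sin (j.+1%:R^-1 * (b - x))) / 2.

Lemma half_sine01 b x j : 0 <= half_sine b x j <= 1.
Proof.
rewrite /half_sine; have := sin_geN1 (j.+1%:R^-1 * (b - x)).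
by have := sin_le1 (j.+1%:R^-1 * (b - x)); lra.
Qed.

Lemma cvg_step_half_sine b x j :
  step n (half_sine b x j) @[n --> \oo] -->
    ((half_sine b x j < 2^-1)%R%:R : R).
Proof.
have /andP[u0 u1] := half_sine01 b x j.
have [u2|u2] := ltP; first exact: cvg_step_lt.
exact: cvg_step_ge.
Qed.

Lemma cvg_half_sine b x :
  ((half_sine b x j < 2^-1)%R%:R : R) @[j --> \oo] --> ((b < x)%R%:R : R).
Proof.
have E j : (half_sine b x j < 2^-1) = (sin (j.+1%:R^-1 * (b - x)) < 0).
  by rewrite /half_sine -[X in _ < X]mul1r ltr_pM2r// gtrDl.
under eq_cvg do rewrite E.
apply: cvg_near_cst; near=> j.
have j0 : 0 < (j.+1%:R^-1 : R) by rewrite invr_gt0.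
(* Within a half-period of [b] the sine has the sign of its argument. *)
have small : j.+1%:R^-1 * `|b - x| < pi.
  rewrite mulrC ltr_pdivrMr//.
  have J : `|b - x| < j.+1%:R.
    apply: (@lt_le_trans _ _ j%:R); last by rewrite ler_nat.
    by near: j; exact: nbhs_infty_gtr.
  apply: (lt_le_trans J); rewrite -[leLHS]mul1r ler_wpM2r//.
  by rewrite (@le_trans _ _ 2)// ?pi_ge2// ler1n.
case: (ltgtP b x) => [bx|xb|->] /=; last by rewrite subrr mulr0 sin0 ltxx.
- have d0 : 0 < x - b by rewrite subr_gt0.
  rewrite -(opprB x b) mulrN sinN oppr_lt0 sin_gt0_pi ?mulr_gt0//=.
  by rewrite -(gtr0_norm d0) distrC.
- have d0 : 0 < b - x by rewrite subr_gt0.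
  rewrite ltNge ltW// sin_gt0_pi ?mulr_gt0//=.
  by rewrite -(gtr0_norm d0).
Unshelve. all: by end_near. Qed.

Definition ray_box (b : 'I_m -> R) : set (m.-tuple R) :=
  [set v | forall k, b k < tnth v k].

Definition ray_boxes : set (set (m.-tuple R)) := [set ray_box b | b in setT].

Lemma prod_boolE (p : 'I_m -> bool) :
  \prod_(k < m) ((p k)%:R : R) = ([forall k, p k])%:R.
Proof.
have [/forallP h|/forallPn[k nk]] := boolP [forall k, p k].
  by rewrite big1// => k _; rewrite h.
by rewrite (bigD1 k)//= (negbTE nk) mul0r.
Qed.

Lemma ray_boxE b v : (\1_(ray_box b) v : R) = \prod_(k < m) (b k < tnth v k)%R%:R.
Proof.
rewrite prod_boolE indicE; congr (_%:R); congr nat_of_bool.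
by apply/idP/forallP => [/set_mem//|h]; apply/mem_set => k; exact: h.
Qed.

Lemma measurable_ray_box b : measurable (ray_box b).
Proof.
rewrite (_ : ray_box b = \bigcap_(k in [set: 'I_m])
  ((fun v : m.-tuple R => tnth v k) @^-1` `]b k, +oo[)); last first.
  apply/seteqP; split => v h k; first by move=> _; rewrite /= in_itv/= andbT; exact: h.
  by have := h k Logic.I; rewrite /= in_itv/= andbT.
apply: fin_bigcap_measurable => //.
by move=> k _; rewrite -[X in measurable X]setTI; exact: measurable_tnth.
Qed.

(** The ray in one coordinate is the union of the products of rays that start at [- j] in
the other coordinates, over all [j]. *)
Lemma measurable_tuple_ray_boxes :
  (measurable : set (set (m.-tuple R))) = <<s ray_boxes >>.
Proof.
apply/seteqP; split; last first.
  apply: smallest_sub; first exact: sigma_algebra_measurable.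
  by move=> _ [b _ <-]; exact: measurable_ray_box.
apply: smallest_sub; first exact: smallest_sigma_algebra.
move=> A; rewrite -bigcup_seq => -[k _ [B mB <-]]; rewrite setTI.
pose S := [set B : set R | <<s ray_boxes >> ((fun v => tnth v k) @^-1` B)].
suff : measurable `<=` S by apply.
apply: (@subset_trans _ (@RGenOInfty.G R).-sigma.-measurable).
  by rewrite -RGenOInfty.measurableE.
apply: smallest_sub.
  split.
  - by rewrite /S /= preimage_set0; exact: sigma_algebra0.
  - move=> C SC; rewrite /S /= setTD preimage_setC.
    by rewrite -setTD; apply: sigma_algebraCD.
  - by move=> F SF; rewrite /S /= preimage_bigcup; exact: sigma_algebra_bigcup.
move=> C [r ->]; rewrite /S /=.
rewrite (_ : _ @^-1` _ = \bigcup_j (ray_box (fun l => if l == k then r else - j%:R))); last first.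
  apply/seteqP; split => [v|v [j _] /(_ k)]; last first.
    by rewrite eqxx /= in_itv/= andbT.
  rewrite /= in_itv/= andbT => rv.
  pose M := \sum_(l < m) `|tnth v l|.
  exists (Num.truncn M).+1 => // l; case: eqVneq => [->//|_].
  have lM : `|tnth v l| <= M.
    by rewrite /M (bigD1 l)//= lerDl sumr_ge0.
  have := truncnS_gt M; have := ler_norm (- tnth v l); rewrite normrN; lra.
by apply: sigma_algebra_bigcup => j; apply: sub_sigma_algebra; eexists.
Qed.

Context {d d' : measure_display} {T : measurableType d} {T' : measurableType d'}.
Variables (P : probability T R) (P' : probability T' R).
Variables (V : T -> m.-tuple R) (V' : T' -> m.-tuple R).
Hypotheses (mV : measurable_fun setT V) (mV' : measurable_fun setT V').
Hypothesis cosVV' : forall (c : 'I_m -> R) (s : R),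
  (\int[P]_w (cos (proj_comb c (V w) + s))%:E =
   \int[P']_w (cos (proj_comb c (V' w) + s))%:E)%E.

Lemma half_sine_trig (b : R) k j : trig_poly (fun v : m.-tuple R => half_sine b (tnth v k) j).
Proof.
(* A sine is a cosine with its phase shifted by [pi / 2]. *)
pose t : R := j.+1%:R^-1.
have := trig_lin 2^-1 2^-1 (trig_poly_cst 1)
  (trig_cos (fun l => if l == k then - t else 0) (t * b - pi / 2)).
congr trig_poly; apply/funext => v.
rewrite /proj_comb (bigD1 k)//= eqxx big1; last first.
  by move=> l /negbTE ->; rewrite mul0r.
rewrite addr0 /half_sine -/t -cosBpihalf.
have -> : - t * tnth v k + (t * b - pi / 2) = t * (b - tnth v k) - pi / 2 by ring.
by lra.
Qed.

(** The indicator of a product of open rays is an iterated limit of trigonometric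
polynomials: [step n] sharpens the half-sines into indicators, and then the period of
the half-sines grows. *)
Lemma ray_same_mean b :
  same_mean P P' V V' (fun v => \prod_(k < m) ((b k < tnth v k)%R%:R : R)).
Proof.
have prod01 (F : 'I_m -> R) : (forall k, 0 <= F k <= 1) ->
    0 <= \prod_(k < m) F k <= 1.
  move=> F01; rewrite prodr_ge0/=; last by move=> k _; case/andP: (F01 k).
  by apply: prodr_ile1 => k _.
have bool01 (p : bool) : 0 <= (p%:R : R) <= 1 by case: p; rewrite /= lexx ler01.
pose F j v := \prod_(k < m) ((half_sine (b k) (tnth v k) j < 2^-1)%R%:R : R).
apply: (@cvg_same_mean _ _ _ _ _ _ _ _ _ _ mV mV' F).
- move=> j.
  pose G n (v : m.-tuple R) := \prod_(k < m) step n (half_sine (b k) (tnth v k) j).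
  apply: (@cvg_same_mean _ _ _ _ _ _ _ _ _ _ mV mV' G).
  + move=> n; apply: trig_same_mean => //; apply: trig_poly_prod => k.
    by apply: trig_poly_step; exact: half_sine_trig.
  + by move=> n v; apply: prod01 => k; rewrite step_ge0 ?step_le1 ?half_sine01.
  + by move=> v; apply: cvg_prodr => k; exact: cvg_step_half_sine.
- by move=> n v; apply: prod01 => k.
- by move=> v; apply: cvg_prodr => k; exact: cvg_half_sine.
Qed.

(** The hypothesis extends by linearity to trigonometric polynomials and, by dominated
convergence, to the indicators of products of rays, which generate the Borel sets and
are stable under intersection. *)
Theorem cramer_wold (A : set (m.-tuple R)) : measurable A ->
  P (V @^-1` A) = P' (V' @^-1` A).
Proof.
pose mu := distribution P (mfun_Sub (mem_set mV)).
pose mu' := distribution P' (mfun_Sub (mem_set mV')).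
move=> mA; rewrite -[LHS]/(mu A) -[RHS]/(mu' A).
apply: (measure_unique ray_boxes (fun j => ray_box (fun=> - j%:R))) => //.
- exact: measurable_tuple_ray_boxes.
- move=> _ _ [b _ <-] [b' _ <-].
  exists (fun k => Num.max (b k) (b' k)) => //.
  apply/seteqP; split => v => [h|[h h'] k].
    by split => k; have := h k; rewrite gt_max => /andP[].
  by rewrite gt_max h h'.
- by move=> j; eexists.
- apply/seteqP; split => // v _.
  pose M := \sum_(l < m) `|tnth v l|.
  exists (Num.truncn M).+1 => // l.
  have lM : `|tnth v l| <= M.
    by rewrite /M (bigD1 l)//= lerDl sumr_ge0.
  have := truncnS_gt M; have := ler_norm (- tnth v l); rewrite normrN; lra.
- move=> _ [b _ <-].
  have [_ _] := ray_same_mean b.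
  under eq_integral do rewrite -ray_boxE.
  under [X in _ = X -> _]eq_integral do rewrite -ray_boxE.
  have indV (d0 : measure_display) (T0 : measurableType d0)
    (P0 : probability T0 R) (V0 : T0 -> m.-tuple R) : measurable_fun setT V0 ->
    (\int[P0]_x (\1_(ray_box b) (V0 x))%:E)%E = P0 (V0 @^-1` ray_box b).
    move=> mV0.
    rewrite -[X in _ = P0 X]setIT -integral_indic//.
      by rewrite -[X in measurable X]setTI; apply: mV0 => //; exact: measurable_ray_box.
  by rewrite !indV.
- by move=> j; rewrite -ge0_fin_numE ?fin_num_measure//; exact: measurable_ray_box.
Qed.

End rays.

(** * Normal laws on the line *)

Section density.
Context {d} {T : measurableType d} {R : realType}.
Variables (mu nu : {measure set T -> \bar R}) (g : T -> R).
Hypotheses (mg : measurable_fun setT g) (g0 : forall x, 0 <= g x).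
Hypothesis nuE : forall A, measurable A -> (nu A = \int[mu]_(x in A) (g x)%:E)%E.

Import HBNNSimple.

(** The two sides agree on simple functions, and monotone convergence does the rest. *)
Lemma ge0_integral_density (f : T -> R) : measurable_fun setT f ->
  (forall x, 0 <= f x) ->
  (\int[nu]_x (f x)%:E = \int[mu]_x (f x * g x)%:E)%E.
Proof.
move=> mf f0.
have mEf : measurable_fun setT (EFin \o f) by exact/measurable_EFinP.
pose h := nnsfun_approx measurableT mEf.
have Ef0 x : [set: T] x -> (0 <= (EFin \o f) x)%E by rewrite lee_fin.
have hf x := @cvg_nnsfun_approx _ _ _ _ measurableT _ mEf Ef0 x Logic.I.
have hnd x : {homo (fun n => h n x) : a b / (a <= b)%N >-> a <= b}.
  by move=> a b ab; have /lefP := nd_nnsfun_approx measurableT mEf ab; exact.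
have hh n : (\int[nu]_x (h n x)%:E = \int[mu]_x (h n x * g x)%:E)%E.
  under eq_integral do rewrite fimfunE -fsumEFin//.
  rewrite ge0_integral_fsum//; last 2 first.
    - by move=> r; exact/measurable_EFinP/measurableT_comp.
    - by move=> r x _; rewrite EFinM nnfun_muleindic_ge0.
  under [RHS]eq_integral.
    move=> x _; rewrite EFinM fimfunE -fsumEFin// muleC ge0_mule_fsumr; last first.
      by move=> r; rewrite EFinM nnfun_muleindic_ge0.
    over.
  rewrite [RHS]ge0_integral_fsum//; last 2 first.
    - move=> r; apply/measurable_EFinP; apply: measurable_funM => //.
      by apply: measurable_funM => //; exact: measurable_indic.
    - move=> r x _; rewrite mule_ge0// ?lee_fin ?g0//.
      by rewrite -lee_fin EFinM nnfun_muleindic_ge0.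
  apply: eq_fsbigr => r _.
  have mr : measurable (h n @^-1` [set r]) by exact: measurable_sfunP.
  have [r0|r0] := leP 0 r; last first.
    have e x : \1_(h n @^-1` [set r]) x = 0 :> R.
      rewrite indicE; case: (boolP (x \in _)) => // /set_mem /= hr.
      have : 0 <= h n x by exact: fun_ge0.
      by rewrite hr leNgt r0.
    by rewrite !integral0_eq// => x _; rewrite e mulr0 ?mule0.
  under eq_integral do rewrite EFinM.
  rewrite ge0_integralZl//; last exact/measurable_EFinP/measurable_indic.
  rewrite integral_indic// setIT nuE//.
  under [RHS]eq_integral do rewrite EFinM muleCA.
  rewrite [RHS]ge0_integralZl//; last 2 first.
  - apply/measurable_EFinP; apply: measurable_funM => //; exact: measurable_indic.
  - by move=> x _; rewrite -EFinM lee_fin mulr_ge0.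
  congr (_ * _)%E; rewrite integral_mkcond; apply: eq_integral => x _.
  rewrite patchE indicE; case: ifPn => xr; by rewrite ?mule1 ?mule0.
have L1 : (\int[nu]_x (h n x)%:E @[n --> \oo] --> \int[nu]_x (f x)%:E)%E.
  have := @cvg_monotone_convergence _ _ _ nu setT measurableT
    (fun n x => (h n x)%:E).
  rewrite (_ : (fun x => limn _) = EFin \o f); last first.
    by apply/funext => x; exact/cvg_lim/hf.
  apply => //.
  - by move=> n; exact/measurable_EFinP.
  - by move=> n x _; rewrite lee_fin.
  - by move=> x _ a b ab; rewrite lee_fin hnd.
have L2 : (\int[mu]_x (h n x * g x)%:E @[n --> \oo] --> \int[mu]_x (f x * g x)%:E)%E.
  have := @cvg_monotone_convergence _ _ _ mu setT measurableT
    (fun n x => (h n x * g x)%:E).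
  rewrite (_ : (fun x => limn _) = (fun x => (f x * g x)%:E)); last first.
    apply/funext => x; apply/cvg_lim => //.
    have : ((h n x)%:E * (g x)%:E @[n --> \oo] --> (f x)%:E * (g x)%:E)%E.
      by apply: cvgeZr => //; exact: hf.
    exact.
  apply => //.
  - by move=> n; apply/measurable_EFinP; exact: measurable_funM.
  - by move=> n x _; rewrite lee_fin mulr_ge0.
  - by move=> x _ a b ab; rewrite lee_fin ler_wpM2r// hnd.
move: L1; under eq_cvg do rewrite hh.
by move=> L1; exact: (cvg_unique _ L1 L2).
Qed.

End density.

Section lebesgue_affine.
Context {R : realType}.
Local Notation mu := (@lebesgue_measure R).
Variables (a b : R).
Hypothesis a0 : a != 0.

Let phi (x : measurableTypeR R) : measurableTypeR R := a * (x : R) + b.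

Let mphi : measurable_fun setT phi.
Proof.
have : measurable_fun [set: R] (fun x : R => a * x + b).
  by apply: measurable_funD => //; exact: measurable_funM.
exact.
Qed.

(** The left-hand side is a measure that gives every half-open interval its length; for
[a < 0] the preimage of such an interval is closed at the other end, which leaves its
length unchanged. *)
Lemma lebesgue_preimage_affine (A : set R) : measurable A ->
  (`|a|%:E * mu (phi @^-1` A) = mu A)%E.
Proof.
pose a' : {nonneg R} := NngNum (normr_ge0 a).
pose mu'_ : {measure set (measurableTypeR R) -> \bar R} := mscale a' (pushforward mu phi).
pose mu' := mu'_ mphi.
move=> mA; rewrite -[LHS]/(mu' A); apply/esym.
apply: (@lebesgue_measure_unique R mu') => // _ [[x y] _ <-] /=.
rewrite /mu' /mu'_ /mscale /= /pushforward /=.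
have aV : a * a^-1 = 1 by rewrite divff.
have [ap|an] : 0 < a \/ a < 0 by case: (ltgtP a 0) a0 => //; auto.
- rewrite (_ : phi @^-1` _ = `](x - b) / a, (y - b) / a]%classic); last first.
    apply/seteqP; split => z; rewrite /phi /= !in_itv/=;
    by rewrite ltr_pdivrMr// ler_pdivlMr// ltrBlDr lerBrDr (mulrC z).
  rewrite !lebesgue_measure_itv/= !lte_fin ltr_pM2r ?invr_gt0// ltrD2r.
  case: ifPn => _; last by rewrite mule0.
  by rewrite gtr0_norm// -!EFinB -EFinM; congr EFin; field.
- rewrite (_ : phi @^-1` _ = `[(y - b) / a, (x - b) / a[%classic); last first.
    apply/seteqP; split => z; rewrite /phi /= !in_itv/=;
    by rewrite ler_ndivrMr// ltr_ndivlMr// ltrBlDr lerBrDr (mulrC z) andbC.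
  rewrite !lebesgue_measure_itv/= !lte_fin ltr_nM2r ?invr_lt0// ltrD2r.
  case: ifPn => _; last by rewrite mule0.
  by rewrite ltr0_norm// -!EFinB -EFinM; congr EFin; field.
Qed.

Lemma ge0_integral_affine (f : R -> R) : measurable_fun setT f ->
  (forall x, 0 <= f x) ->
  (\int[mu]_x (f x)%:E = \int[mu]_x (`|a| * f (a * x + b))%:E)%E.
Proof.
move=> mf f0.
pose a' : {nonneg R} := NngNum (normr_ge0 a).
pose mu'_ : {measure set (measurableTypeR R) -> \bar R} := mscale a' (pushforward mu phi).
pose mu' := mu'_ mphi.
transitivity (\int[mu']_x (f x)%:E)%E.
  apply: eq_measure_integral => A mA _.
  exact/esym/lebesgue_preimage_affine.
have mEf : measurable_fun setT (EFin \o f) by exact/measurable_EFinP.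
rewrite ge0_integral_mscale//=; last by move=> x _; rewrite lee_fin.
rewrite ge0_integral_pushforward//; last by move=> x _; rewrite lee_fin.
rewrite preimage_setT -ge0_integralZl//.
- by apply/measurable_EFinP; exact: (measurableT_comp mf mphi).
- by move=> x _; rewrite lee_fin /=.
Qed.

End lebesgue_affine.

Section standard_normal.
Context {R : realType}.
Local Notation mu := (@lebesgue_measure R).

Definition gauss (x : R) : R := normal_pdf 0 1 x.

Lemma gaussE x : gauss x = normal_peak 1 * expR (- x ^+ 2 / 2).
Proof. by rewrite /gauss normal_pdfE ?oner_eq0// /normal_fun subr0 expr1n. Qed.

Lemma gauss_ge0 x : 0 <= gauss x. Proof. exact: normal_pdf_ge0. Qed.

Lemma measurable_gauss : measurable_fun setT gauss.
Proof. exact: measurable_normal_pdf. Qed.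

Lemma integral_gauss : (\int[mu]_x (gauss x)%:E = 1)%E.
Proof. exact: integral_normal_pdf. Qed.

Lemma gaussN x : gauss (- x) = gauss x.
Proof. by rewrite !gaussE sqrrN. Qed.

Lemma normal_pdf_affine (m s x : R) : s != 0 ->
  `|s| * normal_pdf m s (s * x + m) = gauss x.
Proof.
move=> s0; rewrite gaussE normal_pdfE// /normal_peak /normal_fun addrK.
rewrite -!mulrnAr (sqrtrM _ (sqr_ge0 s)) expr1n mul1r sqrtr_sqr invfM.
rewrite !mulrA divff ?normr_eq0// mul1r; congr (_ * expR _).
by rewrite -mulr_natr; field.
Qed.

Lemma measurable_affine (a b : R) : measurable_fun setT (fun x : R => a * x + b).
Proof. by apply: measurable_funD => //; exact: measurable_funM. Qed.

Lemma integral_gauss_opp (f : R -> R) : measurable_fun setT f ->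
  (forall x, 0 <= f x) ->
  (\int[mu]_x (f (- x) * gauss x)%:E = \int[mu]_x (f x * gauss x)%:E)%E.
Proof.
move=> mf f0.
have N1 : -1 != 0 :> R by rewrite oppr_eq0 oner_eq0.
rewrite [RHS](ge0_integral_affine 0 N1); last 2 first.
- by apply: measurable_funM => //; exact: measurable_gauss.
- by move=> x; rewrite mulr_ge0// gauss_ge0.
by apply: eq_integral => x _; rewrite normrN1 mul1r addr0 mulN1r gaussN.
Qed.

(** Writing the variable as [s * x + m] with [x] standard normal covers the point masses
[s = 0] as well, which have no density. *)
Lemma normal_law_expectation d (T : measurableType d) (P : probability T R)
    (X : T -> R) (m s : R) : measurable_fun setT X ->
  (forall A, measurable A -> P (X @^-1` A) = normal_law m s A) ->
  forall f : R -> R, measurable_fun setT f -> (forall x, 0 <= f x) ->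
  (\int[P]_w (f (X w))%:E = \int[mu]_x (f (s * x + m) * gauss x)%:E)%E.
Proof.
move=> mX lawX f mf f0.
have mEf : measurable_fun setT (EFin \o f) by exact/measurable_EFinP.
pose mX' : @measurable_fun _ _ T (measurableTypeR R) setT X := mX.
pose X' : {mfun T >-> measurableTypeR R} := @mfun_Sub _ _ T (measurableTypeR R) X (mem_set mX').
have -> : (\int[P]_w (f (X w))%:E =
           \int[distribution P X']_x (f x)%:E)%E.
  by rewrite ge0_integral_distribution.
have [s0|s0] := eqVneq s 0.
  rewrite (@eq_measure_integral _ (measurableTypeR R) R setT (@dirac _ (measurableTypeR R) m R)); last first.
    by move=> A mA _; have := lawX _ mA; rewrite /normal_law s0 eqxx.
  rewrite integral_dirac// diracT mul1e.
  have e x : (f (s * x + m) * gauss x)%:E = ((f m)%:E * (gauss x)%:E)%E.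
    by rewrite s0 mul0r add0r EFinM.
  under [RHS]eq_integral do rewrite e.
  rewrite ge0_integralZl//; first by rewrite integral_gauss mule1.
  - by apply/measurable_EFinP; exact: measurable_gauss.
  - by move=> x _; rewrite lee_fin gauss_ge0.
  - by rewrite lee_fin.
transitivity (\int[normal_prob m s]_x (f x)%:E)%E.
  apply: eq_measure_integral => A mA _.
  by have := lawX _ mA; rewrite /normal_law (negbTE s0).
rewrite (@ge0_integral_density _ _ _ mu _ (normal_pdf m s))//; last 2 first.
- exact: measurable_normal_pdf.
- by move=> x; exact: normal_pdf_ge0.
rewrite (ge0_integral_affine m s0); last 2 first.
- by apply: measurable_funM => //; exact: measurable_normal_pdf.
- by move=> x; rewrite mulr_ge0// normal_pdf_ge0.
by apply: eq_integral => x _; rewrite mulrCA normal_pdf_affine.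
Qed.

(** The left-hand side is the joint density of [a x + b y] and [y], for independent standard
normal [x] and [y]. Completing the square factors it into the density of the law
[N(0, s^2)] and a normal density in [y], which integrates to 1. *)
Lemma gauss_kernel (a b z y : R) : a != 0 -> b != 0 ->
  let s : R := Num.sqrt (a ^+ 2 + b ^+ 2) in
  `|a|^-1 * gauss ((z - b * y) / a) * gauss y =
  s^-1 * gauss (z / s) * (s / `|a| * gauss (s / `|a| * y + - (b * z / (s * `|a|)))).
Proof.
move=> a0 b0 s.
have s2 : s ^+ 2 = a ^+ 2 + b ^+ 2 by rewrite sqr_sqrtr// addr_ge0 ?sqr_ge0.
move: s s2 => s s2.
have ab0 : a ^+ 2 + b ^+ 2 != 0.
  by rewrite gt_eqF// ltr_pwDl ?sqr_ge0// exprn_even_gt0.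
have s0 : s != 0 by apply: contraNneq ab0 => s0; rewrite -s2 s0 expr0n.
have na0 : `|a| != 0 by rewrite normr_eq0.
have na2 : `|a| ^+ 2 = a ^+ 2 by rewrite real_normK ?num_real.
have ba : s / `|a| * s^-1 = `|a|^-1. by field; rewrite na0.
rewrite !gaussE.
set E1 := expR _; set E2 := expR _; set E3 := expR _; set E4 := expR _.
have EE : E1 * E2 = E3 * E4.
  rewrite /E1 /E2 /E3 /E4 -!expRD; congr expR.
  have -> : (s / `|a| * y + - (b * z / (s * `|a|))) ^+ 2 =
     (s ^+ 2 * y - b * z) ^+ 2 / (s ^+ 2 * `|a| ^+ 2).
    by field; rewrite na0.
  have -> : (z / s) ^+ 2 = z ^+ 2 / s ^+ 2 by rewrite expr_div_n.
  by rewrite na2 s2; field; rewrite a0.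
transitivity (`|a|^-1 * normal_peak 1 * normal_peak 1 * (E1 * E2)); first ring.
by rewrite EE; field; rewrite na0.
Qed.

End standard_normal.

Section rotation.
Context {R : realType}.
Local Notation mu := (@lebesgue_measure R).
(** The combination [a x + b y] of independent standard normal variables is distributed like
[sqrt (a^2 + b^2) z]: substitute [z = a x + b y] for [x], exchange the integrals, and
integrate [y] out of [gauss_kernel]. *)
Lemma gauss_rotation (a b : R) (f : R -> R) : measurable_fun setT f ->
  (forall x, 0 <= f x) ->
  (\int[mu]_y ((\int[mu]_x (f (a * x + b * y) * gauss x)%:E) * (gauss y)%:E) =
   \int[mu]_z (f (Num.sqrt (a ^+ 2 + b ^+ 2) * z) * gauss z)%:E)%E.
Proof.
move=> mf f0.
have mfs (c e : R) : measurable_fun setT (fun x => f (c * x + e)).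
  by apply: measurableT_comp => //; exact: measurable_affine.
have mfs0 (c : R) : measurable_fun setT (fun x => f (c * x)).
  by have := mfs c 0; under eq_fun do rewrite addr0.
have absE (c : R) : (\int[mu]_z (f (c * z) * gauss z)%:E =
    \int[mu]_z (f (`|c| * z) * gauss z)%:E)%E.
  have [c0|c0] := ger0P c; first by [].
  rewrite -integral_gauss_opp//.
  by apply: eq_integral => x _; rewrite mulrN mulNr.
have gm : measurable_fun setT (EFin \o @gauss R).
  by apply/measurable_EFinP; exact: measurable_gauss.
(* When [a] or [b] vanishes, one of the two integrals is that of [gauss]. *)
have [->|a0] := eqVneq a 0.
  rewrite expr0n add0r sqrtr_sqr -absE; apply: eq_integral => y _.
  under eq_integral do rewrite mul0r add0r EFinM.
  rewrite ge0_integralZl//; first by rewrite integral_gauss mule1.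
  - by move=> x _; rewrite lee_fin gauss_ge0.
  - by rewrite lee_fin.
have [->|b0] := eqVneq b 0.
  rewrite expr0n addr0 sqrtr_sqr -absE.
  under eq_integral do under eq_integral do rewrite mul0r addr0.
  rewrite ge0_integralZl//.
  - by rewrite integral_gauss mule1.
  - by move=> x _; rewrite lee_fin gauss_ge0.
  - by apply: integral_ge0 => x _; rewrite lee_fin mulr_ge0// gauss_ge0.
set s := Num.sqrt _.
have ab0 : 0 < a ^+ 2 + b ^+ 2.
  by rewrite ltr_pwDl ?sqr_ge0// exprn_even_gt0.
have s0 : 0 < s by rewrite sqrtr_gt0.
have aV0 : a^-1 != 0 by rewrite invr_eq0.
pose k (y z : R) := f z * (`|a|^-1 * gauss ((z - b * y) / a) * gauss y).
have k0 y z : 0 <= k y z by rewrite !mulr_ge0 ?gauss_ge0.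
have mk : measurable_fun setT (fun p : R * R => k p.1 p.2).
  apply: measurable_funM; first exact: (measurableT_comp mf measurable_snd).
  apply: measurable_funM; last first.
    exact: (measurableT_comp measurable_gauss measurable_fst).
  apply: measurable_funM => //.
  apply: (measurableT_comp measurable_gauss).
  apply: measurable_funM => //.
  apply: measurable_funB => //.
  exact: (measurableT_comp (mulrl_measurable b) (@measurable_fst _ _ R R)).
transitivity (\int[mu]_y \int[mu]_z (k y z)%:E)%E.
  apply: eq_integral => y _.
  rewrite -ge0_integralZr//; last 3 first.
  - apply/measurable_EFinP.
    by apply: measurable_funM; [exact: mfs|exact: measurable_gauss].
  - by move=> x _; rewrite lee_fin mulr_ge0// gauss_ge0.
  - by rewrite lee_fin gauss_ge0.
  under eq_integral do rewrite -EFinM.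
  rewrite (ge0_integral_affine (- (b * y) / a) aV0); last 2 first.
  - apply: measurable_funM => //.
    by apply: measurable_funM; [exact: mfs|exact: measurable_gauss].
  - by move=> x; rewrite !mulr_ge0// gauss_ge0.
  apply: eq_integral => z _; congr EFin.
  have -> : a * (a^-1 * z + - (b * y) / a) + b * y = z by field.
  have -> : a^-1 * z + - (b * y) / a = (z - b * y) / a by field.
  by rewrite /k normfV; ring.
rewrite (@fubini_tonelli _ _ _ _ _ mu mu (fun p => (k p.1 p.2)%:E))/=; last 2 first.
- exact/measurable_EFinP.
- by move=> p; rewrite lee_fin.
transitivity (\int[mu]_z (f z * (s^-1 * gauss (z / s)))%:E)%E.
  apply: eq_integral => z _.
  have e y : (k y z)%:E = ((f z * (s^-1 * gauss (z / s)))%:E *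
      (s / `|a| * gauss (s / `|a| * y + - (b * z / (s * `|a|))))%:E)%E.
    by rewrite -EFinM /k gauss_kernel// mulrA.
  under eq_integral do rewrite e.
  have c0 : s / `|a| != 0.
    by rewrite mulf_eq0 invr_eq0 normr_eq0 negb_or a0 gt_eqF.
  have := ge0_integral_affine (- (b * z / (s * `|a|))) c0 measurable_gauss gauss_ge0.
  have sa0 : 0 < s / `|a| by rewrite divr_gt0 ?normr_gt0.
  rewrite integral_gauss (gtr0_norm sa0) => I1.
  rewrite ge0_integralZl//.
  - by rewrite -I1 mule1.
  - apply/measurable_EFinP; apply: measurable_funM => //.
    by apply: measurableT_comp; [exact: measurable_gauss|exact: measurable_affine].
  - by move=> y _; rewrite lee_fin mulr_ge0 ?gauss_ge0// ltW.
  - by rewrite lee_fin !mulr_ge0 ?gauss_ge0// invr_ge0 ltW.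
rewrite (ge0_integral_affine 0 (lt0r_neq0 s0)); last 2 first.
- apply: measurable_funM => //; apply: measurable_funM => //.
  by apply: measurableT_comp; [exact: measurable_gauss|exact: measurable_funM].
- by move=> x; rewrite !mulr_ge0 ?gauss_ge0 ?invr_ge0// ltW.
apply: eq_integral => z _; rewrite addr0 gtr0_norm// (mulrC s z) mulfK ?gt_eqF//.
by rewrite mulrCA mulVKf ?gt_eqF.
Qed.

End rotation.

Section normal_moments.
Context {R : realType}.
Local Notation mu := (@lebesgue_measure R).

(** The value 1 of this integral stays implicit: it serves as a positive finite unit of
variance. *)
Definition gauss_var : \bar R := (\int[mu]_x (x ^+ 2 * gauss x)%:E)%E.

Lemma gauss_var_ge0 : (0 <= gauss_var)%E.
Proof.
by apply: integral_ge0 => x _; rewrite lee_fin mulr_ge0 ?sqr_ge0 ?gauss_ge0.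
Qed.

Context {d} {T : measurableType d} (P : probability T R).
Variables (X : T -> R) (m s : R).
Hypothesis X2 : X \in Lfun P 2%:E.
Hypothesis lawX :
  forall A, measurable A -> P (X @^-1` A) = normal_law m s A.

Let Pfin : P setT \is a fin_num := fin_num_measure P _ measurableT.

Let mX : measurable_fun setT X.
Proof. by move: X2; rewrite inE => /andP[/[!inE]]. Qed.

Lemma normal_second_moment : ('E_P[fun w => ((X w - m) ^+ 2)%R] = (s ^+ 2)%:E * gauss_var)%E.
Proof.
rewrite unlock (normal_law_expectation mX lawX (f := fun x => (x - m) ^+ 2)); last 2 first.
- by apply: measurable_funX; apply: measurable_funB.
- by move=> x; exact: sqr_ge0.
rewrite /gauss_var -ge0_integralZl//.
- by apply: eq_integral => x _; rewrite addrK exprMn -mulrA EFinM.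
- apply/measurable_EFinP; apply: measurable_funM; last exact: measurable_gauss.
  exact: measurable_funX.
- by move=> x _; rewrite lee_fin mulr_ge0 ?sqr_ge0 ?gauss_ge0.
- by rewrite lee_fin sqr_ge0.
Qed.

(** [(X - m + 1)^2] and [(X - m - 1)^2] are nonnegative and have the same mean by symmetry,
and their difference is [4 (X - m)]. *)
Lemma normal_mean : ('E_P[X] = m%:E)%E.
Proof.
have X1 := Lfun_subset12 Pfin X2.
pose Y := X \- cst m.
have Y2 : Y \in Lfun P 2%:E by rewrite rpredB ?lee1n //= Lfun_cst.
have Y1 := Lfun_subset12 Pfin Y2.
have E1 (e : R) : ('E_P[fun w => ((X w - m + e) ^+ 2)%R] =
    'E_P[Y \* Y] + (2 * e)%R%:E * 'E_P[Y] + (e ^+ 2)%R%:E)%E.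
  have YY1 := Lfun2_mul_Lfun1 Y2 Y2.
  have eY1 : (2 * e)%R \o* Y \in Lfun P 1 by rewrite Lfun_scale.
  have S1 : Y \* Y \+ (2 * e)%R \o* Y \in Lfun P 1 by rewrite rpredD.
  rewrite -expectationZl// -expectationD// -(expectation_cst P (e ^+ 2)).
  rewrite -expectationD ?Lfun_cst//.
  by congr expectation; apply/funext => w; rewrite /Y /=; ring.
have E2 (e : R) : ('E_P[fun w => ((X w - m + e) ^+ 2)%R] =
    \int[mu]_x ((s * x + e) ^+ 2 * gauss x)%:E)%E.
  rewrite unlock (normal_law_expectation mX lawX (f := fun x => (x - m + e) ^+ 2)); last 2 first.
  - by apply: measurable_funX; apply: measurable_funD => //; apply: measurable_funB.
  - by move=> x; exact: sqr_ge0.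
  by apply: eq_integral => x _; rewrite addrK.
have E3 : ('E_P[fun w => ((X w - m + 1) ^+ 2)%R] = 'E_P[fun w => ((X w - m + -1) ^+ 2)%R])%E.
  rewrite !E2 -(integral_gauss_opp (f := fun x => (s * x + 1) ^+ 2)).
  - by apply: eq_integral => x _; congr (_ * _)%:E; ring.
  - by apply: measurable_funX; apply: measurable_funD => //; apply: measurable_funM.
  - by move=> x; exact: sqr_ge0.
have fY := expectation_fin_num Y1.
have fYY := expectation_fin_num (Lfun2_mul_Lfun1 Y2 Y2).
have EY : ('E_P[Y] = 0)%E.
  move: E3; rewrite !E1 -(fineK fY) -(fineK fYY) -!EFinM -!EFinD => -[].
  by move=> h; congr EFin; lra.
have -> : X = Y \+ cst m by apply/funext => w; rewrite /Y /= subrK.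
by rewrite expectationD ?Lfun_cst// EY add0e expectation_cst.
Qed.

Lemma normal_variance : ('V_P[X] = (s ^+ 2)%:E * gauss_var)%E.
Proof.
by rewrite -normal_second_moment /variance unlock normal_mean; congr expectation.
Qed.

End normal_moments.

(** * Equicorrelated Gaussian vectors *)

Section equicorrelated.
Context {R : realType} {m : nat}.
Local Notation mu := (@lebesgue_measure R).

Definition equicorrelated {d} {T : measurableType d} (P : probability T R)
    (rho : R) (V : T -> m.-tuple R) : Prop :=
  [/\ jointly_gaussian P V,
      forall k, ('E_P[fun w => tnth (V w) k] = 0)%E,
      forall k, ('V_P[fun w => tnth (V w) k] = 1)%E &
      forall k l, k != l ->
        covariance P (fun w => tnth (V w) k) (fun w => tnth (V w) l) = rho%:E].

(** The quadratic form of the covariance matrix with diagonal 1 and off-diagonal entries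
[rho]. *)
Definition cov_form (rho : R) (c : 'I_m -> R) : R :=
  (1 - rho) * (\sum_k c k ^+ 2) + rho * (\sum_k c k) ^+ 2.

Section projections.
Context {d} {T : measurableType d} (P : probability T R).
Variables (rho : R) (V : T -> m.-tuple R).
Hypothesis mV : measurable_fun setT V.
Hypothesis VP : equicorrelated P rho V.

Let Pfin : P setT \is a fin_num := fin_num_measure P _ measurableT.
Let X k w := tnth (V w) k.

Let mX k : measurable_fun setT (X k).
Proof. exact: (measurableT_comp (@measurable_tnth _ _ m k) mV). Qed.

Lemma equicorrelated_Lfun2 k : X k \in Lfun P 2%:E.
Proof.
have [_ E0 V1 _] := VP.
rewrite inE; apply/andP; split; rewrite inE/=; first exact: mX.
have := V1 k; rewrite /variance unlock E0/= => h.
rewrite /finite_norm unlock /=.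
suff -> : (\int[P]_x `|(X k x)%:E| `^ 2 = 1)%E by rewrite poweR_EFin ltry.
move: h; rewrite unlock => <-.
apply: eq_integral => w _ /=.
rewrite !fctE /= !subr0.
 by rewrite /X -expr2 powR_mulrn// real_normK ?num_real.
Qed.

Let comb (r : seq 'I_m) (c : 'I_m -> R) w := \sum_(k <- r) c k * X k w.

Lemma comb_Lfun2 r c : comb r c \in Lfun P 2%:E.
Proof.
elim: r => [|k r IH].
  rewrite (_ : comb [::] c = cst 0) ?Lfun_cst//.
  by apply/funext => w; rewrite /comb big_nil.
rewrite (_ : comb (k :: r) c = (c k \o* X k) \+ comb r c); last first.
  by apply/funext => w; rewrite /comb big_cons /= mulrC.
by rewrite rpredD ?lee1n//= Lfun_scale ?ler1n// equicorrelated_Lfun2.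
Qed.

Lemma comb_mean r c : ('E_P[comb r c] = 0)%E.
Proof.
elim: r => [|k r IH].
  rewrite (_ : comb [::] c = cst 0) ?expectation_cst//.
  by apply/funext => w; rewrite /comb big_nil.
rewrite (_ : comb (k :: r) c = (c k \o* X k) \+ comb r c); last first.
  by apply/funext => w; rewrite /comb big_cons /= mulrC.
have X1 := Lfun_subset12 Pfin (equicorrelated_Lfun2 k).
rewrite expectationD ?IH//.
- by rewrite expectationZl// (_ : X k = fun w => tnth (V w) k)//; have [_ -> _ _] := VP; rewrite mule0 adde0.
- by rewrite Lfun_scale.
- exact: Lfun_subset12 (comb_Lfun2 r c).
Qed.

Lemma comb_covariance r c Z : Z \in Lfun P 2%:E ->
  covariance P (comb r c) Z = (\sum_(k <- r) (c k)%:E * covariance P (X k) Z)%E.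
Proof.
move=> Z2; elim: r => [|k r IH].
  rewrite (_ : comb [::] c = cst 0) ?covariance_cst_l ?big_nil//.
  by apply/funext => w; rewrite /comb big_nil.
rewrite (_ : comb (k :: r) c = (c k \o* X k) \+ comb r c); last first.
  by apply/funext => w; rewrite /comb big_cons /= mulrC.
have X2 := equicorrelated_Lfun2 k.
have X1 := Lfun_subset12 Pfin X2.
have Z1 := Lfun_subset12 Pfin Z2.
rewrite covarianceDl ?comb_Lfun2//; last by rewrite Lfun_scale// ler1n.
by rewrite covarianceZl ?Lfun2_mul_Lfun1// IH big_cons.
Qed.

Lemma comb_variance c :
  ('V_P[fun w => proj_comb c (V w)] = (cov_form rho c)%:E)%E.
Proof.
have [_ _ V1 C] := VP.
rewrite -[fun w => _]/(comb (index_enum 'I_m) c) /variance comb_covariance ?comb_Lfun2//.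
have covE k l : covariance P (X k) (X l) = ((1 - rho) * (k == l)%:R + rho)%:E.
  case: eqVneq => [->|kl]; last by rewrite mulr0 add0r; exact: C.
  by rewrite mulr1 subrK; exact: V1.
under eq_bigr => k _.
  rewrite covarianceC comb_covariance ?equicorrelated_Lfun2//.
  under eq_bigr => l _ do rewrite covE -EFinM.
  rewrite sumEFin -EFinM.
  over.
rewrite sumEFin; congr EFin; rewrite /cov_form mulr_sumr expr2.
under eq_bigr => k _.
  under eq_bigr => l _ do rewrite mulrDr mulrCA.
  rewrite big_split /= -mulr_sumr -mulr_suml (bigD1 k)//= eqxx mulr1 big1; last first.
    by move=> l /negbTE lk; rewrite lk mulr0.
  rewrite addr0 mulrDr.
  over.
rewrite big_split /= mulr_sumr; congr (_ + _).
  by apply: eq_bigr => k _; rewrite mulrCA expr2.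
rewrite -mulr_suml -mulr_sumr; ring.
Qed.

(** A coordinate is normal with some standard deviation [s] and has variance 1, so that
[s^2 * gauss_var = 1]. *)
Lemma gauss_var_positive (k : 'I_m) :
  0 < fine (@gauss_var R) /\ gauss_var = (fine (@gauss_var R))%:E.
Proof.
have [J E0 V1 _] := VP.
have [a [s lawX]] := J (fun l => (l == k)%:R).
have E : (fun w => \sum_(l < m) (l == k)%:R * tnth (V w) l) = X k.
  apply/funext => w; rewrite (bigD1 k)//= eqxx mul1r big1 ?addr0// => l /negbTE ->.
  by rewrite mul0r.
have lawX' A : measurable A -> P (X k @^-1` A) = normal_law a s A.
  by move=> mA; rewrite -(lawX _ mA) -E.
have := normal_variance (equicorrelated_Lfun2 k) lawX'.
rewrite [X in X = _ -> _](V1 k).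
have := @gauss_var_ge0 R; case: (@gauss_var R) => [v|//|//] /=.
  rewrite lee_fin le_eqVlt => /predU1P[<-|v0 _]; last by split.
  by rewrite mule0 => -[] /eqP; rewrite oner_eq0.
move=> _; case: (eqVneq s 0) => [->|s0].
  by rewrite expr0n mul0e => -[] /eqP; rewrite oner_eq0.
by rewrite gt0_muley ?lte_fin ?exprn_even_gt0.
Qed.

(** The projection is normal with mean 0 and variance [cov_form rho c]. Its parameter [s]
is determined up to sign, and the sign does not change the law. *)
Lemma gaussian_projection (c : 'I_m -> R) (f : R -> R) :
  (0 < m)%N -> measurable_fun setT f -> (forall x, 0 <= f x) ->
  0 <= cov_form rho c /\
  (\int[P]_w (f (proj_comb c (V w)))%:E = \int[mu]_x
     (f (Num.sqrt (cov_form rho c / fine (@gauss_var R)) * x) * gauss x)%:E)%E.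
Proof.
move=> m0 mf f0; have [J _ _ _] := VP.
have [v0 vE] := gauss_var_positive (Ordinal m0).
have [a [s lawX]] := J c.
have L2 := comb_Lfun2 (index_enum 'I_m) c.
have := normal_mean L2 lawX; rewrite comb_mean => -[a0].
have := normal_variance L2 lawX.
rewrite [X in X = _ -> _](comb_variance c) vE -EFinM => -[qE].
split; first by rewrite qE mulr_ge0 ?sqr_ge0 ?ltW.
rewrite qE mulfK ?gt_eqF// sqrtr_sqr.
rewrite (normal_law_expectation (measurableT_comp (measurable_proj_comb c) mV) lawX)//.
rewrite -a0.
under eq_integral do rewrite addr0.
have [_|s0] := ger0P s; first by [].
rewrite -(integral_gauss_opp (f := fun x => f (- s * x))).
- by apply: eq_integral => x _; rewrite mulNr mulrN opprK.
- apply: measurableT_comp => //; exact: measurable_funM.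
- by move=> x.
Qed.

End projections.
End equicorrelated.

Section uniqueness.
Context {R : realType} {m : nat}.
Local Notation mu := (@lebesgue_measure R).

Lemma measurable_cos_comp d (T : measurableType d) (Z : T -> R) :
  measurable_fun setT Z -> measurable_fun setT (fun w => cos (Z w)).
Proof.
move=> mZ; apply: measurableT_comp => //.
exact: continuous_measurable_fun (@continuous_cos R).
Qed.

Lemma integral_1Dcos d (T : measurableType d) (P : probability T R) (Z : T -> R) :
  measurable_fun setT Z ->
  (\int[P]_w (1 + cos (Z w))%:E = 1 + \int[P]_w (cos (Z w))%:E)%E /\
  (\int[P]_w (cos (Z w))%:E)%E \is a fin_num.
Proof.
move=> mZ; have mc := measurable_cos_comp mZ.
have I : P.-integrable setT (fun w => (cos (Z w))%:E).
  apply: (@le_integrable _ _ _ P setT measurableT _ (cst 1%:E)).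
  - exact/measurable_EFinP.
  - by move=> w _ /=; rewrite lee_fin normr1 cos_max.
  - exact: finite_measure_integrable_cst.
split; last exact: integrable_fin_num.
under eq_integral do rewrite EFinD.
rewrite integralD//=; last exact: finite_measure_integrable_cst.
by congr (_ + _)%E; rewrite integral_cst//= probability_setT mule1.
Qed.

Lemma measurable_1Dcos (s : R) : measurable_fun setT (fun x : R => 1 + cos (x + s)).
Proof.
apply: measurable_funD => //; apply: measurable_cos_comp.
exact: measurable_funD.
Qed.

Lemma ge0_1Dcos (x : R) : 0 <= 1 + cos x.
Proof. by have := cos_geN1 x; lra. Qed.

Lemma eq_integral_1Dcos d d' (T : measurableType d) (T' : measurableType d')
    (P : probability T R) (P' : probability T' R) (Z : T -> R) (Z' : T' -> R) :
  measurable_fun setT Z -> measurable_fun setT Z' ->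
  (\int[P]_w (1 + cos (Z w))%:E = \int[P']_w (1 + cos (Z' w))%:E)%E ->
  (\int[P]_w (cos (Z w))%:E = \int[P']_w (cos (Z' w))%:E)%E.
Proof.
move=> mZ mZ'.
have [-> f] := integral_1Dcos P mZ; have [-> f'] := integral_1Dcos P' mZ'.
by rewrite -(fineK f) -(fineK f') -!EFinD => -[] /addrI ->.
Qed.

(** By [cramer_wold] it is enough to compare cosines of projections. The added constant 1
makes the integrands nonnegative; by [gaussian_projection] their means depend on [rho]
and [c] alone. *)
Lemma equicorrelated_unique d d' (T : measurableType d) (T' : measurableType d')
    (P : probability T R) (P' : probability T' R) (rho : R)
    (V : T -> m.-tuple R) (V' : T' -> m.-tuple R) : (0 < m)%N ->
  measurable_fun setT V -> measurable_fun setT V' ->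
  equicorrelated P rho V -> equicorrelated P' rho V' ->
  forall A, measurable A -> P (V @^-1` A) = P' (V' @^-1` A).
Proof.
move=> m0 mV mV' VP VP'; apply: cramer_wold => // c s.
have mZ d0 (T0 : measurableType d0) (V0 : T0 -> m.-tuple R) :
    measurable_fun setT V0 ->
    measurable_fun setT (fun w => proj_comb c (V0 w) + s).
  move=> mV0; apply: measurable_funD => //.
  exact: (measurableT_comp (measurable_proj_comb c) mV0).
apply: eq_integral_1Dcos; [exact: mZ|exact: mZ|].
have F0 x : 0 <= 1 + cos (x + s) by exact: ge0_1Dcos.
have [_ ->] := gaussian_projection mV VP c m0 (measurable_1Dcos s) F0.
by have [_ ->] := gaussian_projection mV' VP' c m0 (measurable_1Dcos s) F0.
Qed.

End uniqueness.

Section resample.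
Context {R : realType} {m : nat}.
Local Notation mu := (@lebesgue_measure R).

Definition tail_sum (v : m.-tuple R) : R := \sum_(k < m | (0 < k)%N) tnth v k.

(** The tail of [u] is translated so that it sums to [y], and so keeps its deviations from
its mean. *)
Definition gauss_fill (y : R) (u : m.-tuple R) : m.-tuple R :=
  [tuple y / m.-1%:R + (tnth u k - tail_sum u / m.-1%:R) | k < m].

Definition with_first (v u : m.-tuple R) : m.-tuple R :=
  [tuple if val k == 0%N then tnth v k else tnth u k | k < m].

Variables (rho : R) (m2 : (1 < m)%N).

Let k0 : 'I_m := Ordinal (ltnW m2).

Lemma sum_tail (F : 'I_m -> R) : \sum_k F k = F k0 + \sum_(k < m | (0 < k)%N) F k.
Proof.
rewrite (bigD1 k0)//=; congr (_ + _); apply: eq_bigl => k.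
by rewrite -val_eqE/= lt0n.
Qed.

Lemma card_tail : (\sum_(k < m | (0 < k)%N) 1 : R) = m.-1%:R.
Proof.
have mE : (m%:R : R) = 1 + m.-1%:R.
  by rewrite -[in LHS](prednK (ltnW m2)) -natr1 addrC.
by have := sum_tail (fun=> 1); rewrite sumr_const card_ord mE => /addrI ->.
Qed.

Section coefficients.
Variable c : 'I_m -> R.
Let cbar := (\sum_(k < m | (0 < k)%N) c k) / m.-1%:R.

(** A linear form [c] is the sum of two forms: [keep_coef] sees the tail only through
its sum, and [dev_coef] sees only the deviations of the tail from its mean. *)
Definition keep_coef (k : 'I_m) : R := if val k == 0%N then c k else cbar.
Definition dev_coef (k : 'I_m) : R := if val k == 0%N then 0 else c k - cbar.

Lemma m1_neq0 : m.-1%:R != 0 :> R.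
Proof. by rewrite pnatr_eq0 -lt0n -subn1 subn_gt0. Qed.

Lemma dev_coef_sum0 : \sum_(k < m | (0 < k)%N) (c k - cbar) = 0.
Proof.
have -> : \sum_(k < m | (0 < k)%N) (c k - cbar) =
    \sum_(k < m | (0 < k)%N) c k - cbar * \sum_(k < m | (0 < k)%N) 1.
  by rewrite mulr_sumr sumrB; congr (_ - _); apply: eq_bigr => k _; rewrite mulr1.
by rewrite card_tail /cbar divfK ?subrr// m1_neq0.
Qed.

Lemma tail_if (G H : 'I_m -> R) :
  \sum_(k < m | (0 < k)%N) (if val k == 0%N then G k else H k) =
  \sum_(k < m | (0 < k)%N) H k.
Proof. by apply: eq_bigr => k; rewrite lt0n => /negbTE ->. Qed.

Lemma proj_comb_fill v u :
  proj_comb c (with_first v (gauss_fill (tail_sum v) u)) =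
  proj_comb keep_coef v + proj_comb dev_coef u.
Proof.
rewrite /proj_comb !sum_tail /= mul0r add0r tnth_mktuple/= -addrA; congr (_ + _).
under eq_bigr => k k1.
  rewrite tnth_mktuple -(negbK (_ == _)) -lt0n k1 /= tnth_mktuple; over.
under [X in _ = X + _]eq_bigr => k k1.
  rewrite /keep_coef -(negbK (_ == _)) -lt0n k1 /=; over.
under [X in _ = _ + X]eq_bigr => k k1.
  rewrite /dev_coef -(negbK (_ == _)) -lt0n k1 /=; over.
rewrite -mulr_sumr -/(tail_sum v).
under eq_bigr do rewrite mulrDr mulrBr.
rewrite !big_split/= sumrN -!mulr_suml.
under [X in _ = _ + X]eq_bigr do rewrite mulrBl.
rewrite sumrB -mulr_sumr -/(tail_sum u) /cbar; ring.
Qed.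

(** The two forms are uncorrelated, since deviations from a mean are orthogonal to
constants. *)
Lemma cov_form_split :
  cov_form rho keep_coef + cov_form rho dev_coef = cov_form rho c.
Proof.
rewrite /cov_form !sum_tail /keep_coef /dev_coef /=.
have D0 := dev_coef_sum0.
have E1 : \sum_(k < m | (0 < k)%N) (if val k == 0%N then 0 else c k - cbar) = 0.
  by rewrite tail_if.
have E2 : \sum_(k < m | (0 < k)%N) (if val k == 0%N then c k else cbar) =
    \sum_(k < m | (0 < k)%N) c k.
  rewrite tail_if; apply/eqP; rewrite eq_sym -subr_eq0 -sumrB.
  exact/eqP.
have E3 : \sum_(k < m | (0 < k)%N) (if val k == 0%N then 0 else c k - cbar) ^+ 2 =
    \sum_(k < m | (0 < k)%N) (c k - cbar) ^+ 2.
  by apply: eq_bigr => k; rewrite lt0n => /negbTE ->.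
have E4 : \sum_(k < m | (0 < k)%N) (if val k == 0%N then c k else cbar) ^+ 2 =
    \sum_(k < m | (0 < k)%N) cbar ^+ 2.
  by apply: eq_bigr => k; rewrite lt0n => /negbTE ->.
have E5 : \sum_(k < m | (0 < k)%N) c k ^+ 2 =
    \sum_(k < m | (0 < k)%N) cbar ^+ 2 + \sum_(k < m | (0 < k)%N) (c k - cbar) ^+ 2.
  transitivity (\sum_(k < m | (0 < k)%N)
      (cbar ^+ 2 + (c k - cbar) ^+ 2 + 2 * cbar * (c k - cbar))).
    by apply: eq_bigr => k _; ring.
  by rewrite big_split /= -mulr_sumr D0 mulr0 addr0 big_split.
rewrite E1 E2 E3 E4 E5; ring.
Qed.

End coefficients.

Lemma measurable_mktuple d (T : measurableType d) (F : 'I_m -> T -> R) :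
  (forall k, measurable_fun setT (F k)) ->
  measurable_fun setT (fun w => [tuple F k w | k < m]).
Proof.
move=> mF; apply/measurable_fun_tnthP => k.
rewrite (_ : _ \o _ = F k)//; apply/funext => w /=.
by rewrite tnth_mktuple.
Qed.

Lemma measurable_tail_sum : measurable_fun setT tail_sum.
Proof.
rewrite (_ : tail_sum = fun v => \sum_(k <- [seq k : 'I_m <- index_enum 'I_m | (0 < k)%N]) tnth v k).
  by apply: measurable_sum => k; exact: measurable_tnth.
by apply/funext => v; rewrite big_filter.
Qed.

Lemma measurable_gauss_fill :
  measurable_fun setT (fun p : R * m.-tuple R => gauss_fill p.1 p.2).
Proof.
apply: measurable_mktuple => k; apply: measurable_funD.
  by apply: measurable_funM => //; exact: measurable_fst.
apply: measurable_funB.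
  exact: (measurableT_comp (measurable_tnth k) measurable_snd).
apply: measurable_funM => //.
exact: (measurableT_comp measurable_tail_sum measurable_snd).
Qed.

Context {d d' : measure_display} {T : measurableType d} {T' : measurableType d'}.
Variables (P : probability T R) (P' : probability T' R).
Variables (V : T -> m.-tuple R) (U : T' -> m.-tuple R).
Hypotheses (mV : measurable_fun setT V) (mU : measurable_fun setT U).
Hypotheses (VP : equicorrelated P rho V) (UP : equicorrelated P' rho U).

(** A projection of the refilled vector is [keep_coef c] applied to [V] plus [dev_coef c]
applied to the independent [U], a sum of independent centred normal variables. Their
variances add up to that of the projection of [V] along [c], by [cov_form_split]. *)
Lemma gauss_fill_law A : measurable A ->
  (P \x P')%E [set p | A (with_first (V p.1) (gauss_fill (tail_sum (V p.1)) (U p.2)))]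
  = P (V @^-1` A).
Proof.
pose W (p : T * T') := with_first (V p.1) (gauss_fill (tail_sum (V p.1)) (U p.2)).
have mW : measurable_fun setT W.
  apply: (@measurable_mktuple _ _ (fun k p => if val k == 0%N then tnth (V p.1) k else tnth (gauss_fill (tail_sum (V p.1)) (U p.2)) k)) => k; case: (val k == 0%N).
    exact: (measurableT_comp (measurable_tnth k) (measurableT_comp mV measurable_fst)).
  have mp : measurable_fun setT (fun p : T * T' => (tail_sum (V p.1), U p.2)).
    apply: measurable_fun_pair.
      exact: (measurableT_comp measurable_tail_sum (measurableT_comp mV measurable_fst)).
    exact: (measurableT_comp mU measurable_snd).
  exact: (measurableT_comp (measurable_tnth k) (measurableT_comp measurable_gauss_fill mp)).
move=> mA; rewrite -/(W @^-1` A); move: A mA.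
apply: (@cramer_wold _ _ _ _ _ _ (P \x P')%E P W V mW mV) => c s.
have m0 : (0 < m)%N := ltnW m2.
pose F x : R := 1 + cos (x + s).
have F0 x : 0 <= F x by exact: ge0_1Dcos.
have mF := measurable_1Dcos s.
have mpW : measurable_fun setT (fun p => proj_comb c (W p)).
  exact: (measurableT_comp (measurable_proj_comb c) mW).
have mpV : measurable_fun setT (fun p => proj_comb c (V p)).
  exact: (measurableT_comp (measurable_proj_comb c) mV).
apply: eq_integral_1Dcos; [exact: measurable_funD|exact: measurable_funD|].
rewrite (@fubini_tonelli2 _ _ _ _ _ P P' (fun p => (F (proj_comb c (W p)))%:E))/=; last 2 first.
- by apply/measurable_EFinP; exact: (measurableT_comp mF mpW).
- by move=> p; rewrite lee_fin.
set v := fine (@gauss_var R).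
pose sA := Num.sqrt (cov_form rho (keep_coef c) / v).
pose sB := Num.sqrt (cov_form rho (dev_coef c) / v).
(* [H y] is the mean of [F] over the part of the projection that depends on [V], when
   the part that depends on [U] equals [y]. *)
pose H y := fine (\int[mu]_x (F (sA * x + y) * gauss x)%:E)%E.
have mFg y : measurable_fun setT (fun x => (F (sA * x + y) * gauss x)%:E).
  apply/measurable_EFinP; apply: measurable_funM; last exact: measurable_gauss.
  exact: (measurableT_comp mF (measurable_affine sA y)).
have HE y : (\int[mu]_x (F (sA * x + y) * gauss x)%:E = (H y)%:E)%E.
  rewrite /H fineK// ge0_fin_numE; last first.
    by apply: integral_ge0 => x _; rewrite lee_fin mulr_ge0 ?gauss_ge0.
  apply: (@le_lt_trans _ _ (\int[mu]_x (2%:E * (gauss x)%:E))%E).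
    apply: ge0_le_integral => //.
    - by move=> x _; rewrite lee_fin mulr_ge0 ?gauss_ge0.
    - exact: mFg.
    - by apply: measurable_funeM; apply/measurable_EFinP; exact: measurable_gauss.
    - move=> x _; rewrite -EFinM lee_fin ler_wpM2r ?gauss_ge0//.
      by rewrite /F; have := cos_le1 (sA * x + y + s); lra.
  rewrite ge0_integralZl//.
  - by rewrite integral_gauss mule1 ltry.
  - by apply/measurable_EFinP; exact: measurable_gauss.
  - by move=> x _; rewrite lee_fin gauss_ge0.
have H0 y : 0 <= H y.
  by rewrite -lee_fin -HE; apply: integral_ge0 => x _; rewrite lee_fin mulr_ge0 ?gauss_ge0.
have mH : measurable_fun setT H.
  apply/measurable_EFinP; rewrite (_ : EFin \o H = fun y =>
    \int[mu]_x (fun p : R * R => (F (sA * p.1 + p.2) * gauss p.1)%:E) (x, y))%E; last first.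
    by apply/funext => y /=; rewrite HE.
  apply: (@measurable_fun_fubini_tonelli_G _ _ _ _ _ mu (fun p : measurableTypeR R * R => (F (sA * p.1 + p.2) * gauss p.1)%:E)).
  + apply/measurable_EFinP; apply: measurable_funM.
      apply: (measurableT_comp mF); apply: measurable_funD; last exact: measurable_snd.
      by apply: measurable_funM => //; exact: measurable_fst.
    exact: (measurableT_comp measurable_gauss measurable_fst).
  + by move=> p; rewrite lee_fin mulr_ge0 ?gauss_ge0.
transitivity (\int[P']_y (H (proj_comb (dev_coef c) (U y)))%:E)%E.
  apply: eq_integral => w' _.
  rewrite /fubini_G /=.
  under eq_integral => w _ do rewrite /W proj_comb_fill.
  set b := proj_comb _ (U w').
  have mFb : measurable_fun setT (fun x : R => F (x + b)).
    by apply: (measurableT_comp mF); exact: measurable_funD.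
  have [_ ->] := gaussian_projection mV VP (keep_coef c) m0 mFb (fun x => F0 _).
  by rewrite -HE.
have [qB ->] := gaussian_projection mU UP (dev_coef c) m0 mH H0.
have [qA _] := gaussian_projection mV VP (keep_coef c) m0 mF F0.
have [_ ->] := gaussian_projection mV VP c m0 mF F0.
have [v0 _] := gauss_var_positive mV VP k0.
rewrite -/v -/sB.
under eq_integral do rewrite EFinM -HE.
rewrite gauss_rotation//; apply: eq_integral => x _.
congr (F (_ * _) * _)%:E; rewrite !sqr_sqrtr ?divr_ge0 ?(ltW v0)//.
by rewrite -mulrDl cov_form_split.
Qed.

End resample.

(** * Measures determined by boxes *)

Section restricted_law.
Context {R : realType} {d d' : measure_display}.
Context {T : measurableType d} {E : measurableType d'}.

Lemma restricted_law (mu : {measure set T -> \bar R}) (D : set T) (X : T -> E) :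
  measurable D -> measurable_fun setT X ->
  exists nu : {measure set E -> \bar R},
    forall C, nu C = mu (X @^-1` C `&` D).
Proof.
move=> mD mX.
pose nu_ : {measure set E -> \bar R} := pushforward (mrestr mu mD) X.
by exists (nu_ mX).
Qed.

End restricted_law.

Section multimeasure.
Context {R : realType} {d : measure_display} {E : measurableType d} {I : finType}.
Implicit Types (B : I -> set E) (F : (I -> set E) -> \bar R).

(** Probabilities of boxes of events and products of probabilities have this property in
common, and it is enough for a uniqueness theorem. *)
Definition multimeasure F : Prop :=
  forall i B, (forall j, measurable (B j)) ->
  exists2 nu : {measure set E -> \bar R}, (nu setT < +oo)%E &
    forall C, measurable C -> F [eta B with i |-> C] = nu C.

(** The uniqueness theorem for measures is applied to one argument after the other: [r]
lists the arguments that have already been freed from the generating class. *)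
Lemma multimeasure_unique (G : set (set E)) F F' :
  (measurable : set (set E)) = <<s G >> -> setI_closed G -> G setT ->
  multimeasure F -> multimeasure F' ->
  (forall B, (forall j, G (B j)) -> F B = F' B) ->
  forall B, (forall j, measurable (B j)) -> F B = F' B.
Proof.
move=> mG GI GT mF mF' FF'.
have GM C : G C -> measurable C by rewrite mG; exact: sub_sigma_algebra.
suff step (r : seq I) B : (forall j, measurable (B j)) ->
    (forall j, j \notin r -> G (B j)) -> F B = F' B.
  move=> B mB; apply: (step (enum I)) => // j.
  by rewrite mem_enum.
elim: r B => [|i r IH] B mB GB; first by apply: FF' => j; exact: GB.
have [nu nuT nuE] := mF i B mB.
have [nu' nu'T nu'E] := mF' i B mB.
have BE : B = [eta B with i |-> B i].
  by apply/funext => j /=; case: eqP => // ->.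
rewrite BE nuE// nu'E//.
apply: (measure_unique G (fun=> setT)) => //.
- by apply/seteqP; split => // x _; exists 0%N.
- move=> C GC; rewrite -(nuE _ (GM _ GC)) -(nu'E _ (GM _ GC)); apply: IH => j /=.
    by case: ifP => _; [exact: GM|exact: mB].
  case: ifPn => // ji jr; apply: GB.
  by rewrite inE negb_or ji.
Qed.

Lemma multimeasure_event d' (T : measurableType d') (mu : {finite_measure set T -> \bar R})
    (D : set T) (W : I -> T -> E) :
  measurable D -> (forall i, measurable_fun setT (W i)) ->
  multimeasure (fun B => mu (D `&` [set w | forall i, B i (W i w)])).
Proof.
move=> mD mW i B mB.
(* Freezing all the arguments but the [i]-th amounts to restricting the measure. *)
pose D' := D `&` \bigcap_(j in [set j | j != i]) (W j @^-1` B j).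
have mD' : measurable D'.
  apply: measurableI => //; apply: fin_bigcap_measurable; first exact: finite_finset.
  move=> j _.
  by rewrite -[X in measurable X]setTI; exact: mW.
have [nu nuE] := restricted_law mu mD' (mW i).
exists nu.
  rewrite nuE preimage_setT setTI.
  by rewrite -ge0_fin_numE ?fin_num_measure.
move=> C mC; rewrite nuE; congr (mu _); apply/seteqP; split => w.
  move=> [Dw h]; split; first by have := h i; rewrite /= eqxx.
  by split => // j /negbTE ji; have := h j; rewrite /= ji.
move=> [/= Cw [Dw h]]; split => // j /=; case: eqP => [->//|/eqP ji].
exact: h.
Qed.

Lemma multimeasure_prod (c : R) (nu : I -> probability E R) : 0 <= c ->
  multimeasure (fun B => c%:E * \prod_i nu i (B i))%E.
Proof.
move=> c0 i B mB.
pose k := c * \prod_(j | j != i) fine (nu j (B j)).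
have k0 : 0 <= k by rewrite mulr_ge0// prodr_ge0// => j _; rewrite fine_ge0.
exists (mscale (NngNum k0) (nu i)).
  by rewrite /= /mscale /= probability_setT mule1 ltry.
move=> C mC /=; rewrite /mscale /= (bigD1 i)//= eqxx muleCA muleC; congr (_ * _)%E.
rewrite /k EFinM; congr (_ * _)%E.
rewrite -prodEFin; apply: eq_bigr => j /negbTE ->.
by rewrite fineK// fin_num_measure.
Qed.

End multimeasure.

Section box_generation.
Context {R : realType}.

Definition tuple_boxes {d} {E : measurableType d} {m : nat} : set (set (m.-tuple E)) :=
  [set C | exists2 B : 'I_m -> set E, forall k, measurable (B k) &
    C = [set v | forall k, B k (tnth v k)]].

Lemma measurable_tuple_boxes d (E : measurableType d) m :
  (measurable : set (set (m.-tuple E))) = <<s tuple_boxes >>.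
Proof.
apply/seteqP; split; last first.
  apply: smallest_sub; first exact: sigma_algebra_measurable.
  move=> _ [B mB ->].
  rewrite (_ : [set v | _] = \bigcap_(k in [set: 'I_m])
    ((fun v : m.-tuple E => tnth v k) @^-1` B k)); last first.
    by apply/seteqP; split => v h k; [move=> _; exact: h|exact: h k Logic.I].
  apply: fin_bigcap_measurable => // k _.
  by rewrite -[X in measurable X]setTI; exact: measurable_tnth.
apply: smallest_sub; first exact: smallest_sigma_algebra.
move=> A; rewrite -bigcup_seq => -[k _ [B mB <-]]; rewrite setTI.
apply: sub_sigma_algebra; exists (fun l => if l == k then B else setT).
  by move=> l; case: ifP.
apply/seteqP; split => v /=; first by move=> Bv l; case: eqP => // ->.
by move/(_ k); rewrite eqxx.
Qed.

Lemma tuple_boxesI d (E : measurableType d) m : setI_closed (@tuple_boxes d E m).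
Proof.
move=> _ _ [B mB ->] [B' mB' ->]; exists (fun k => B k `&` B' k).
  by move=> k; exact: measurableI.
by apply/seteqP; split => v /= => [[h h'] k|h]; split => // k; have [] := h k.
Qed.

Definition observation_box {m n} (B : 'I_m -> 'I_n -> 'I_n -> set R) :
    set (observation R m n) :=
  [set x : observation R m n | forall k i j, B k i j (tnth x k i j)].

Definition observation_boxes {m n} : set (set (observation R m n)) :=
  [set C | exists2 B, forall k i j, measurable (B k i j) & C = observation_box B].

Lemma measurable_entry {n p} (i : 'I_n) (j : 'I_p) :
  measurable_fun setT (fun A : 'M[R]_(n, p) => A i j).
Proof.
move=> _ B mB; rewrite setTI; apply: sub_sigma_algebra.
by exists i, j, B.
Qed.

Lemma measurable_obs_entry {m n} k i j :
  measurable_fun setT (fun x : observation R m n => tnth x k i j).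
Proof. exact: (measurableT_comp (measurable_entry i j) (measurable_tnth k)). Qed.

Lemma measurable_observation_boxes m n :
  (measurable : set (set (observation R m n))) = <<s observation_boxes >>.
Proof.
apply/seteqP; split; last first.
  apply: smallest_sub; first exact: sigma_algebra_measurable.
  move=> _ [B mB ->].
  rewrite (_ : observation_box B = \bigcap_(q in [set: 'I_m * 'I_n * 'I_n])
    ((fun x : observation R m n => tnth x q.1.1 q.1.2 q.2) @^-1` B q.1.1 q.1.2 q.2)); last first.
    apply/seteqP; split => x h; first by move=> q _; exact: h.
    by move=> k i j; exact: (h (k, i, j) Logic.I).
  apply: fin_bigcap_measurable => // q _.
  by rewrite -[X in measurable X]setTI; exact: measurable_obs_entry.
apply: smallest_sub; first exact: smallest_sigma_algebra.
move=> A; rewrite -bigcup_seq => -[k _ [C mC <-]]; rewrite setTI.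
pose S := [set C : set 'M[R]_n | <<s @observation_boxes m n >> ((fun x => tnth x k) @^-1` C)].
suff : <<s @entry_cylinders _ R n n >> `<=` S by apply.
apply: smallest_sub.
  split.
  - by rewrite /S /= preimage_set0; exact: sigma_algebra0.
  - move=> D SD; rewrite /S /= setTD preimage_setC.
    by rewrite -setTD; apply: sigma_algebraCD.
  - by move=> F SF; rewrite /S /= preimage_bigcup; exact: sigma_algebra_bigcup.
move=> _ [i [j [B [mB ->]]]]; apply: sub_sigma_algebra.
exists (fun k' i' j' => if (k' == k) && (i' == i) && (j' == j) then B else setT).
  by move=> k' i' j'; case: ifP.
apply/seteqP; split => x /=.
  by move=> Bx k' i' j'; case: ifP => // /andP[/andP[/eqP -> /eqP ->] /eqP ->].
by move/(_ k i j); rewrite !eqxx.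
Qed.

Lemma observation_boxesI m n : setI_closed (@observation_boxes m n).
Proof.
move=> _ _ [B mB ->] [B' mB' ->]; exists (fun k i j => B k i j `&` B' k i j).
  by move=> k i j; exact: measurableI.
apply/seteqP; split => x.
  by move=> [h h'] k i j; split; [exact: h|exact: h'].
by move=> h; split => k i j; have [] := h k i j.
Qed.

Lemma observation_measure_unique m n (mu nu : {measure set (observation R m n) -> \bar R}) :
  (mu setT < +oo)%E ->
  (forall B, (forall k i j, measurable (B k i j)) ->
    mu (observation_box B) = nu (observation_box B)) ->
  forall A, measurable A -> mu A = nu A.
Proof.
move=> muT munu; apply: (measure_unique observation_boxes (fun=> setT)) => //.
- exact: measurable_observation_boxes.
- exact: observation_boxesI.
- by move=> _; exists (fun _ _ _ => setT) => //; apply/seteqP.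
- by apply/seteqP; split => // x _; exists 0%N.
- by move=> _ [B mB ->]; exact: munu.
Qed.

End box_generation.

Section laws.
Context {R : realType} {d d' : measure_display}.
Context {T : measurableType d} {E : measurableType d'}.

Lemma law_exists (P : probability T R) (V : T -> E) : measurable_fun setT V ->
  exists L : probability E R, forall C, L C = P (V @^-1` C).
Proof.
by move=> mV; exists (distribution P (mfun_Sub (mem_set mV))).
Qed.

Lemma cond_lawE (P : probability T R) (C : set T) (mC : measurable C) (p : R) A :
  P C = p%:E -> p != 0 -> cond_law P mC A = (P (A `&` C) * p^-1%:E)%E.
Proof.
move=> PC p0; rewrite /cond_law /= /mnormalize /= /mrestr setTI PC.
by rewrite (negbTE (_ : p%:E != 0%E)).
Qed.

Lemma cond_law0 (P : probability T R) (C : set T) (mC : measurable C) A :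
  P C = 0%E -> cond_law P mC A = P A.
Proof.
by move=> PC; rewrite /cond_law /= /mnormalize /= /mrestr setTI PC eqxx.
Qed.

End laws.

Lemma product_law {R : realType} d1 d2 d1' d2' (T1 : measurableType d1)
    (T2 : measurableType d2) (E1 : measurableType d1') (E2 : measurableType d2')
    (P1 : probability T1 R) (P2 : probability T2 R)
    (L1 : probability E1 R) (L2 : probability E2 R) (V1 : T1 -> E1) (V2 : T2 -> E2) :
  measurable_fun setT V1 -> measurable_fun setT V2 ->
  (forall C, L1 C = P1 (V1 @^-1` C)) -> (forall C, L2 C = P2 (V2 @^-1` C)) ->
  forall C, measurable C ->
  ((L1 \x L2) C = (P1 \x P2) [set p | C (V1 p.1, V2 p.2)])%E.
Proof.
move=> mV1 mV2 L1E L2E C mC.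
have mVV : measurable_fun setT (fun p : T1 * T2 => (V1 p.1, V2 p.2)).
  apply: measurable_fun_pair; first exact: (measurableT_comp mV1 measurable_fst).
  exact: (measurableT_comp mV2 measurable_snd).
have [nu nuE] := restricted_law (P1 \x P2)%E measurableT mVV.
rewrite (product_measure_unique (m' := nu))//; first by rewrite nuE setIT.
move=> A B mA mB; rewrite nuE setIT.
rewrite (_ : _ @^-1` _ = (V1 @^-1` A) `*` (V2 @^-1` B))//.
apply: etrans (product_measure1E _ _ _ _) _; last first.
  by congr (_ * _)%E; [exact/esym/L1E|exact/esym/L2E].
- by rewrite -[X in measurable X]setTI; exact: mV2.
- by rewrite -[X in measurable X]setTI; exact: mV1.
Qed.

(** * Edges, observations and relabellings *)

Section edges.
Context {n : nat}.
Implicit Types (s : 'S_n) (e : edge n) (i j : 'I_n).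

Definition edge_of i j : option (edge n) :=
  if insub (i, j) is Some e then Some e else insub (j, i).

Lemma edge_of_lt i j (ij : (i < j)%N) : edge_of i j = Some (exist (fun e : 'I_n * 'I_n => (e.1 < e.2)%N) (i, j) ij).
Proof.
by rewrite /edge_of (insubT (fun e : 'I_n * 'I_n => (e.1 < e.2)%N) (x := (i, j)) ij).
Qed.

Lemma edge_ofC i j : edge_of i j = edge_of j i.
Proof.
rewrite /edge_of; case: insubP => [e /= ij _|/= ij]; case: insubP => [f /= ji _|/= ji] //.
  by move: (ltn_trans ij ji); rewrite ltnn.
Qed.

Lemma edge_ofP i j e : edge_of i j = Some e -> val e = (i, j) \/ val e = (j, i).
Proof.
rewrite /edge_of; case: insubP => [f /= _ <- [<-]|_]; first by left.
by case: insubP => [f /= _ <- [<-]|_ //]; right.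
Qed.

Lemma edge_of_diag i : edge_of i i = None.
Proof. by rewrite /edge_of !insubF/= ?ltnn. Qed.

Lemma edge_of_neq i j : i != j -> exists e, edge_of i j = Some e.
Proof.
move=> ij; have [h|h|h] := ltngtP i j.
- by eexists; exact: edge_of_lt h.
- by rewrite edge_ofC; eexists; exact: edge_of_lt h.
- by move/val_inj: h ij => ->; rewrite eqxx.
Qed.

Lemma edge_neq e : (val e).1 != (val e).2.
Proof. by rewrite -val_eqE ltn_eqF//; exact: valP e. Qed.

(** The default value [e] is never returned, because permutations are injective. *)
Definition shift_edge s e : edge n := odflt e (edge_of (s (val e).1) (s (val e).2)).

Lemma shift_edgeE s e :
  edge_of (s (val e).1) (s (val e).2) = Some (shift_edge s e).
Proof.
have [|f fE] := @edge_of_neq (s (val e).1) (s (val e).2).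
  by rewrite (inj_eq perm_inj) edge_neq.
by rewrite /shift_edge fE.
Qed.

Lemma shift_edge_inj s : injective (shift_edge s).
Proof.
move=> e f ef; apply: val_inj.
have e12 : ((val e).1 < (val e).2)%N := valP e.
have f12 : ((val f).1 < (val f).2)%N := valP f.
have := edge_ofP (shift_edgeE s e); have := edge_ofP (shift_edgeE s f).
rewrite ef; move: (val e) (val f) e12 f12 => [i j] [i' j'] /= e12 f12.
case=> -> [] [] /perm_inj ii /perm_inj jj; first by rewrite ii jj.
- by move: e12; rewrite -ii -jj => /(ltn_trans f12); rewrite ltnn.
- by move: e12; rewrite -ii -jj => /(ltn_trans f12); rewrite ltnn.
- by rewrite ii jj.
Qed.

End edges.

Section observations.
Context {R : realType} {m n : nat}.
Implicit Types (x : observation R m n) (a b : alignment m n).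

Definition graph_like (x1 : 'M[R]_n) : Prop := x1^T = x1 /\ forall i, x1 i i = 0.

Definition graphs x : Prop := forall k, graph_like (tnth x k).

Definition edge_box a (B : 'I_m -> 'I_n -> 'I_n -> set R) (e : edge n) :
    set (m.-tuple R) :=
  [set v | forall k, let i := component a k (val e).1 in
     let j := component a k (val e).2 in (B k i j `&` B k j i) (tnth v k)].

Lemma measurable_edge_box a B e : (forall k i j, measurable (B k i j)) ->
  measurable (edge_box a B e).
Proof.
move=> mB; rewrite measurable_tuple_boxes; apply: sub_sigma_algebra.
exists (fun k => B k (component a k (val e).1) (component a k (val e).2) `&`
  B k (component a k (val e).2) (component a k (val e).1)) => // k.
exact: measurableI.
Qed.

Lemma graph_likeC (x1 : 'M[R]_n) i j : graph_like x1 -> x1 i j = x1 j i.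
Proof. by case=> xT _; rewrite -[in LHS]xT mxE. Qed.

(** A graph is determined by its entries above the diagonal, so that a box of observations
amounts to one condition per edge, whichever alignment is used to label the edges. *)
Lemma observation_boxE a B x : graphs x ->
  observation_box B x <->
  (forall k i, B k i i 0) /\ forall e, edge_box a B e (edge_vector a x e).
Proof.
move=> gx; split=> [h|[h0 h] k i j].
  split=> [k i|e k]; first by have [_ d] := gx k; rewrite -(d i); exact: h.
  rewrite /edge_vector tnth_mktuple /=; split; first exact: h.
  by rewrite (graph_likeC _ _ (gx k)); exact: h.
have [->|ij] := eqVneq i j; first by have [_ ->] := gx k; exact: h0.
pose p := (component a k)^-1%g i; pose q := (component a k)^-1%g j.
have pi : component a k p = i by rewrite /p permKV.
have qj : component a k q = j by rewrite /q permKV.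
have pq : p != q by rewrite (inj_eq perm_inj).
have [e eE] := edge_of_neq pq.
have := h e k; rewrite /edge_vector tnth_mktuple /=.
have [->|->] /= := edge_ofP eE; rewrite pi qj => -[] //.
by rewrite (graph_likeC _ _ (gx k)).
Qed.

Lemma measurable_edge_vector a e :
  measurable_fun setT (fun x => edge_vector a x e).
Proof. by apply: measurable_mktuple => k; exact: measurable_obs_entry. Qed.

Lemma measurable_fun_mx d (T : measurableType d) (F : T -> 'M[R]_n) :
  (forall i j, measurable_fun setT (fun w => F w i j)) -> measurable_fun setT F.
Proof.
move=> mF; apply: (@measurability _ _ _ _ setT _ (@entry_cylinders _ R n n)) => //.
move=> _ [_ [i [j [B [mB ->]]]] <-]; exact: mF.
Qed.

Lemma measurable_fun_observation d (T : measurableType d) (F : T -> observation R m n) :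
  (forall k i j, measurable_fun setT (fun w => tnth (F w) k i j)) ->
  measurable_fun setT F.
Proof.
move=> mF; apply/measurable_fun_tnthP => k.
apply: measurable_fun_mx => i j; exact: mF.
Qed.

End observations.

Section finite_partition.
Context {R : realType} {d d' : measure_display}.
Context {T : measurableType d} {E : measurableType d'} {S : finType}.

Lemma measurable_fun_fin_cases (pi : T -> S) (F : S -> T -> E) :
  fin_measurable pi -> (forall a, measurable_fun setT (F a)) ->
  measurable_fun setT (fun w => F (pi w) w).
Proof.
move=> mpi mF _ B mB; rewrite setTI.
rewrite (_ : _ @^-1` B = \bigcup_(a in [set: S])
  (pi @^-1` [set a] `&` (F a @^-1` B))); last first.
  apply/seteqP; split => [w Bw|w [a _ [/= <-]]//].
  by exists (pi w).
apply: fin_bigcup_measurable; first exact: finite_finset.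
move=> a _; apply: measurableI; first exact: mpi.
by rewrite -[X in measurable X]setTI; exact: mF.
Qed.

Lemma fin_measurable_event (f : T -> S) (A : set S) :
  fin_measurable f -> measurable [set w | A (f w)].
Proof.
move=> mf; rewrite (_ : [set w | _] = \bigcup_(s in A) (f @^-1` [set s])).
  by apply: fin_bigcup_measurable => [|s _]; [exact: finite_finset|exact: mf].
by apply/seteqP; split => [w Aw|w [s As /= ws]]; [exists (f w)|rewrite ws].
Qed.

Lemma fin_measurable_comp (D : T -> E) (g : E -> S) :
  measurable_fun setT D -> fin_measurable g -> fin_measurable (g \o D).
Proof.
move=> mD mg s; rewrite comp_preimage -[X in measurable X]setTI.
exact: mD.
Qed.

Lemma measure_fin_split (mu : {measure set T -> \bar R}) (pi : T -> S) (p : pred S)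
    (A : set T) : fin_measurable pi -> measurable A ->
  (mu [set w | p (pi w) /\ A w] = \sum_(a | p a) mu [set w | pi w = a /\ A w])%E.
Proof.
move=> mpi mA.
have mpa a : measurable [set w | pi w = a /\ A w].
  exact: (measurableI _ _ (mpi a) mA).
have claim (r : seq S) : uniq r ->
    (mu [set w | pi w \in r /\ A w] = \sum_(a <- r) mu [set w | pi w = a /\ A w])%E.
  elim: r => [|a r IH] /=.
    by move=> _; rewrite big_nil (_ : [set w | _] = set0) ?measure0//; apply/seteqP; split => // w [].
  move=> /andP[ar ur]; rewrite big_cons -IH// -measureU//.
  - congr (mu _); apply/seteqP; split => w /=; rewrite inE.
      by case=> /orP[/eqP|] h Aw; [left|right].
    by case=> -[h Aw]; split => //; rewrite h ?eqxx ?orbT.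
  - rewrite (_ : [set w | _] = (\bigcup_(b in [set b | b \in r]) (pi @^-1` [set b])) `&` A).
      apply: measurableI => //; apply: fin_bigcup_measurable; first exact: finite_finset.
      by move=> b _; exact: mpi.
    apply/seteqP; split => w /=; first by case=> h Aw; split => //; exists (pi w).
    by case=> -[b /= br wb] Aw; rewrite wb.
  - apply/seteqP; split => // w /= [[wa _] [wr _]].
    by rewrite -wa wr in ar.
rewrite -big_filter -claim ?filter_uniq ?index_enum_uniq//; congr (mu _).
apply/seteqP; split => w /=; rewrite mem_filter mem_index_enum andbT//.
Qed.

End finite_partition.

Section relabelling.
Context {R : realType} {m n : nat} (hm : (1 < m)%N).
Implicit Types (a b : alignment m n) (s : 'S_n).

Lemma id_subproof : is_alignment ([ffun=> 1%g] : {ffun 'I_m -> 'S_n}).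
Proof. by apply/forallP => k; rewrite ffunE eqxx implybT. Qed.

Definition id_alignment : alignment m n :=
  exist (fun a : {ffun 'I_m -> 'S_n} => is_alignment a) _ id_subproof.

Definition twist_fun s b : {ffun 'I_m -> 'S_n} :=
  [ffun k : 'I_m => if val k == 0%N then 1%g else (s * component b k)%g].

Lemma twist_subproof s b : is_alignment (twist_fun s b).
Proof. by apply/forallP => k; apply/implyP => k0; rewrite ffunE k0. Qed.

(** If the [b k] align the graphs with the second one (so that [b_2 = Id]), then [twist s b]
aligns them with the first one when [s] is the alignment between these two. *)
Definition twist s b : alignment m n := exist _ (twist_fun s b) (twist_subproof s b).

Lemma twistE s b k : component (twist s b) k =
  if val k == 0%N then 1%g else (s * component b k)%g.
Proof. by rewrite /component /= ffunE. Qed.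

Lemma component0 a (k : 'I_m) : val k = 0%N -> component a k = 1%g.
Proof.
by move=> k0; have /forallP/(_ k)/implyP := valP a; rewrite k0 => /(_ isT) /eqP.
Qed.

Lemma twistM s t b : twist s (twist t b) = twist (s * t) b.
Proof.
apply: val_inj; apply/ffunP => k; rewrite !ffunE !twistE.
by case: (val k == 0%N); rewrite // mulgA.
Qed.

Lemma twist1 b : twist 1 b = b.
Proof.
apply: val_inj; apply/ffunP => k; rewrite ffunE.
case: eqP => [k0|_]; [by rewrite -(component0 b k0)|exact: mul1g].
Qed.

Definition second a : 'S_n := component a (graph2 hm).

Lemma second_twist s b : second (twist s b) = (s * second b)%g.
Proof. by rewrite /second twistE. Qed.

(** [twist s] multiplies the second component by [s], and [twist s^-1] is its inverse. *)
Lemma sum_second_twist (W : nmodType) s (F : alignment m n -> W) :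
  \sum_(b | second b == 1%g) F (twist s b) = \sum_(b | second b == s) F b.
Proof.
rewrite [RHS](reindex_onto (twist s) (twist s^-1)) /=; last first.
  by move=> b _; rewrite twistM mulgV twist1.
apply: eq_bigl => b; rewrite twistM mulVg twist1 eqxx andbT second_twist.
by rewrite -(inj_eq (mulgI s)) mulg1.
Qed.

End relabelling.

Section fill.
Context {R : realType} {m n : nat} (hm : (1 < m)%N).
Context {E : Type}.
Variable psi : R -> E -> m.-tuple R.
Implicit Types (a b : alignment m n) (s : 'S_n) (x : observation R m n).

(** The aggregate [y] is labelled by the vertices of the second graph, and so are the
noises [eta]. The [k]-th entry drawn for the edge [f] is placed at the edge [b_k(f)] of
the [k]-th graph. *)
Definition fill b (eta : edge n -> E) (x1 y : 'M[R]_n) : observation R m n :=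
  [tuple if val k == 0%N then x1 else \matrix_(i, j)
     if edge_of ((component b k)^-1%g i) ((component b k)^-1%g j) is Some f
     then tnth (psi (y (val f).1 (val f).2) (eta f)) k else 0 | k < m].

Lemma fill_graphs b eta (x1 y : 'M[R]_n) : graph_like x1 -> graphs (fill b eta x1 y).
Proof.
move=> gx k; rewrite /fill tnth_mktuple; case: ifP => // _; split.
  by apply/matrixP => i j; rewrite !mxE edge_ofC.
by move=> i; rewrite mxE edge_of_diag.
Qed.

(** Whatever [b] is, the manufactured list is aligned by [twist a_2 b]. The noise that
reaches [e] is the one of its image in the second graph. *)
Lemma edge_vector_fill a b eta (x1 y : 'M[R]_n) e (yv : R) (v : m.-tuple R) :
  (forall i j, y i j = y j i) ->
  tnth v (graph1 hm) = x1 (val e).1 (val e).2 ->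
  y (component a (graph2 hm) (val e).1) (component a (graph2 hm) (val e).2) = yv ->
  edge_vector (twist (second hm a) b) (fill b eta x1 y) e =
  with_first v (psi yv (eta (shift_edge (second hm a) e))).
Proof.
move=> yC vE yE; apply: eq_from_tnth => k; rewrite !tnth_mktuple twistE.
case: (eqVneq (val k) 0%N) => k0.
  by rewrite !perm1 -vE; congr tnth; apply: val_inj.
rewrite mxE !permM !permK shift_edgeE.
have := edge_ofP (shift_edgeE (second hm a) e).
rewrite -/(second hm a) in yE.
by case=> ->/=; rewrite -yE// yC.
Qed.

End fill.

Lemma measurable_with_first_psi {R : realType} {m : nat} d (E : measurableType d)
    (agg : m.-tuple R -> R) (psi : R -> E -> m.-tuple R) :
  measurable_fun setT agg ->
  measurable_fun setT (fun p : R * E => psi p.1 p.2) ->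
  measurable_fun setT (fun q : m.-tuple R * E => with_first q.1 (psi (agg q.1) q.2)).
Proof.
move=> magg mpsi.
have mp : measurable_fun setT (fun q : m.-tuple R * E => (agg q.1, q.2)).
  apply: measurable_fun_pair; last exact: measurable_snd.
  exact: (measurableT_comp magg measurable_fst).
apply: (@measurable_mktuple _ _ _ _ (fun k (q : m.-tuple R * E) =>
  if val k == 0%N then tnth q.1 k else tnth (psi (agg q.1) q.2) k)) => k.
case: (val k == 0%N); first exact: (measurableT_comp (measurable_tnth k) measurable_fst).
exact: (measurableT_comp (measurable_tnth k) (measurableT_comp mpsi mp)).
Qed.

(** * Simulating the graphs from the first one and the aggregate *)

(** Otherwise the integral of the positive function [c - f] would vanish. *)
Lemma exists_ge_mean {R : realType} d (T : measurableType d) (Q : probability T R)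
    (f : T -> R) (c : R) :
  measurable_fun setT f -> (forall w, 0 <= f w) ->
  (c%:E <= \int[Q]_w (f w)%:E)%E -> exists w, c <= f w.
Proof.
move=> mf f0 cf; apply: contrapT => /forallNP h.
have fc w : f w < c by rewrite ltNge; apply/negP; exact: h.
have I1 : (\int[Q]_w (c - f w)%:E + \int[Q]_w (f w)%:E = c%:E)%E.
  rewrite -ge0_integralD//.
  - under eq_integral do rewrite -EFinD subrK.
    by rewrite integral_cst//= probability_setT mule1.
  - by move=> w _; rewrite lee_fin subr_ge0 ltW.
  - by apply/measurable_EFinP; exact: measurable_funB.
  - by move=> w _; rewrite lee_fin.
  - exact/measurable_EFinP.
have I0 : (0 <= \int[Q]_w (c - f w)%:E)%E.
  by apply: integral_ge0 => w _; rewrite lee_fin subr_ge0 ltW.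
have Iz : (\int[Q]_w `|(c - f w)%:E| = 0)%E.
  under eq_integral do rewrite gee0_abs ?lee_fin ?subr_ge0 ?(ltW (fc _))//.
  apply/eqP; rewrite eq_le I0 andbT.
  have fin : (\int[Q]_w (f w)%:E \is a fin_num)%E.
    rewrite ge0_fin_numE; last by apply: integral_ge0 => w _; rewrite lee_fin.
    by apply: (@le_lt_trans _ _ c%:E); rewrite ?ltry// -[leRHS]I1 leeDr.
  rewrite -[X in (X <= _)%E](addeK _ fin) I1.
  move: cf; rewrite -(fineK fin) -EFinB !lee_fin; lra.
have /ae_eq_integral_abs := Iz.
case=> //; first by apply/measurable_EFinP; exact: measurable_funB.
move=> A [mA QA0 sub].
have AT : A = setT.
  apply/seteqP; split => // w _; apply: sub => /= /(_ Logic.I) [] /eqP.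
  by rewrite subr_eq0 => /eqP cw; have := fc w; rewrite cw ltxx.
have QA1 : Q A = 1%E by rewrite AT probability_setT.
by have /eqP := etrans (esym QA1) QA0; rewrite onee_eq0.
Qed.

(** The common frame of the two models: [L] is the law of an edge vector, [agg] computes the
entry of the aggregate from it, [N] is the law of the noise attached to an edge, and
[psi] redraws the tail from the aggregate and the noise. The heart of the
matter for each model is [fillL]: redrawing the tail preserves [L]. *)
Section simulation.
Context {R : realType} {m n : nat} (hm : (1 < m)%N).
Context {d : measure_display} {T : measurableType d} (P : probability T R).
Variables (pistar : T -> alignment m n) (X : T -> observation R m n).
Hypotheses (mpi : fin_measurable pistar) (mX : measurable_fun setT X).
Hypothesis gX : forall w, graphs (X w).
Variables (M : model R) (agg : m.-tuple R -> R).
Hypothesis magg : measurable_fun setT agg.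
Hypothesis aggE : forall (a : alignment m n) (x : observation R m n) i j,
  aggregate hm M a x (component a (graph2 hm) i) (component a (graph2 hm) j) =
  agg [tuple tnth x k (component a k i) (component a k j) | k < m].
Variables (c : R) (L : probability (m.-tuple R) R).
Hypothesis c0 : 0 <= c.
Hypothesis iidV : forall (a : alignment m n) (B : edge n -> set (m.-tuple R)),
  (forall e, measurable (B e)) ->
  P [set w | pistar w = a /\ forall e, B e (edge_vector a (X w) e)] =
  (c%:E * \prod_e L (B e))%E.
Context {d' dE : measure_display} {T' : measurableType d'} {E : measurableType dE}.
Variables (Q : probability T' R) (u : edge n -> T' -> E) (N : probability E R).
Hypothesis mu : forall e, measurable_fun setT (u e).
Hypothesis iidU : forall B : edge n -> set E, (forall e, measurable (B e)) ->
  Q [set w | forall e, B e (u e w)] = (\prod_e N (B e))%E.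
Variable psi : R -> E -> m.-tuple R.
Hypothesis mpsi : measurable_fun setT (fun p : R * E => psi p.1 p.2).
Hypothesis fillL : forall A, measurable A ->
  (L \x N)%E [set p | A (with_first p.1 (psi (agg p.1) p.2))] = L A.

Let Y w := aggregate hm M (pistar w) (X w).
Let X1 w := tnth (X w) (graph1 hm).
Let sim (b : alignment m n) (w' : T') (x1 y : 'M[R]_n) : observation R m n :=
  fill psi b (fun e => u e w') x1 y.

Lemma aggregateE (a : alignment m n) x i j : aggregate hm M a x i j =
  agg [tuple tnth x k (component a k ((component a (graph2 hm))^-1%g i))
                      (component a k ((component a (graph2 hm))^-1%g j)) | k < m].
Proof. by rewrite -aggE !permKV. Qed.

Lemma aggregateC (a : alignment m n) x i j : graphs x ->
  aggregate hm M a x i j = aggregate hm M a x j i.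
Proof.
move=> gx; rewrite !aggregateE; congr agg; apply: eq_from_tnth => k.
by rewrite !tnth_mktuple; apply: graph_likeC; exact: gx.
Qed.

Lemma measurable_Y : measurable_fun setT Y.
Proof.
apply: measurable_fun_mx => i j.
apply: (@measurable_fun_fin_cases _ _ _ _ _ pistar (fun a w => aggregate hm M a (X w) i j)) => // a.
under eq_fun do rewrite aggregateE.
apply: (measurableT_comp magg); apply: measurable_mktuple => k.
exact: (measurableT_comp (measurable_obs_entry _ _ _) mX).
Qed.

Lemma measurable_X1 : measurable_fun setT X1.
Proof. exact: (measurableT_comp (measurable_tnth _) mX). Qed.

Lemma measurable_sim_comp d0 (T0 : measurableType d0) b (W : T0 -> T')
    (x1 y : T0 -> 'M[R]_n) :
  measurable_fun setT W -> measurable_fun setT x1 -> measurable_fun setT y ->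
  measurable_fun setT (fun p => sim b (W p) (x1 p) (y p)).
Proof.
move=> mW mx1 my; apply: measurable_fun_observation => k i j.
rewrite /sim /fill; under eq_fun do rewrite tnth_mktuple.
case: (val k == 0%N); first exact: (measurableT_comp (measurable_entry i j) mx1).
under eq_fun do rewrite mxE.
case: (edge_of _ _) => [f|]; last exact: measurable_cst.
have mp : measurable_fun setT
    (fun p => (y p (val f).1 (val f).2, u f (W p))).
  apply: measurable_fun_pair; first exact: (measurableT_comp (measurable_entry _ _) my).
  exact: (measurableT_comp (mu f) mW).
exact: (measurableT_comp (measurable_tnth k) (measurableT_comp mpsi mp)).
Qed.

(** Both sides are multimeasures, so that product sets suffice. Moving the noises along
[s] only permutes i.i.d. variables. *)
Lemma iid_pairs (a : alignment m n) (s : 'S_n)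
    (C : edge n -> set (m.-tuple R * E)) : (forall e, measurable (C e)) ->
  (P \x Q)%E [set p | pistar p.1 = a /\
     forall e, C e (edge_vector a (X p.1) e, u (shift_edge s e) p.2)] =
  (c%:E * \prod_e (L \x N)%E (C e))%E.
Proof.
pose D : set (T * T') := [set p | pistar p.1 = a].
have mD : measurable D.
  rewrite -[X in measurable X]setTI.
  exact: (@measurable_fst _ _ T T' measurableT _ (mpi a)).
pose W e (p : T * T') := (edge_vector a (X p.1) e, u (shift_edge s e) p.2).
have mW e : measurable_fun setT (W e).
  apply: measurable_fun_pair.
    exact: (measurableT_comp (measurableT_comp (measurable_edge_vector a e) mX) measurable_fst).
  exact: (measurableT_comp (mu _) measurable_snd).
pose G : set (set (m.-tuple R * E)) :=
  [set A `*` B | A in measurable & B in measurable].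
move: C; apply: (multimeasure_unique (G := G)).
- exact: measurable_prod_measurableType.
- move=> _ _ [A mA [B mB <-]] [A' mA' [B' mB' <-]].
  exists (A `&` A'); first exact: measurableI.
  exists (B `&` B'); first exact: measurableI.
  by rewrite setXI.
- by exists setT => //; exists setT => //; rewrite setXTT.
- pose PQ : probability (T * T')%type R := (P \x Q)%E.
  exact: (@multimeasure_event _ _ _ _ _ _ PQ D W mD mW).
- exact: multimeasure_prod.
move=> C GC.
have /choice[AB ABP] : forall e, exists AB : set (m.-tuple R) * set E,
    [/\ measurable AB.1, measurable AB.2 & C e = AB.1 `*` AB.2].
  by move=> e; have [A mA [B mB <-]] := GC e; exists (A, B).
pose DA := [set w | pistar w = a /\ forall e, (AB e).1 (edge_vector a (X w) e)].
pose DB := [set w' | forall e, (AB e).2 (u (shift_edge s e) w')].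
have mDA : measurable DA.
  apply: (@measurableI _ _ (pistar @^-1` [set a]) [set w | forall e, (AB e).1 (edge_vector a (X w) e)]).
    exact: mpi.
  rewrite (_ : [set w | _] = \bigcap_(e in [set: edge n])
    ((fun w => edge_vector a (X w) e) @^-1` (AB e).1)); last first.
    by apply/seteqP; split => w h e; [move=> _; exact: h|exact: h e Logic.I].
  apply: fin_bigcap_measurable; first exact: finite_finset.
  move=> e _; rewrite -[X in measurable X]setTI.
  by apply: (measurableT_comp (measurable_edge_vector a e) mX) => //; have [] := ABP e.
have mDB : measurable DB.
  rewrite (_ : DB = \bigcap_(e in [set: edge n])
    (u (shift_edge s e) @^-1` (AB e).2)); last first.
    by apply/seteqP; split => w h e; [move=> _; exact: h|exact: h e Logic.I].
  apply: fin_bigcap_measurable; first exact: finite_finset.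
  move=> e _; rewrite -[X in measurable X]setTI.
  by apply: mu => //; have [] := ABP e.
rewrite (_ : [set p | _] = DA `*` DB); last first.
  apply/seteqP; split => [p [pa h]|p [[pa h] h']].
    by split; [split => // e|move=> e]; have := h e; have [_ _ ->] := ABP e; case.
  by split => // e; have [_ _ ->] := ABP e; split; [exact: h|exact: h'].
have PDA : P DA = (c%:E * \prod_e L (AB e).1)%E.
  by apply: iidV => e; have [] := ABP e.
have sK : bijective (@shift_edge n s) := injF_bij (@shift_edge_inj n s).
have [si siK Ksi] := sK.
have QDB : Q DB = (\prod_e N (AB e).2)%E.
  rewrite (_ : DB = [set w' | forall f, (AB (si f)).2 (u f w')]); last first.
    apply/seteqP; split => w' h e; first by have := h (si e); rewrite Ksi.
    by have := h (shift_edge s e); rewrite siK.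
  rewrite (iidU (B := fun f => (AB (si f)).2)); last by move=> e; have [] := ABP (si e).
  by rewrite (reindex (@shift_edge n s)) /=; [apply: eq_bigr => e _; rewrite siK|exists si => e _].
rewrite product_measure1E//.
transitivity (c%:E * \prod_e L (AB e).1 * \prod_e N (AB e).2)%E.
  by congr (_ * _)%E; [exact: PDA|exact: QDB].
rewrite -muleA; congr (_ * _)%E; rewrite -big_split /=.
by apply: eq_bigr => e _; have [mA mB ->] := ABP e; rewrite product_measure1E.
Qed.

(** On boxes both sides are products over the edges, with factors that agree by [fillL].
The constant [c] is the same for all alignments: this is where the uniformity of the
latent alignment matters. *)
Lemma sim_law (a b : alignment m n) (A : set (observation R m n)) : measurable A ->
  (P \x Q)%E [set p | pistar p.1 = a /\ A (sim b p.2 (X1 p.1) (Y p.1))] =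
  P [set w | pistar w = twist (second hm a) b /\ A (X w)].
Proof.
pose D : set (T * T') := [set p | pistar p.1 = a].
have mD : measurable D.
  rewrite -[X in measurable X]setTI; exact: (@measurable_fst _ _ T T' measurableT _ (mpi a)).
pose S p := sim b p.2 (X1 p.1) (Y p.1).
have mS : measurable_fun setT S.
  apply: measurable_sim_comp; first exact: measurable_snd.
    exact: (measurableT_comp measurable_X1 measurable_fst).
  exact: (measurableT_comp measurable_Y measurable_fst).
pose a' := twist (second hm a) b.
have [nu nuE] := restricted_law (P \x Q)%E mD mS.
have [nu' nu'E] := restricted_law P (mpi a') mX.
move=> mA.
rewrite (_ : [set p | _] = S @^-1` A `&` D); last by rewrite setIC.
rewrite (_ : [set w | _] = X @^-1` A `&` pistar @^-1` [set a']); last by rewrite setIC.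
rewrite -nuE -nu'E; apply: observation_measure_unique mA.
  rewrite nuE preimage_setT setTI -ge0_fin_numE//.
  pose PQ : probability (T * T')%type R := (P \x Q)%E.
  exact: (fin_num_measure PQ).
move=> B mB; rewrite nuE nu'E.
have gS p : graphs (S p) by apply: fill_graphs; exact: gX.
(* Diagonal entries vanish on both sides; a box that excludes 0 there has mass 0. *)
have [h0|h0] := pselect (forall k i, B k i i 0); last first.
  rewrite (_ : S @^-1` _ `&` D = set0).
    rewrite (_ : X @^-1` _ `&` _ = set0) ?measure0//.
    by apply/seteqP; split => // w [/(observation_boxE a' _ (gX w))[]].
  by apply/seteqP; split => // p [/(observation_boxE a' _ (gS p))[]].
rewrite (_ : X @^-1` _ `&` _ = [set w | pistar w = a' /\
    forall e, edge_box a' B e (edge_vector a' (X w) e)]); last first.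
  apply/seteqP; split => [w [/(observation_boxE a' _ (gX w))[_ h] wa]//|w [wa h]].
  by split => //; apply/(observation_boxE a' _ (gX w)).
transitivity (c%:E * \prod_e L (edge_box a' B e))%E; last first.
  by apply/esym; apply: iidV => e; exact: measurable_edge_box.
rewrite (_ : S @^-1` _ `&` D = [set p | pistar p.1 = a /\
    forall e, [set q | edge_box a' B e (with_first q.1 (psi (agg q.1) q.2))]
      (edge_vector a (X p.1) e, u (shift_edge (second hm a) e) p.2)]); last first.
  have SE p e : pistar p.1 = a -> edge_vector a' (S p) e =
      with_first (edge_vector a (X p.1) e) (psi (agg (edge_vector a (X p.1) e))
        (u (shift_edge (second hm a) e) p.2)).
    move=> pa; rewrite /S /sim (@edge_vector_fill _ _ _ hm _ psi a b (fun e => u e p.2)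
      _ _ e (agg (edge_vector a (X p.1) e)) (edge_vector a (X p.1) e))//.
    - by move=> i j; apply: aggregateC; exact: gX.
    - by rewrite tnth_mktuple component0// !perm1.
    - by rewrite /Y pa aggE.
  apply/seteqP; split => [p [/(observation_boxE a' _ (gS p))[_ h] pa]|p [pa h]].
    by split => // e /=; rewrite -SE.
  split => //; apply/(observation_boxE a' _ (gS p)); split => // e.
  by rewrite SE//; exact: h.
pose C e : set (m.-tuple R * E) :=
  [set q | edge_box a' B e (with_first q.1 (psi (agg q.1) q.2))].
have mC e : measurable (C e).
  rewrite -[X in measurable X]setTI.
  have mk := measurable_with_first_psi magg mpsi.
  exact: (mk measurableT _ (@measurable_edge_box _ _ _ a' B e mB)).
transitivity (c%:E * \prod_e (L \x N) (C e))%E.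
  exact: iid_pairs mC.
congr (_ * _)%E; apply: eq_bigr => e _; apply: fillL.
exact: measurable_edge_box.
Qed.

Variables (g : observation R m n -> 'S_n) (h : 'S_n -> 'S_n -> R).
Hypotheses (mg : fin_measurable g) (h0 : forall s t, 0 <= h s t).

Let A b s t : set (T * T') :=
  [set p | second hm (pistar p.1) = s /\ g (sim b p.2 (X1 p.1) (Y p.1)) = t].

Let target s t := P [set w | second hm (pistar w) = s /\ g (X w) = t].

Let msim b : measurable_fun setT (fun p : T * T' => sim b p.2 (X1 p.1) (Y p.1)).
Proof.
apply: measurable_sim_comp.
- exact: measurable_snd.
- exact: (measurableT_comp measurable_X1 measurable_fst).
- exact: (measurableT_comp measurable_Y measurable_fst).
Qed.

Let msecond : fin_measurable (fun w => second hm (pistar w)).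
Proof. by move=> s; exact: (fin_measurable_event (fun a => second hm a = s) mpi). Qed.

Let mgsim b t : measurable [set p : T * T' | g (sim b p.2 (X1 p.1) (Y p.1)) = t].
Proof. exact: (fin_measurable_comp (msim b) mg). Qed.

Let mA b s t : measurable (A b s t).
Proof.
apply: (@measurableI _ _ [set p : T * T' | second hm (pistar p.1) = s]).
  exact: (fin_measurable_comp measurable_fst msecond).
exact: mgsim.
Qed.

Let simulated_massE b s t : ((P \x Q) (A b s t) = \sum_(a | second hm a == s)
  P [set w | pistar w = twist s b /\ g (X w) = t])%E.
Proof.
rewrite (_ : A b s t = [set p | second hm (pistar p.1) == s /\
  [set p : T * T' | g (sim b p.2 (X1 p.1) (Y p.1)) = t] p]); last first.
  by apply/seteqP; split => p [/= /eqP ? ?].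
rewrite (measure_fin_split (P \x Q)%E (fun a => second hm a == s)
  (fin_measurable_comp measurable_fst mpi) (mgsim b t)).
apply: eq_bigr => a /eqP <-.
exact: (sim_law a b (mg t)).
Qed.

(** Whatever [a] is, with second component [s], the alignment [twist s b] runs over all
alignments with second component [s] when [b] runs over those with second component the
identity. *)
Let sum_simulated s t : (\sum_(b : alignment m n | second hm b == 1%g) (P \x Q) (A b s t) =
  \sum_(b : alignment m n | second hm b == 1%g) target s t)%E.
Proof.
under eq_bigr do rewrite simulated_massE.
rewrite exchange_big /=.
under eq_bigr do rewrite (sum_second_twist hm s (fun b => P [set w | pistar w = b /\ g (X w) = t])).
rewrite [RHS](sum_second_twist hm s (fun=> target s t)).
apply: eq_bigr => a _; rewrite /target -(measure_fin_split P (fun a => second hm a == s) mpi).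
  by congr (P _); apply/seteqP; split => w [/= /eqP ? ?].
exact: (fin_measurable_comp mX mg).
Qed.

Let gain (F : 'S_n -> 'S_n -> \bar R) : R := \sum_s \sum_t h s t * fine (F s t).

Let good_relabelling : exists b, gain target <= gain (fun s t => (P \x Q)%E (A b s t)).
Proof.
pose PQ : probability (T * T')%type R := (P \x Q)%E.
pose val b := gain (fun s t => (P \x Q)%E (A b s t)).
have sumval : \sum_(b : alignment m n | second hm b == 1%g) val b =
    \sum_(b : alignment m n | second hm b == 1%g) gain target.
  rewrite /val /gain exchange_big [RHS]exchange_big; apply: eq_bigr => s _.
  rewrite exchange_big [RHS]exchange_big; apply: eq_bigr => t _.
  rewrite -!mulr_sumr; congr (_ * _).
  have : (\sum_(b : alignment m n | second hm b == 1%g) (fine (PQ (A b s t)))%:E =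
      \sum_(b : alignment m n | second hm b == 1%g) (fine (target s t))%:E)%E.
    rewrite (eq_bigr (fun b => (P \x Q) (A b s t)))%E; last first.
      by move=> b _; rewrite fineK// fin_num_measure.
    rewrite sum_simulated; apply: eq_bigr => b _; rewrite fineK// fin_num_measure//.
    apply: (@measurableI _ _ [set w | second hm (pistar w) = s]).
      exact: msecond.
    exact: (fin_measurable_comp mX mg).
  by rewrite !sumEFin => -[].
pose b0 := @id_alignment m n.
have b01 : second hm b0 == 1%g by rewrite /second /component /= ffunE.
apply: contrapT => /forallNP hb.
have lt b : val b < gain target by rewrite ltNge; apply/negP; exact: hb.
suff : \sum_(b : alignment m n | second hm b == 1%g) val b < \sum_(b : alignment m n | second hm b == 1%g) gain target.
  by rewrite sumval ltxx.
by rewrite (bigD1 b0)// [ltRHS](bigD1 b0)//= ltr_leD//; apply: ler_sum => b _; exact: ltW.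
Qed.

(** Two averages are replaced by one of their values: first over the relabelling [b], then
over the noise [w'], the mean over the noise being computed by Fubini's theorem. *)
Lemma derandomized_estimator :
  exists2 g' : 'M[R]_n * 'M[R]_n -> 'S_n, fin_measurable g' &
    gain target <= gain (fun s t =>
      P [set w | second hm (pistar w) = s /\ g' (X1 w, Y w) = t]).
Proof.
have [b gb] := good_relabelling.
pose PQ : probability (T * T')%type R := (P \x Q)%E.
pose Pw s t w' := P (ysection (A b s t) w').
have mPw s t : measurable_fun setT (Pw s t).
  exact: (measurable_fun_ysection P (mA b s t)).
have Pwfin s t w' : Pw s t w' \is a fin_num.
  by apply: fin_num_measure; exact: measurable_ysection.
have mfPw s t : measurable_fun setT (fun w' => fine (Pw s t w')).
  apply/measurable_EFinP; rewrite (_ : EFin \o _ = Pw s t)//.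
  by apply/funext => w' /=; rewrite fineK.
have mhPw s t : measurable_fun setT (fun w' => h s t * fine (Pw s t w')).
  by apply: measurable_funM.
pose f w' := gain (fun s t => Pw s t w').
have mf : measurable_fun setT f.
  apply: measurable_sum => s; apply: measurable_sum => t.
  exact: mhPw.
have f0 w' : 0 <= f w'.
  by apply: sumr_ge0 => s _; apply: sumr_ge0 => t _; rewrite mulr_ge0// fine_ge0.
have If : (\int[Q]_w' (f w')%:E = (gain (fun s t => (P \x Q)%E (A b s t)))%:E)%E.
  rewrite /f /gain.
  under eq_integral do rewrite -sumEFin.
  rewrite ge0_integral_sum//; last 2 first.
  - move=> s; apply/measurable_EFinP; apply: measurable_sum => t.
    exact: mhPw.
  - by move=> s w' _; rewrite lee_fin; apply: sumr_ge0 => t _; rewrite mulr_ge0// fine_ge0.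
  rewrite -sumEFin; apply: eq_bigr => s _.
  under eq_integral do rewrite -sumEFin.
  rewrite ge0_integral_sum//; last 2 first.
  - move=> t; apply/measurable_EFinP.
    exact: mhPw.
  - by move=> t w' _; rewrite lee_fin mulr_ge0// fine_ge0.
  rewrite -sumEFin; apply: eq_bigr => t _.
  have e w' : ((h s t * fine (Pw s t w'))%:E = (h s t)%:E * Pw s t w')%E.
    by rewrite EFinM fineK.
  under eq_integral do rewrite e.
  rewrite ge0_integralZl//; last by rewrite lee_fin.
  rewrite EFinM; congr (_ * _)%E.
  rewrite fineK; last exact: (fin_num_measure PQ).
  rewrite (product_measure_unique (m' := (P \x^ Q)%E))//.
  by move=> B C mB mC; exact: product_measure2E.
have [w' fw'] : exists w', gain target <= f w'.
  by apply: (exists_ge_mean (Q := Q) mf f0); rewrite If lee_fin.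
exists (fun q => g (sim b w' q.1 q.2)).
  apply: (fin_measurable_comp (D := fun q : 'M[R]_n * 'M[R]_n => sim b w' q.1 q.2)) => //.
  apply: measurable_sim_comp.
  - exact: measurable_cst.
  - exact: measurable_fst.
  - exact: measurable_snd.
apply: (le_trans fw'); rewrite /f /gain le_eqVlt; apply/orP; left; apply/eqP.
apply: eq_bigr => s _; apply: eq_bigr => t _; congr (_ * fine (P _)).
by apply/seteqP; split => w; rewrite /ysection /= inE.
Qed.

End simulation.

(** * The Gaussian model *)

Section reduction.
Context {R : realType} {m n : nat} (hm : (1 < m)%N).
Context {d : measure_display} {T : measurableType d} (P : probability T R).
Variables (pistar : T -> alignment m n) (X : T -> observation R m n).

(** Sufficiency in the sense of the comparison of experiments: for every score, passing to
the first graph and the aggregate costs nothing on average. *)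
Definition aggregate_suffices (M : model R) : Prop :=
  forall (g : observation R m n -> 'S_n) (h : 'S_n -> 'S_n -> R),
  fin_measurable g -> (forall s t, 0 <= h s t) ->
  exists2 g' : 'M[R]_n * 'M[R]_n -> 'S_n, fin_measurable g' &
    \sum_s \sum_t h s t * fine (P [set w | second hm (pistar w) = s /\ g (X w) = t]) <=
    \sum_s \sum_t h s t * fine (P [set w | second hm (pistar w) = s /\
      g' (tnth (X w) (graph1 hm), aggregate hm M (pistar w) (X w)) = t]).

Lemma card_alignment_gt0 : (0 < #|{: alignment m n}|)%N.
Proof.
by apply/card_gt0P; exists (@id_alignment m n).
Qed.

Lemma correlated_graphs_graphs M : correlated_graphs P M pistar X ->
  forall w, graphs (X w).
Proof. by case=> _ _ h _ _ w k; exact: h. Qed.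

Lemma gaussian_aggregateE (rho : R) (a : alignment m n) (x : observation R m n) i j :
  aggregate hm (Gaussian rho) a x
    (component a (graph2 hm) i) (component a (graph2 hm) j) =
  tail_sum [tuple tnth x k (component a k i) (component a k j) | k < m].
Proof.
rewrite /aggregate mxE /tail_sum.
by apply: eq_bigr => k _; rewrite tnth_mktuple /relative !permM !permK.
Qed.

(** The model conditioned on one fixed alignment [a1] serves as a source of fresh
equicorrelated edge vectors, one per edge. *)
Lemma gaussian_aggregate_suffices (rho : R) (e0 : edge n) :
  correlated_graphs P (Gaussian rho) pistar X ->
  aggregate_suffices (Gaussian rho).
Proof.
move=> cg; have gX := correlated_graphs_graphs cg.
case: cg => mpi mX _ Ppi [rho01 edgeQ] g h mg h0.
set c : R := #|{: alignment m n}|%:R^-1 in Ppi.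
have c_gt0 : 0 < c by rewrite invr_gt0 ltr0n card_alignment_gt0.
have /card_gt0P[a1 _] := card_alignment_gt0.
pose V (a : alignment m n) e w := edge_vector a (X w) e.
have mV a e : measurable_fun setT (V a e).
  exact: (measurableT_comp (measurable_edge_vector a e) mX).
pose Q a := cond_law P (mpi a).
have indepQ a : mutually_independent (Q a) (V a) by have [] := edgeQ a (mpi a).
have eqQ a e : equicorrelated (Q a) rho (V a e).
  by have [_ h'] := edgeQ a (mpi a); exact: h'.
have [L LE] := law_exists (Q a1) (mV a1 e0).
have m0 : (0 < m)%N := ltnW hm.
have lawV a e A : measurable A -> Q a (V a e @^-1` A) = L A.
  by move=> mA; rewrite LE; exact: (equicorrelated_unique m0 _ _ (eqQ a e) (eqQ a1 e0)).
have jointV a (B : edge n -> set (m.-tuple R)) : (forall e, measurable (B e)) ->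
    Q a [set w | forall e, B e (V a e w)] = (\prod_e L (B e))%E.
  move=> mB; have := indepQ a (finset.setTfor (edge n)) B mB.
  rewrite (_ : [set w | _] = [set w | forall e, B e (V a e w)]); last first.
    by apply/seteqP; split => w hw e => [|_]; apply: hw; rewrite ?finset.in_setT.
  move=> ->; rewrite (eq_bigl xpredT); last by move=> e; rewrite finset.in_setT.
  by apply: eq_bigr => e _; exact: lawV.
apply: (derandomized_estimator (hm := hm) mpi mX gX (agg := tail_sum)
  measurable_tail_sum _ (ltW c_gt0) (L := L) (Q := Q a1) (N := L) _ (mV a1) (jointV a1)
  (psi := gauss_fill) measurable_gauss_fill) => //.
- exact: gaussian_aggregateE.
- move=> a B mB; rewrite -(jointV a B mB).
  rewrite /Q (cond_lawE (mpi a) _ (Ppi a)) ?gt_eqF// muleCA -EFinM divff ?gt_eqF// mule1.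
  by congr (P _); rewrite setIC.
- move=> A mA.
  have mW := measurable_with_first_psi (R := R) (m := m) measurable_tail_sum measurable_gauss_fill.
  rewrite (product_law (mV a1 e0) (mV a1 e0) LE LE) /=.
    by rewrite (gauss_fill_law hm (mV a1 e0) (mV a1 e0) (eqQ a1 e0) (eqQ a1 e0) mA) LE.
  by have := mW measurableT _ mA; rewrite setTI.
Qed.

End reduction.

(** * The Erdos-Renyi model *)

Section bool_tuples.
Context {m : nat}.

Lemma measurable_bool_tuple (A : set (m.-tuple bool)) : measurable A.
Proof.
rewrite (_ : A = \bigcup_(z in A) [set z]); last first.
  by apply/seteqP; split => [z Az|z [y Ay /= ->]//]; exists z.
apply: fin_bigcup_measurable; first exact: finite_finset.
move=> z _; rewrite measurable_tuple_boxes; apply: sub_sigma_algebra.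
exists (fun i => [set tnth z i]) => //.
by apply/seteqP; split => [z' /= -> //|z' zz' /=]; apply: eq_from_tnth => i; exact: zz'.
Qed.

Lemma measurable_fun_bool_tuple d (E : measurableType d) (f : m.-tuple bool -> E) :
  measurable_fun setT f.
Proof. by move=> _ B _; exact: measurable_bool_tuple. Qed.

End bool_tuples.

Section erdos_renyi.
Context {R : realType} {m n : nat} (hm : (1 < m)%N).
Context {d : measure_display} {T : measurableType d} (P : probability T R).
Variables (p s : R) (Z : @latent_index m n -> T -> bool).
Hypothesis mZ : forall i, measurable_fun setT (Z i).
Hypothesis indZ : mutually_independent P Z.
Hypothesis lawZ : forall e, (forall A, P (Z (None, e) @^-1` A) = bernoulli_prob p A)
              /\ forall k A, P (Z (Some k, e) @^-1` A) = bernoulli_prob s A.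
Variable e0 : edge n.

(** Index 0 holds the parent [X^0_e], and index [k + 1] holds [xi^k_e]. *)
Definition latent e (w : T) : m.+1.-tuple bool :=
  [tuple Z (unlift ord0 i, e) w | i < m.+1].

Let theta (i : 'I_m.+1) (A : set bool) := P (Z (unlift ord0 i, e0) @^-1` A).

Let thetaE e i A : P (Z (unlift ord0 i, e) @^-1` A) = theta i A.
Proof.
rewrite /theta; case: (unlift _ _) => [k|].
  by rewrite !(lawZ _).2.
by rewrite !(lawZ _).1.
Qed.

Let thetaT i : theta i setT = 1%E.
Proof. by rewrite /theta preimage_setT probability_setT. Qed.

Lemma measurable_latent e : measurable_fun setT (latent e).
Proof.
apply/measurable_fun_tnthP => i.
rewrite (_ : _ \o _ = Z (unlift ord0 i, e))//; apply/funext => w /=.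
by rewrite tnth_mktuple.
Qed.

Let proj_latent (o : option 'I_m) : 'I_m.+1 := if o is Some k then lift ord0 k else ord0.

Let proj_latentK : cancel proj_latent (unlift ord0).
Proof. by case=> [k|] /=; rewrite ?liftK ?unlift_none. Qed.

Let unlift0K : cancel (unlift ord0) proj_latent.
Proof. by move=> i; case: (unliftP ord0 i) => [j ->|->]. Qed.

Definition spread (B : edge n -> 'I_m.+1 -> set bool) (q : latent_index) : set bool :=
  B q.2 (proj_latent q.1).

Lemma spreadP B w :
  (forall q : latent_index, spread B q (Z q w)) <-> (forall e i, B e i (tnth (latent e w) i)).
Proof.
split=> [h e i|h [q e] ].
  by rewrite tnth_mktuple; have := h (unlift ord0 i, e); rewrite /spread /= unlift0K.
have := h e (proj_latent q); rewrite tnth_mktuple proj_latentK; exact.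
Qed.

Lemma prod_spread B :
  (\prod_q P (Z q @^-1` spread B q) = \prod_e \prod_i theta i (B e i))%E.
Proof.
rewrite exchange_big /= [RHS](reindex proj_latent) /=; last first.
  by exists (unlift ord0) => o _; [exact: proj_latentK|exact: unlift0K].
rewrite pair_big /=; apply: eq_bigr => -[q e] _ /=.
by rewrite -(thetaE e) proj_latentK.
Qed.

Let spread_law B : P [set w | forall q : latent_index, spread B q (Z q w)] =
  (\prod_q P (Z q @^-1` spread B q))%E.
Proof.
have := indZ (finset.setTfor latent_index) (B := spread B).
rewrite (_ : [set w | _] = [set w | forall q : latent_index, spread B q (Z q w)]); last first.
  by apply/seteqP; split => w hw e => [|_]; apply: hw; rewrite ?finset.in_setT.
by move=> -> //; apply: eq_bigl => e; rewrite finset.in_setT.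
Qed.

Lemma latent_box_law B :
  P [set w | forall e i, B e i (tnth (latent e w) i)] =
  (\prod_e \prod_i theta i (B e i))%E.
Proof.
rewrite -prod_spread -spread_law; congr (P _).
by apply/seteqP; split => w /spreadP.
Qed.

Lemma latent1_box_law e (B : 'I_m.+1 -> set bool) :
  P [set w | forall i, B i (tnth (latent e w) i)] = (\prod_i theta i (B i))%E.
Proof.
have := latent_box_law (fun e' => if e' == e then B else fun=> setT).
rewrite (bigD1 e)//= eqxx [X in (_ * X)%E]big1 ?mule1; last first.
  by move=> e' /negbTE ->; rewrite big1.
move=> <-; congr (P _); apply/seteqP; split => w h; last first.
  by move=> i; have := h e i; rewrite eqxx.
by move=> e' i; case: eqP => // ->; exact: h.
Qed.

(** The event [D] is either the whole space or the event that the alignment takes a given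
value, of probability [c]. *)
Lemma latent_iid (D : set T) (c : R) (beta : probability (m.+1.-tuple bool) R) :
  (forall C, beta C = P (latent e0 @^-1` C)) ->
  measurable D -> 0 <= c ->
  (forall B, P (D `&` [set w | forall q : latent_index, spread B q (Z q w)]) =
     (c%:E * P [set w | forall q : latent_index, spread B q (Z q w)])%E) ->
  forall B, P (D `&` [set w | forall e, B e (latent e w)]) = (c%:E * \prod_e beta (B e))%E.
Proof.
move=> betaE mD c0 hD B.
apply: (@multimeasure_unique R _ _ (edge n) tuple_boxes
  (fun B => P (D `&` [set w | forall e, B e (latent e w)]))
  (fun B => c%:E * \prod_e beta (B e))%E).
- exact: measurable_tuple_boxes.
- exact: tuple_boxesI.
- by exists (fun=> setT) => //; apply/seteqP.
- by apply: multimeasure_event => // e; exact: measurable_latent.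
- exact: (multimeasure_prod (fun=> beta)).
- move=> {}B GB.
  have /choice[B' B'P] : forall e, exists B' : 'I_m.+1 -> set bool,
      B e = [set v | forall i, B' i (tnth v i)].
    by move=> e; have [B' _ ->] := GB e; exists B'.
  rewrite (_ : [set w | _] = [set w | forall q : latent_index, spread B' q (Z q w)]); last first.
    apply/seteqP; split => w.
      by move=> h; apply/spreadP => e i; have := h e; rewrite B'P; exact.
    by move=> /spreadP h e; rewrite B'P; exact: h.
  rewrite hD spread_law prod_spread; congr (_ * _)%E.
  by apply: eq_bigr => e _; rewrite betaE B'P -(latent1_box_law e0).
- by move=> e; exact: measurable_bool_tuple.
Qed.

Variable beta : probability (m.+1.-tuple bool) R.
Hypothesis betaE : forall C, beta C = P (latent e0 @^-1` C).

Lemma beta_box (B : 'I_m.+1 -> set bool) :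
  beta [set z | forall i, B i (tnth z i)] = (\prod_i theta i (B i))%E.
Proof. by rewrite betaE -(latent1_box_law e0). Qed.

Let i1 : 'I_m.+1 := lift ord0 (graph1 hm).

(** The flags other than the parent and the flag of the first graph. *)
Definition flags_tail (k : 'I_m.+1) : bool := (k != ord0) && (k != i1).

(** The event [S] need not be a box. It is the preimage of itself under the map [rho] that
overwrites the head with constants, so that the claim is an equality of two measures,
which can be checked on boxes. *)
Lemma head_tail_independent (x t : bool) (S : set (m.+1.-tuple bool)) :
  (forall z z' : m.+1.-tuple bool,
    (forall i, flags_tail i -> tnth z i = tnth z' i) -> S z -> S z') ->
  (beta [set z | [/\ tnth z ord0 = x, tnth z i1 = t & S z]] =
   beta [set z | tnth z ord0 = x /\ tnth z i1 = t] * beta S)%E.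
Proof.
move=> Stail.
pose H i : set bool := if i == ord0 then [set x] else if i == i1 then [set t] else setT.
pose rho (z : m.+1.-tuple bool) : m.+1.-tuple bool :=
  [tuple if flags_tail i then tnth z i else false | i < m.+1].
have HE : [set z : m.+1.-tuple bool | tnth z ord0 = x /\ tnth z i1 = t] =
    [set z | forall i, H i (tnth z i)].
  apply/seteqP; split => [z [z0 z1] i|z h].
    by rewrite /H; case: eqP => [->//|_]; case: eqP => [->|].
  have := h ord0; have := h i1; rewrite /H eqxx /= => h1 h0.
  by split; [exact: h0|exact: h1].
have SE : S = rho @^-1` S.
  have rE z i : flags_tail i -> tnth z i = tnth (rho z) i.
    by move=> fi; rewrite tnth_mktuple fi.
  apply/seteqP; split => z /=; apply: Stail => i fi; first exact: rE.
  by rewrite -rE.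
have [mu1 mu1E] := restricted_law beta (measurable_bool_tuple
  [set z : m.+1.-tuple bool | forall i, H i (tnth z i)])
  (measurable_fun_bool_tuple rho).
have [mu2 mu2E] := restricted_law beta (measurable_bool_tuple (@setT (m.+1.-tuple bool)))
  (measurable_fun_bool_tuple rho).
have fin A : beta A \is a fin_num.
  by apply: fin_num_measure; exact: measurable_bool_tuple.
set bH := beta [set z | tnth z ord0 = x /\ tnth z i1 = t].
have bH0 : 0 <= fine bH by apply: fine_ge0; exact: measure_ge0.
pose mu3 : {measure set _ -> \bar R} := mscale (NngNum bH0) mu2.
have mu3E C : mu3 C = (bH * beta (rho @^-1` C))%E.
  transitivity ((fine bH)%:E * mu2 C)%E; first by [].
  by rewrite mu2E setIT fineK /bH ?fin.
have mu13 A : measurable A -> mu1 A = mu3 A.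
  apply: (measure_unique tuple_boxes (fun=> setT)) => //.
  - exact: measurable_tuple_boxes.
  - exact: tuple_boxesI.
  - by move=> _; exists (fun=> setT) => //; apply/seteqP.
  - by apply/seteqP; split => // y _; exists 0%N.
  - move=> _ [B mB ->]; rewrite mu1E mu3E /bH HE.
    (* If some [B i] excludes the value written over the head, the preimage is empty;
       otherwise the head coordinates impose no condition. *)
    have [bad|good] := pselect (exists2 i, ~~ flags_tail i & ~ B i false).
      have [i fi Bi] := bad.
      have -> : rho @^-1` [set v | forall k, B k (tnth v k)] = set0.
        apply/seteqP; split => // z /= /(_ i).
        by rewrite tnth_mktuple (negbTE fi).
      by rewrite set0I !measure0 mule0.
    have goodB i : ~~ flags_tail i -> B i false.
      by move=> fi; apply: contrapT => nB; apply: good; exists i.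
    pose B' i := if flags_tail i then B i else setT.
    have -> : rho @^-1` [set v | forall k, B k (tnth v k)] = [set z | forall i, B' i (tnth z i)].
      apply/seteqP; split => z /= h i; have := h i; rewrite tnth_mktuple /B';
      by case: ifPn => // /goodB.
    rewrite (_ : _ `&` _ = [set z | forall i, (B' i `&` H i) (tnth z i)]); last first.
      apply/seteqP; split => [z [h1 h2] i|z h]; first by split; [exact: h1|exact: h2].
      by split => i; have [] := h i.
    apply: etrans (beta_box (fun i => B' i `&` H i)) _.
    rewrite !beta_box -big_split /=; apply: eq_bigr => i _.
    rewrite /B' /H /flags_tail; case: eqP => [_|_] /=; first by rewrite setTI thetaT mule1.
    by case: eqP => [_|_] /=; rewrite ?setTI ?setIT thetaT ?mule1 ?mul1e.
  - move=> _; rewrite mu1E -ge0_fin_numE; [exact: fin|exact: measure_ge0].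
have := mu13 S (measurable_bool_tuple S).
rewrite mu1E mu3E -SE => <-.
congr (beta _); rewrite -HE; apply/seteqP; split => z; first by case.
by case=> Sz [].
Qed.

End erdos_renyi.

Section er_fill.
Context {R : realType} {m : nat} (hm : (1 < m)%N).

Definition kept_entries (z : m.+1.-tuple bool) : m.-tuple R :=
  [tuple (tnth z ord0)%:R * (tnth z (lift ord0 k))%:R | k < m].

Definition tail_max (v : m.-tuple R) : R :=
  \big[Num.max/0]_(k < m | (0 < k)%N) tnth v k.

Definition er_fill (y : R) (z : m.+1.-tuple bool) : m.-tuple R :=
  [tuple y * (tnth z (lift ord0 k))%:R | k < m].

Definition tail_survives (z : m.+1.-tuple bool) : bool :=
  [exists k : 'I_m, (0 < k)%N && tnth z (lift ord0 k)].

Lemma tail_max_kept z :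
  tail_max (kept_entries z) = (tnth z ord0 && tail_survives z)%:R.
Proof.
rewrite /tail_max /tail_survives.
under eq_bigr do rewrite tnth_mktuple -natrM mulnb.
have claim (r : seq 'I_m) (b : 'I_m -> bool) :
    \big[Num.max/0]_(k <- r | (0 < k)%N) ((b k)%:R : R) =
    (has (fun k : 'I_m => (0 < k)%N && b k) r)%:R.
  elim: r => [|k r IH]; first by rewrite big_nil.
  rewrite big_cons IH /=; case: (0 < k)%N => //=.
  by case: (b k) => /=; case: (has _ _); rewrite /= ?maxxx// ?(max_l ler01) ?(max_r ler01)//.
rewrite claim; congr (nat_of_bool _)%:R.
apply/hasP/andP => [[k _ /andP[k0 /andP[z0 zk]]]|[z0 /existsP[k /andP[k0 zk]]]].
  by split => //; apply/existsP; exists k; rewrite k0.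
by exists k; rewrite ?mem_index_enum// k0 z0.
Qed.

Lemma measurable_tail_max : measurable_fun setT tail_max.
Proof.
rewrite /tail_max; elim: (index_enum _) => [|k r IH].
  by under eq_fun do rewrite big_nil; exact: measurable_cst.
under eq_fun do rewrite big_cons.
case: (0 < k)%N => //.
by apply: measurable_maxr => //; exact: measurable_tnth.
Qed.

Lemma measurable_er_fill :
  measurable_fun setT (fun q : R * m.+1.-tuple bool => er_fill q.1 q.2).
Proof.
apply: measurable_mktuple => k; apply: measurable_funM; first exact: measurable_fst.
exact: (measurableT_comp (measurable_fun_bool_tuple
  (fun z : m.+1.-tuple bool => (tnth z (lift ord0 k))%:R : R)) measurable_snd).
Qed.

(** The edge vector when the parent is present: the flag [t] of the first graph followed by
the tail of [z]. *)
Definition splice (t : bool) (z : m.+1.-tuple bool) : m.-tuple R :=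
  [tuple if val k == 0%N then t%:R else (tnth z (lift ord0 k))%:R | k < m].

Let i1 : 'I_m.+1 := lift ord0 (graph1 hm).

Lemma kept_entries_splice z : tnth z ord0 && tail_survives z ->
  kept_entries z = splice (tnth z i1) z.
Proof.
move=> /andP[z0 _]; apply: eq_from_tnth => k; rewrite !tnth_mktuple z0 mul1r.
case: eqP => // k0; congr (nat_of_bool (tnth z _))%:R; congr lift.
exact: val_inj.
Qed.

Lemma er_fill_splice z z' : tnth z ord0 && tail_survives z ->
  with_first (kept_entries z) (er_fill (tail_max (kept_entries z)) z') =
  splice (tnth z i1) z'.
Proof.
move=> /[dup] /andP[z0 _] zD; apply: eq_from_tnth => k.
rewrite !tnth_mktuple tail_max_kept zD mul1r z0 mul1r.
case: eqP => // k0; congr (nat_of_bool (tnth z _))%:R; congr lift.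
exact: val_inj.
Qed.

Lemma er_fill_lost z z' : ~~ (tnth z ord0 && tail_survives z) ->
  with_first (kept_entries z) (er_fill (tail_max (kept_entries z)) z') =
  kept_entries z.
Proof.
move=> zD; apply: eq_from_tnth => k.
rewrite !tnth_mktuple tail_max_kept (negbTE zD) mul0r.
case: eqP => // /eqP k0; move: zD; rewrite negb_and => /orP[/negbTE ->|].
  by rewrite mul0r.
move=> /existsPn /(_ k); rewrite lt0n k0 /= => /negbTE ->.
by rewrite mulr0.
Qed.

Variable beta : probability (m.+1.-tuple bool) R.
Hypothesis head_tail : forall (x t : bool) (S : set (m.+1.-tuple bool)),
  (forall z z' : m.+1.-tuple bool,
    (forall i, flags_tail hm i -> tnth z i = tnth z' i) -> S z -> S z') ->
  (beta [set z | [/\ tnth z ord0 = x, tnth z i1 = t & S z]] =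
   beta [set z | tnth z ord0 = x /\ tnth z i1 = t] * beta S)%E.
Variable L : probability (m.-tuple R) R.
Hypothesis LE : forall A, L A = beta (kept_entries @^-1` A).

Let mT (A : set (m.+1.-tuple bool)) : measurable A := measurable_bool_tuple A.
Let survivors : set (m.+1.-tuple bool) := [set z | tail_survives z].
Let N := cond_law beta (mT survivors).

Let flags_lift (k : 'I_m) : (0 < k)%N -> flags_tail hm (lift ord0 k).
Proof.
move=> k0; rewrite /flags_tail eq_sym neq_lift (inj_eq lift_inj).
by rewrite -val_eqE /= -lt0n.
Qed.

Let survivors_tail (z z' : m.+1.-tuple bool) :
  (forall i, flags_tail hm i -> tnth z i = tnth z' i) ->
  survivors z -> survivors z'.
Proof.
move=> zz' /existsP[k /andP[k0 zk]]; apply/existsP; exists k.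
by rewrite k0 -zz' ?flags_lift.
Qed.

(** The law [N] is that of the flags conditioned on a tail event, hence independent of the
head. If that event is negligible, both sides vanish. *)
Lemma resampled_given_head t (A : set (m.-tuple R)) :
  (beta [set z | [/\ tnth z ord0 = true, tnth z i1 = t & survivors z]] *
     N [set z | A (splice t z)] =
   beta [set z | [/\ tnth z ord0 = true, tnth z i1 = t &
     survivors z /\ A (splice t z)]])%E.
Proof.
rewrite !head_tail; last 2 first.
- move=> z z' zz' [Sz Az]; split; first exact: survivors_tail Sz.
  rewrite (_ : splice t z' = splice t z)//; apply: eq_from_tnth => k.
  rewrite !tnth_mktuple; case: eqP => // /eqP; rewrite -lt0n => k0.
  by rewrite zz' ?flags_lift.
- exact: survivors_tail.
have fin B : beta B \is a fin_num by apply: fin_num_measure; exact: mT.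
rewrite -muleA; congr (_ * _)%E.
have [b0|b0] := eqVneq (beta survivors) 0%E.
  rewrite b0 mul0e; apply/esym/eqP; rewrite eq_le measure_ge0 andbT -b0.
  by apply: le_measure; rewrite ?inE; [exact: mT|exact: mT|move=> z []].
have bE := esym (fineK (fin survivors)).
rewrite /N (cond_lawE (mT survivors) _ bE) ?fine_eq0//.
rewrite muleCA -[X in (_ * (X * _))%E](fineK (fin survivors)) -EFinM divff ?fine_eq0// mule1.
by congr (beta _); rewrite setIC.
Qed.

(** If the parent is absent or no tail flag survives, the aggregate and the tail vanish, and
refilling changes nothing ([er_fill_lost]). Otherwise the aggregate is 1, and refilling
amounts to drawing the tail flags anew from their law given that they do not all
vanish. *)
Lemma er_fill_law A : measurable A ->
  (L \x N)%E [set q | A (with_first q.1 (er_fill (tail_max q.1) q.2))] = L A.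
Proof.
move=> mA.
pose D z := tnth z ord0 && tail_survives z.
pose lost : set (m.+1.-tuple bool) := [set z | ~~ D z /\ A (kept_entries z)].
pose head t := [set z : m.+1.-tuple bool | [/\ tnth z ord0 = true, tnth z i1 = t & survivors z]].
pose tail t := [set z | A (splice t z)].
have DE z : D z = true -> tnth z ord0 = true /\ survivors z by move=> /andP[].
rewrite (product_law (V1 := kept_entries) (V2 := id) (P1 := beta) (P2 := N)) //; last first.
  have := measurable_with_first_psi measurable_tail_max measurable_er_fill measurableT mA.
  by rewrite setTI.
rewrite (_ : [set q | _] = (lost `*` setT) `|` ((head true `*` tail true) `|`
    (head false `*` tail false))); last first.
  apply/seteqP; split => [[z z'] /=|[z z'] /=].
    case: (boolP (D z)) => zD; last by rewrite er_fill_lost// => h; left.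
    rewrite er_fill_splice// => h; right; have [z0 zS] := DE z zD.
    by case e : (tnth z i1) h => h; [left|right].
  case=> [[[zD h] _]|]; first by rewrite er_fill_lost.
  by case=> -[[z0 z1 zS] h]; rewrite er_fill_splice ?z0//; move: h; rewrite /tail z1.
have mX (B C : set (m.+1.-tuple bool)) : measurable (B `*` C).
  by apply: measurableX; exact: mT.
have dis1 : (lost `*` [set: m.+1.-tuple bool]) `&`
    (head true `*` tail true `|` head false `*` tail false) = set0.
  apply/seteqP; split => // -[z z'] /= [[[/negP zD _] _]].
  by case=> -[[z0 z1 zS] _]; apply: zD; rewrite /D z0.
have dis2 : (head true `*` tail true) `&` (head false `*` tail false) = set0.
  by apply/seteqP; split => // -[z z'] /= [[[_ z1 _] _] [[_ z1' _] _]]; rewrite z1 in z1'.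
rewrite measureU//; last by apply: measurableU.
rewrite measureU//.
have pX B C : (beta \x N)%E (B `*` C) = (beta B * N C)%E.
  exact: product_measure1E (mT B) (mT C).
transitivity (beta lost * N setT + (beta (head true) * N (tail true) +
    beta (head false) * N (tail false)))%E.
  by congr (_ + (_ + _))%E; exact: pX.
rewrite LE.
rewrite (_ : kept_entries @^-1` A = lost `|`
  ([set z | [/\ tnth z ord0 = true, tnth z i1 = true & survivors z /\ A (splice true z)]] `|`
   [set z | [/\ tnth z ord0 = true, tnth z i1 = false & survivors z /\ A (splice false z)]])); last first.
  apply/seteqP; split => z /=.
    case: (boolP (D z)) => zD; last by move=> h; left.
    rewrite kept_entries_splice// => h; right; have [z0 zS] := DE z zD.
    by case e : (tnth z i1) h => h; [left|right].
  case=> [[]//|]; case=> -[z0 z1 [zS h]];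
  by rewrite kept_entries_splice ?z0// z1.
rewrite measureU//; last first.
  apply/seteqP; split => // z /= [[/negP zD _]].
  by case=> -[z0 z1 [zS _]]; apply: zD; rewrite /D z0.
rewrite measureU//; last first.
  by apply/seteqP; split => // z /= [[_ z1 _] [_ z1' _]]; rewrite z1 in z1'.
congr (_ + (_ + _))%E; try exact: resampled_given_head.
by apply: etrans (mule1 _); congr (_ * _)%E; exact: probability_setT.
Qed.

End er_fill.

Section er_reduction.
Context {R : realType} {m n : nat} (hm : (1 < m)%N).
Context {d : measure_display} {T : measurableType d} (P : probability T R).
Variables (pistar : T -> alignment m n) (X : T -> observation R m n).

Lemma er_aggregateE (p s : R) (a : alignment m n) (x : observation R m n) i j :
  aggregate hm (ErdosRenyi p s) a x
    (component a (graph2 hm) i) (component a (graph2 hm) j) =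
  tail_max [tuple tnth x k (component a k i) (component a k j) | k < m].
Proof.
rewrite /aggregate mxE /tail_max.
by apply: eq_bigr => k _; rewrite tnth_mktuple /relative !permM !permK.
Qed.

(** The noise consists of the latent flags themselves, conditioned on the event [G] that on
every edge some tail flag survives. *)
Lemma er_aggregate_suffices (p s : R) (e0 : edge n) :
  correlated_graphs P (ErdosRenyi p s) pistar X ->
  aggregate_suffices hm P pistar X (ErdosRenyi p s).
Proof.
move=> cg; have gX := correlated_graphs_graphs cg.
case: cg => mpi mX _ Ppi [p01 s01 [Z [mZ indZ indpi lawZ XE]]] g h mg h0.
set c : R := #|{: alignment m n}|%:R^-1 in Ppi.
have c_ge0 : 0 <= c by rewrite invr_ge0.
have ml e := measurable_latent mZ e.
have [beta betaE] := law_exists P (ml e0).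
have [L LE] := law_exists beta (measurable_fun_bool_tuple (@kept_entries R m)).
have iidP (B : edge n -> set (m.+1.-tuple bool)) :
    P [set w | forall e, B e (latent Z e w)] = (\prod_e beta (B e))%E.
  have := latent_iid mZ indZ lawZ betaE measurableT ler01 _ B.
  by rewrite setTI mul1e; apply => B'; rewrite setTI mul1e.
have iidV a (B : edge n -> set (m.-tuple R)) : (forall e, measurable (B e)) ->
    P [set w | pistar w = a /\ forall e, B e (edge_vector a (X w) e)] =
    (c%:E * \prod_e L (B e))%E.
  move=> mB.
  have hD (B' : edge n -> 'I_m.+1 -> set bool) :
      P (pistar @^-1` [set a] `&` [set w | forall q : latent_index, spread B' q (Z q w)]) =
      (c%:E * P [set w | forall q : latent_index, spread B' q (Z q w)])%E.
    by rewrite -(Ppi a) -indpi.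
  have := latent_iid mZ indZ lawZ betaE (mpi a) c_ge0 hD
    (fun e => @kept_entries R m @^-1` B e).
  under eq_bigr do rewrite -LE.
  move=> <-; congr (P _).
  have VE w e : pistar w = a -> edge_vector a (X w) e = kept_entries (latent Z e w).
    move=> wa; apply: eq_from_tnth => k.
    by rewrite -{1}wa XE !tnth_mktuple unlift_none liftK.
  apply/seteqP; split => w [wa hw]; split => // e; have := hw e.
    by rewrite /= -VE.
  by rewrite VE.
pose surv : set (m.+1.-tuple bool) := [set z | tail_survives z].
pose G := [set w | forall e, surv (latent Z e w)].
have mG : measurable G.
  rewrite (_ : G = \bigcap_(e in [set: edge n]) (latent Z e @^-1` surv)); last first.
    by apply/seteqP; split => w hw e; [move=> _; exact: hw|exact: hw e Logic.I].
  apply: fin_bigcap_measurable; first exact: finite_finset.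
  move=> e _; rewrite -[X in measurable X]setTI.
  by apply: ml => //; exact: measurable_bool_tuple.
pose N := cond_law beta (measurable_bool_tuple surv).
have PG : P G = (\prod_(e : edge n) beta surv)%E by exact: iidP.
have fin A : beta A \is a fin_num.
  by apply: fin_num_measure; exact: measurable_bool_tuple.
pose q := fine (beta surv).
have bq : beta surv = q%:E by rewrite /q fineK.
have iidU (B : edge n -> set (m.+1.-tuple bool)) : (forall e, measurable (B e)) ->
    cond_law P mG [set w | forall e, B e (latent Z e w)] = (\prod_e N (B e))%E.
  (* [cond_law] given a null event is the law itself, for [P] as for [beta]. *)
  move=> _; have [q0|q0] := eqVneq q 0.
    rewrite cond_law0; last by rewrite PG (bigD1 e0)//= bq q0 mul0e.
    rewrite iidP; apply: eq_bigr => e _.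
    by rewrite /N cond_law0// bq q0.
  have PGq : P G = (\prod_(e : edge n) q)%:E.
    by rewrite PG -prodEFin; apply: eq_bigr => e _; exact: bq.
  rewrite (cond_lawE mG _ PGq); last by apply/prodf_neq0 => e _.
  rewrite (_ : _ `&` G = [set w | forall e, (B e `&` surv) (latent Z e w)]); last first.
    apply/seteqP; split => [w [h1 h2] e|w hw].
      by split; [exact: h1|exact: h2].
    by split => e; have [] := hw e.
  transitivity ((\prod_e beta (B e `&` surv)) * ((\prod_(e : edge n) q)^-1)%:E)%E.
    by congr (_ * _)%E; exact: (iidP (fun e => B e `&` surv)).
  rewrite -prodfV -prodEFin -big_split /=; apply: eq_bigr => e _.
  by rewrite /N (cond_lawE _ _ bq).
apply: (derandomized_estimator (hm := hm) mpi mX gX (agg := @tail_max R m)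
  measurable_tail_max _ c_ge0 iidV (Q := cond_law P mG) (N := N) ml iidU
  (psi := @er_fill R m) measurable_er_fill) => //.
- exact: er_aggregateE.
- move=> A mA; apply: (er_fill_law (hm := hm)) => //.
  by move=> x t S tl; exact: (head_tail_independent indZ lawZ betaE x t tl).
Qed.

End er_reduction.

(** * Modes of recovery *)

Section recovery_transfer.
Context {R : realType} {m : nat} (hm : (1 < m)%N).

Lemma no_edge_perm n (st : 'S_n) : (forall e : edge n, False) -> st = 1%g.
Proof.
move=> noe; apply/permP => i; rewrite perm1; apply: contrapT => /eqP ij.
by have [e _] := edge_of_neq ij; exact: noe e.
Qed.

(** A model without edges has at most one vertex, and then there is only one permutation. *)
Lemma correlated_aggregate_suffices n d (T : measurableType d) (P : probability T R)
    (M : model R) (pistar : T -> alignment m n) (X : T -> observation R m n) :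
  correlated_graphs P M pistar X -> aggregate_suffices hm P pistar X M.
Proof.
move=> cg; have [[e0]|noe] := pselect (inhabited (edge n)).
  case: M cg => [rho|p s] cg; first exact: gaussian_aggregate_suffices.
  exact: er_aggregate_suffices.
have {}noe (e : edge n) : False by apply: noe; constructor.
move=> g h mg h0; exists (fun=> 1%g).
  move=> st; have [->|ne] := eqVneq st 1%g.
    by rewrite (_ : _ @^-1` _ = setT)//; apply/seteqP.
  rewrite (_ : _ @^-1` _ = set0)//; apply/seteqP; split => // x /= e1.
  by rewrite e1 eqxx in ne.
apply: ler_sum => st _; apply: ler_sum => t _; rewrite le_eqVlt; apply/orP; left.
apply/eqP; congr (_ * fine (P _)); apply/seteqP; split => w /= [-> _]; split => //;
by rewrite (no_edge_perm t noe) ?(no_edge_perm (g _) noe).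
Qed.

Lemma overlap_perm_le1 n (s t : 'S_n) : overlap_perm R s t <= 1.
Proof.
rewrite /overlap_perm; case: n s t => [|n] s t; first by rewrite invr0 mulr0 ler01.
by rewrite ler_pdivrMr ?ltr0n// mul1r ler_nat -[leqRHS]card_ord max_card.
Qed.

Lemma overlap_perm_ge0 n (s t : 'S_n) : 0 <= overlap_perm R s t.
Proof. by rewrite /overlap_perm divr_ge0. Qed.

Lemma overlap_le_second n (a b : alignment m n) :
  overlap R a b <= overlap_perm R (second hm a) (second hm b).
Proof.
rewrite /overlap /overlap_perm ler_wpM2r ?invr_ge0// ler_nat.
apply: subset_leq_card; apply/fintype.subsetP => i; rewrite !inE => /forallP.
by move=> /(_ (graph2 hm)).
Qed.

End recovery_transfer.

Section scores.
Context {R : realType} {d : measure_display} {T : measurableType d} (P : probability T R).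

Lemma fin_measurable_pair (S S' : finType) (f : T -> S) (g : T -> S') :
  fin_measurable f -> fin_measurable g -> fin_measurable (fun w => (f w, g w)).
Proof.
move=> mf mg [s t]; rewrite (_ : _ @^-1` _ = f @^-1` [set s] `&` g @^-1` [set t]).
  by apply: measurableI; [exact: mf|exact: mg].
by apply/seteqP; split => [w [<- <-]//|w /= [-> ->]].
Qed.

Context {S : finType} (theta f : T -> S).
Hypotheses (mtheta : fin_measurable theta) (mf : fin_measurable f).

Definition joint_mass s t : R := fine (P [set w | theta w = s /\ f w = t]).

Lemma joint_mass_ge0 s t : 0 <= joint_mass s t.
Proof. exact: fine_ge0. Qed.

Lemma pair_event (A : S -> S -> Prop) : measurable [set w | A (theta w) (f w)].
Proof.
exact: (fin_measurable_event (fun q : S * S => A q.1 q.2) (fin_measurable_pair mtheta mf)).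
Qed.

Lemma joint_massE (q : S -> S -> bool) :
  P [set w | q (theta w) (f w)] = (\sum_s \sum_t (q s t)%:R * joint_mass s t)%:E.
Proof.
rewrite (_ : [set w | _] = [set w | (fun st : S * S => q st.1 st.2) (theta w, f w) /\ setT w]); last first.
  by apply/seteqP; split => w // [].
rewrite (measure_fin_split P (fun st : S * S => q st.1 st.2) (fin_measurable_pair mtheta mf) measurableT).
rewrite pair_big /= big_mkcond /= -sumEFin; apply: eq_bigr => -[s t] _ /=.
case: (q s t) => /=; last by rewrite mul0r.
rewrite mul1r /joint_mass fineK.
  by congr (P _); apply/seteqP; split => [w /= [[-> ->] _]|w /= [-> ->]].
apply: fin_num_measure; exact: (pair_event (fun s' t' => s' = s /\ t' = t)).
Qed.

Lemma joint_mass_sum1 : \sum_s \sum_t joint_mass s t = 1.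
Proof.
have := joint_massE (fun _ _ => true).
rewrite (_ : [set w | _] = setT); last by apply/seteqP.
rewrite probability_setT => -[->]; apply: eq_bigr => s _; apply: eq_bigr => t _.
by rewrite mul1r.
Qed.

Variable ov : S -> S -> R.
Hypothesis ov01 : forall s t, 0 <= ov s t <= 1.

Definition mean_score : R := \sum_s \sum_t ov s t * joint_mass s t.

Lemma mean_score_ge (delta : R) :
  (1 - delta) * fine (P [set w | 1 - delta <= ov (theta w) (f w)]) <= mean_score.
Proof.
rewrite (joint_massE (fun s t => 1 - delta <= ov s t)) /= mulr_sumr; apply: ler_sum => s _.
rewrite mulr_sumr; apply: ler_sum => t _; rewrite mulrA ler_wpM2r ?joint_mass_ge0//.
have /andP[lo hi] := ov01 s t.
by case: (leP (1 - delta) (ov s t)) => h /=; rewrite ?mulr1 ?mulr0.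
Qed.

(** Markov's inequality for [1 - ov]. *)
Lemma mean_score_markov (eps : R) : 0 < eps ->
  eps * (1 - fine (P [set w | 1 - eps <= ov (theta w) (f w)])) <= 1 - mean_score.
Proof.
move=> e0; rewrite (joint_massE (fun s t => 1 - eps <= ov s t)) /=.
set p := \sum_s _; rewrite -joint_mass_sum1 /p /mean_score -!sumrB mulr_sumr.
apply: ler_sum => s _; rewrite -!sumrB mulr_sumr; apply: ler_sum => t _.
have -> : joint_mass s t - ov s t * joint_mass s t = (1 - ov s t) * joint_mass s t by ring.
rewrite -[X in X - _]mul1r -mulrBl mulrA ler_wpM2r ?joint_mass_ge0//.
have /andP[lo hi] := ov01 s t.
by case: (leP (1 - eps) (ov s t)) => h /=; [rewrite subrr mulr0 subr_ge0|rewrite subr0 mulr1; lra].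
Qed.

End scores.

Section transfer.
Context {R : realType} {m n : nat} (hm : (1 < m)%N).
Context {d : measure_display} {T : measurableType d} (P : probability T R).
Variables (M : model R) (pistar : T -> alignment m n) (X : T -> observation R m n).
Hypothesis cg : correlated_graphs P M pistar X.

Let mpi : fin_measurable pistar. Proof. by have [] := cg. Qed.
Let mX : measurable_fun setT X. Proof. by have [] := cg. Qed.

Let D w := (tnth (X w) (graph1 hm), aggregate hm M (pistar w) (X w)).

Lemma fin_measurable_second : fin_measurable (fun w => second hm (pistar w)).
Proof. by move=> s; exact: (fin_measurable_event (fun a => second hm a = s) mpi). Qed.

Lemma measurable_graph1_aggregate : measurable_fun setT D.
Proof.
apply: measurable_fun_pair; first exact: measurable_X1.
case: M => [rho|p s].
  exact: (measurable_Y mpi mX measurable_tail_sum (gaussian_aggregateE hm rho)).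
exact: (measurable_Y mpi mX measurable_tail_max (er_aggregateE hm p s)).
Qed.

Let msecond := fin_measurable_second.
Let mD := measurable_graph1_aggregate.

Variable est : observation R m n -> alignment m n.
Hypothesis mest : fin_measurable est.

Let g x := second hm (est x).

Let mg : fin_measurable g.
Proof. by move=> s; exact: (fin_measurable_event (fun a => second hm a = s) mest). Qed.

Let mgX : fin_measurable (fun w => g (X w)).
Proof. exact: (fin_measurable_comp mX mg). Qed.

Let ov2_01 (s t : 'S_n) : 0 <= overlap_perm R s t <= 1.
Proof. by rewrite overlap_perm_ge0 overlap_perm_le1. Qed.

Lemma measurable_estimate_event (A : alignment m n -> alignment m n -> Prop) :
  measurable [set w | A (pistar w) (est (X w))].
Proof. exact: (pair_event mpi (fin_measurable_comp mX mest)). Qed.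

Lemma aggregate_event (q : 'S_n -> 'S_n -> bool) :
  exists g' : 'M[R]_n * 'M[R]_n -> 'S_n, fin_measurable g' /\
    (P [set w | q (second hm (pistar w)) (g (X w))] <=
     P [set w | q (second hm (pistar w)) (g' (D w))])%E.
Proof.
have q0 s t : 0 <= ((q s t)%:R : R) by [].
have [g' mg' le_g'] := correlated_aggregate_suffices hm cg mg q0.
exists g'; split=> //.
by rewrite !joint_massE// ?lee_fin//; exact: (fin_measurable_comp mD mg').
Qed.

(** The estimator is chosen before [eps], with the overlap itself as the score, so that it
serves all thresholds. *)
Lemma aggregate_mean_score :
  exists g' : 'M[R]_n * 'M[R]_n -> 'S_n, fin_measurable g' /\
  forall eps delta : R, 0 < eps -> delta <= 1 ->
    eps * (1 - fine (P [set w | 1 - eps <=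
      overlap_perm R (second hm (pistar w)) (g' (D w))])) <=
    1 - (1 - delta) * fine (P [set w | 1 - delta <= overlap R (pistar w) (est (X w))]).
Proof.
have ov0 (s t : 'S_n) : 0 <= overlap_perm R s t by exact: overlap_perm_ge0.
have [g' mg' le_g'] := correlated_aggregate_suffices hm cg mg ov0.
exists g'; split=> // eps delta e0 d1.
have mg'D := fin_measurable_comp mD mg'.
have h := mean_score_markov P msecond mg'D ov2_01 e0; apply: le_trans h _.
rewrite lerD2l lerN2; apply: le_trans _ le_g'.
apply: le_trans _ (mean_score_ge P msecond mgX ov2_01 delta).
rewrite ler_wpM2l ?subr_ge0// fine_le ?fin_num_measure//.
- exact: (measurable_estimate_event (fun a b => 1 - delta <= overlap R a b)).
- exact: (pair_event msecond mgX (fun s t => 1 - delta <= overlap_perm R s t)).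
apply: le_measure; rewrite ?inE.
- exact: (measurable_estimate_event (fun a b => 1 - delta <= overlap R a b)).
- exact: (pair_event msecond mgX (fun s t => 1 - delta <= overlap_perm R s t)).
by move=> w /= h; apply: le_trans h (overlap_le_second hm _ _).
Qed.

End transfer.

Section transfer_limits.
Context {R : realType} {d : nat -> measure_display}
  {T : forall n, measurableType (d n)} (P : forall n, probability (T n) R).

Lemma whp_le (A B : forall n, set (T n)) : (forall n, measurable (B n)) ->
  (forall n, (P n (A n) <= P n (B n))%E) ->
  with_high_probability P A -> with_high_probability P B.
Proof.
move=> mB AB PA; rewrite /with_high_probability.
apply: (@squeeze_cvge _ _ _ _ (fun n => P n (A n)) _ (fun=> 1%E)) => //; last exact: cvg_cst.
by apply: nearW => n; rewrite AB probability_le1.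
Qed.

Lemma whp_fineP (A : forall n, set (T n)) : (forall n, measurable (A n)) ->
  with_high_probability P A <->
  forall e : R, 0 < e -> \forall n \near \oo, 1 - e <= fine (P n (A n)).
Proof.
move=> mA; have PA n : P n (A n) = (fine (P n (A n)))%:E.
  by rewrite fineK// fin_num_measure.
rewrite /with_high_probability (_ : (fun n => P n (A n)) = EFin \o (fun n => fine (P n (A n)))); last first.
  by apply/funext => n; exact: PA.
have le1 n : fine (P n (A n)) <= 1 by rewrite -lee_fin -PA probability_le1.
split=> [/fine_cvg/cvgrPdist_le h e e0|h].
  by apply: filterS (h e e0) => n /=; rewrite ger0_norm ?subr_ge0//; lra.
apply: cvg_EFin; first by apply: nearW.
apply/cvgrPdist_le => e e0; apply: filterS (h e e0) => n /=.
by rewrite ger0_norm ?subr_ge0//; lra.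
Qed.

End transfer_limits.

Theorem theorem3p1 (R : realType) (m : nat) (hm : (2 <= m)%N)
    (M : model_sequence R)
    (d : nat -> measure_display) (T : forall n, measurableType (d n))
    (P : forall n, probability (T n) R)
    (pistar : forall n, T n -> alignment m n)
    (X : forall n, T n -> observation R m n)
    (hX : forall n, correlated_graphs (P n) (model_at M n) (@pistar n) (@X n)) :
  let pistar2 := fun n (w : T n) => component (pistar n w) (graph2 hm) in
  let X1Y := fun n (w : T n) =>
    (tnth (X n w) (graph1 hm),
     aggregate hm (model_at M n) (pistar n w) (X n w)) in
  let ov2 := @overlap_perm R in
  let ov := @overlap R m in
  [/\ exact_impossible P ov2 pistar2 X1Y -> exact_impossible P ov pistar X,
      almost_exact_impossible P ov2 pistar2 X1Y ->
        almost_exact_impossible P ov pistar X,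
      partial_impossible P ov2 pistar2 X1Y -> partial_impossible P ov pistar X &
      partial_intractable P ov2 pistar2 X1Y ->
        partial_intractable P ov pistar X].
Proof.
move=> pistar2 X1Y ov2 ov.
have ov_le n (a b : alignment m n) : ov n a b <= ov2 n (second hm a) (second hm b).
  exact: overlap_le_second.
(* One event per [n] is fixed in advance; the estimator may depend on these events. *)
have event est (q : forall n, 'S_n -> 'S_n -> bool) : estimator est ->
    exists est2 : forall n, 'M[R]_n * 'M[R]_n -> 'S_n, estimator est2 /\
    forall n, (P n [set w | q n (pistar2 n w) (second hm (est n (X n w)))] <=
               P n [set w | q n (pistar2 n w) (est2 n (X1Y n w))])%E.
  move=> mest; pose E n := cid (aggregate_event hm (hX n) (mest n) (q n)).
  exists (fun n => projT1 (E n)); split=> n; first by have [] := projT2 (E n).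
  by have [] := projT2 (E n).
have mX1Y n : measurable_fun setT (X1Y n) := measurable_graph1_aggregate hm (hX n).
have mpi2 n : fin_measurable (pistar2 n) := fin_measurable_second hm (hX n).
have mest2 est2 (A : forall n, 'S_n -> 'S_n -> Prop) : estimator est2 -> forall n,
    measurable [set w | A n (pistar2 n w) (est2 n (X1Y n w))].
  move=> mest n; apply: (pair_event (mpi2 n) _ (A n)).
  exact: (fin_measurable_comp (mX1Y n) (mest n)).
have mest1 est (A : forall n, alignment m n -> alignment m n -> Prop) : estimator est ->
    forall n, measurable [set w | A n (pistar n w) (est n (X n w))].
  move=> mest n; exact: (measurable_estimate_event (hX n) (mest n)).
have transfer est (p : forall n, alignment m n -> alignment m n -> Prop)
    (q : forall n, 'S_n -> 'S_n -> bool) : estimator est ->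
    with_high_probability P (fun n => [set w | p n (pistar n w) (est n (X n w))]) ->
    (forall n a b, p n a b -> q n (second hm a) (second hm b)) ->
    exists est2, estimator est2 /\
      with_high_probability P (fun n => [set w | q n (pistar2 n w) (est2 n (X1Y n w))]).
  move=> mest whp pq; have [est2 [mest_2 le2]] := event est q mest.
  exists est2; split=> //; apply: (whp_le (mest2 est2 q mest_2) _ whp).
  move=> n; apply: le_trans _ (le2 n); apply: le_measure; rewrite ?inE.
  - exact: (mest1 est p mest).
  - exact: (mest1 est (fun n a b => q n (second hm a) (second hm b)) mest).
  - by move=> w; exact: pq.
split.
- apply: contra_not => -[est [mest whp]].
  have pq n (a b : alignment m n) : ov n a b = 1 -> ov2 n (second hm a) (second hm b) == 1.
    by move=> ab1; rewrite eq_le overlap_perm_le1 -[X in X <= _]ab1 ov_le.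
  have [est2 [mest_2 whp2]] := transfer est _ (fun n s t => ov2 n s t == 1) mest whp pq.
  exists est2; split=> //.
  apply: (whp_le (mest2 est2 (fun n s t => ov2 n s t = 1) mest_2) _ whp2) => n.
  rewrite le_eqVlt; apply/orP; left; apply/eqP; congr (P n _).
  by apply/seteqP; split => w /eqP.
- apply: contra_not => -[est [mest whp]].
  pose E n := cid (aggregate_mean_score hm (hX n) (mest n)).
  have mE n : fin_measurable (projT1 (E n)) by have [] := projT2 (E n).
  have leE n := (projT2 (E n)).2.
  exists (fun n => projT1 (E n)); split=> // eps e0.
  have mB := mest2 _ (fun n s t => 1 - eps <= ov2 n s t) mE.
  apply: (whp_fineP P mB).2 => e' e'0.
  (* The mean overlap will be at least [(1 - delta)^2 >= 1 - 2 delta], while Markov's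
     inequality asks for [1 - eps e']. *)
  pose delta : R := Num.min (eps * e' / 4) (1 / 2).
  have d0 : 0 < delta by rewrite lt_min divr_gt0 ?mulr_gt0//.
  have d1 : delta <= 1 by rewrite ge_min; apply/orP; right; lra.
  have de : delta <= eps * e' / 4 by rewrite ge_min lexx.
  have mA := mest1 est (fun n a b => 1 - delta <= ov n a b) mest.
  have := (whp_fineP P mA).1 (whp delta d0) delta d0.
  apply: filterS => n /= hn.
  have : eps * (1 - fine (P n [set w | 1 - eps <= ov2 n (pistar2 n w) (projT1 (E n) (X1Y n w))])) <= eps * e'.
    apply: le_trans (leE n eps delta e0 d1) _.
    apply: (@le_trans _ _ (1 - (1 - delta) * (1 - delta))).
      by rewrite lerD2l lerN2 ler_wpM2l ?subr_ge0.
    by have := sqr_ge0 delta; lra.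
  by rewrite ler_pM2l//; lra.
- apply: contra_not => -[est [mest [c [c0 whp]]]].
  have pq n (a b : alignment m n) : c <= ov n a b -> c <= ov2 n (second hm a) (second hm b).
    by move=> cab; apply: le_trans cab (ov_le _ _ _).
  have [est2 [mest_2 whp2]] := transfer est _ (fun n s t => c <= ov2 n s t) mest whp pq.
  by exists est2; split=> //; exists c.
- move=> intract score est mest eps e0.
  have [est2 [mest_2 le2]] := event est (fun n s t => eps < ov2 n s t) mest.
  have mle := mest1 est (fun n a b => ov n a b <= eps) mest.
  apply: (whp_le mle _ (intract est2 mest_2 eps e0)) => n.
  have m2 := mest2 est2 (fun n s t => eps < ov2 n s t) mest_2 n.
  have m1 := mest1 est (fun n a b => eps < ov2 n (second hm a) (second hm b)) mest n.
  set A := [set w | _ < _] in m2; set B := [set w | _ < _] in m1.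
  apply: (@le_trans _ _ (P n (~` B))); last first.
    apply: le_measure; rewrite ?inE//; first exact: measurableC.
    by move=> w /= /negP; rewrite -leNgt; apply: le_trans (ov_le _ _ _).
  apply: (@le_trans _ _ (P n (~` A))).
    apply: le_measure; rewrite ?inE//; first exact: (mest2 est2 (fun n s t => ov2 n s t <= eps) mest_2 n).
      exact: measurableC.
    by move=> w /=; rewrite leNgt => /negP.
  by rewrite !probability_setC// leeB//; exact: le2.
Qed.
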